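(* For real-valued $q\in L^1[0,1]$, extended by $q(x)=0$ for $x>1$, let $u$ solve $$u_{tt}=u_{xx}-q(x)u,\quad x\ge0,\ t\ge0;\qquad u=u_t=0\ \text{ at } t=0;\qquad u(0,t)=\delta(t),$$ where $\delta$ is the delta-function, and let $a(t):=u(1,t)$, $t>0$. The inverse problem of finding $q$ from $\{a(t):t>0\}$ has at most one solution: if two such potentials $q_1,q_2$ produce the same $a(t)$ for all $t>0$, then $q_1=q_2$ almost everywhere.
   Context: The problem is understood in the sense of distributions, $u$ being the (causal) solution, with $u=0$ for $t<0$. *)

(* Defs.v *)
From HB Require Import structures.
From mathcomp Require Import all_boot all_order all_algebra.
From mathcomp Require Import all_classical all_reals all_analysis.

Set Implicit Arguments.
Unset Strict Implicit.
Unset Printing Implicit Defensive.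

Import Order.TTheory GRing.Theory Num.Theory.
Import numFieldNormedType.Exports.

Local Open Scope classical_set_scope.
Local Open Scope ring_scope.

Definition tsupp (R : realType) (V : topologicalType) (f : V -> R) : set V :=
  closure [set z | f z != 0].

Definition test_fun1 (R : realType) (chi : R -> R) : Prop :=
  (forall (n : nat) (t : R), derivable (chi^`(n))%classic t 1) /\ compact (tsupp chi).

(* Functions of the two variables (x, t) are curried, so that [phi x] is the
   function of t obtained by freezing x. *)
Definition partial_x (R : realType) (phi : R -> R -> R) : R -> R -> R :=
  fun x t => (fun y => phi y t)^`()%classic x.

Definition partial_t (R : realType) (phi : R -> R -> R) : R -> R -> R :=
  fun x t => (phi x)^`()%classic t.

Fixpoint class_C2d (R : realType) (n : nat) (phi : R -> R -> R) : Prop :=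
  continuous (fun z : R * R => phi z.1 z.2) /\
  match n with
  | 0%N => True
  | m.+1 =>
      [/\ forall x t : R, derivable (fun y => phi y t) x 1,
          forall x t : R, derivable (phi x) t 1,
          class_C2d m (partial_x phi)
        & class_C2d m (partial_t phi)]
  end.

Definition test_fun2 (R : realType) (phi : R -> R -> R) : Prop :=
  (forall n : nat, class_C2d n phi) /\
  compact (tsupp (fun z : R * R => phi z.1 z.2)).

(* An element of D'(R).  Only the values of T at test functions are meaningful.
   Continuity is the usual finite-order estimate on each compact set. *)
Definition distribution1 (R : realType) (T : (R -> R) -> R) : Prop :=
  (forall (c : R) (chi psi : R -> R), test_fun1 chi -> test_fun1 psi ->
     T (fun t => c * chi t + psi t) = c * T chi + T psi) /\
  (forall K : set R, compact K ->
     exists (C : R) (N : nat), forall chi : R -> R,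
       test_fun1 chi -> tsupp chi `<=` K ->
       `|T chi| <= C * \sum_(k < N.+1) sup (range (fun t => `|(chi^`(k))%classic t|))).

Definition eq_distr_on (R : realType) (A : set R) (S T : (R -> R) -> R) : Prop :=
  forall chi : R -> R, test_fun1 chi -> tsupp chi `<=` A -> S chi = T chi.

Definition extend0 (R : realType) (q : R -> R) : R -> R :=
  fun x => if 0 <= x <= 1 then q x else 0.

(* A distributional solution is a family x |-> u(x, .) in D'(R_t), weakly
   continuous on x >= 0: this gives a meaning both to the traces u(0, .) and
   u(1, .) and to the product q u for q merely integrable.  The zero Cauchy
   data at t = 0 are encoded, as usual, by extending u by zero to t < 0 and
   requiring the equation on the whole of ]0, +oo[ x R: nonzero values of u or
   u_t at t = 0 would produce source terms in delta'(t) and delta(t). *)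
Record causal_solution (R : realType) (q : R -> R) (u : R -> (R -> R) -> R)
    : Prop := CausalSolution {
  sol_distribution : forall x : R, 0 <= x -> distribution1 (u x) ;
  sol_continuous : forall chi : R -> R, test_fun1 chi ->
    {within `[0, +oo[, continuous (fun x => u x chi)} ;
  sol_equation : forall phi : R -> R -> R, test_fun2 phi ->
    tsupp (fun z : R * R => phi z.1 z.2) `<=` [set z | 0 < z.1] ->
    (\int[lebesgue_measure]_(x in `]0, +oo[)
      (u x (partial_t (partial_t phi) x) - u x (partial_x (partial_x phi) x)
       + extend0 q x * u x (phi x)) = 0)%R ;
  sol_causal : forall x : R, 0 <= x ->
    eq_distr_on `]-oo, 0[ (u x) (fun _ => 0) ;
  sol_boundary : eq_distr_on setT (u 0) (fun chi => chi 0)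
}.

(* Main.v *)
(* Mollifying in time turns the solution [u] into smooth functions [v = u * b] that solve
   [v_xx = v_tt + q v] as an evolution in [x] with Cauchy data on [x = 0].  They are compared,
   through Green's identities on strips [0, 1] x [-T, T], with the solutions [phi] of the same
   equation satisfying [phi = 0] and [phi_x = gamma] on [x = 0], for test functions [gamma].
   Since [u] vanishes in the past and [q = 0] beyond [x = 1], [v] is outgoing:
   [v_x + v_t = 0] at [x = 1].  Hence [A * Phi = b * gamma], where [A = v(1, .)] and
   [Phi = phi_t + phi_x] at [x = 1].  Finite propagation speed and the data determine [A], so
   [A * (Phi1 - Phi2) = 0]; convolving with a second response, for which
   [A * Phi1 = b * g], and letting [b] and [g] concentrate gives [Phi1 = Phi2].

   For odd [gamma], [phi_t] is even and [phi_x] is odd in [t], so the two potentials give the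
   same Cauchy data at [x = 1], and Green's identity for [phi1] and a reflected [phi2] yields
   [int_0^1 (q1 - q2)(x) (phi1 * phi2)(x, s) dx = 0] for all [s].  Take [gamma = c'] with [c]
   an approximate delta: [phi] is [(c(t + x) - c(t - x)) / 2] up to a bounded error
   supported in [|t| <= x], so that
   [phi1 * phi2] at [s = 2 y] is [(c * c)(2 y - 2 x) / 4] up to a bounded error that
   vanishes for [x < y].  At a Lebesgue point this gives
   [|q1 - q2|(y) <= C int_y^1 |q1 - q2|], and Gronwall's argument concludes. *)
Require Import Defs.
From HB Require Import structures.
From mathcomp Require Import all_boot all_order all_algebra.
From mathcomp Require Import all_classical all_reals all_analysis.
From mathcomp Require Import measurable_realfun.
From mathcomp Require Import ring lra zify.

Import Order.TTheory GRing.Theory Num.Theory.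
Import numFieldNormedType.Exports.

Local Open Scope classical_set_scope.
Local Open Scope ring_scope.

Set Implicit Arguments.
Unset Strict Implicit.
Unset Printing Implicit Defensive.


(** * Calculus on the line *)

(** With [q] only integrable, [v_xx] is not continuous in [x] and no identity is obtained by
    differentiating twice in [x]. All dependence on [x] is kept as increments: remainders over
    [[x, y]] are bounded by multiples of [(y - x) * (N y - N x)], where [N] dominates a primitive of
    [1 + |q|], and such remainders disappear under summation ([quad_const]). The hypotheses give
    only weak continuity in [x]; the bounds for [v] on compact sets, on which these remainders rest,
    come from a uniform boundedness argument.

    The data are known for [t > 0] only, while [A] averages over a time interval of half-width
    [eps]; the vanishing of [A] before [1 - eps] leaves no gap near [t = 0]. [A] is never inverted:
    [A * Phi1 = b * g] exhibits a multiple of it, for convolution, that is an approximate delta.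

    The data [gamma = c'] blow up as [c] concentrates, but the distance from [phi] to the free
    solution is governed by the mass of [c], which stays 1. This is why the constant in Gronwall's
    inequality does not depend on the width of [c]. *)

Definition der (R : realType) (f g : R -> R) : Prop :=
  forall t : R, is_derive t 1 f (g t).

Section Calculus.
Context {R : realType}.
Implicit Types (f g : R -> R) (a b c t x y : R).

Lemma le_div_nat_eq0 (x C : R) : (forall n, `|x| <= C / n.+1%:R) -> x = 0.
Proof.
move=> H; apply/eqP; rewrite -normr_le0 leNgt; apply/negP => x0.
have C0 : 0 < C by apply: lt_le_trans x0 _; have := H 0; rewrite divr1.
have [n] : exists n, C / `|x| < n%:R.
  by exists (Num.bound (C / `|x|)); rewrite archi_boundP// divr_ge0 ?ltW.
case: n => [|n]; first by rewrite ltNge divr_ge0 ?ltW.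
rewrite ltr_pdivrMr// => Cn.
have := H n; rewrite ler_pdivlMr// mulrC; lra.
Qed.

(* The increments of [D] are of second order, so they vanish when summed over
   finer and finer partitions. *)
Lemma quad_const (D N : R -> R) a b : a <= b ->
  (forall x y, a <= x -> x <= y -> y <= b ->
    `|D y - D x| <= (y - x) * (N y - N x)) ->
  D b = D a.
Proof.
move=> ab H; apply/eqP; rewrite -subr_eq0; apply/eqP.
apply: (@le_div_nat_eq0 _ ((b - a) * (N b - N a))) => n.
pose h := (b - a) / n.+1%:R.
have h0 : 0 <= h by rewrite divr_ge0// subr_ge0.
have Hi i : (i <= n.+1)%N ->
    a + i%:R * h <= b /\ `|D (a + i%:R * h) - D a| <= h * (N (a + i%:R * h) - N a).
  elim: i => [_|i IH ilt]; first by rewrite mul0r addr0 !subrr normr0 mulr0; split.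
  have [_ IHi] := IH (ltnW ilt).
  have le : a + i.+1%:R * h <= b.
    rewrite -lerBrDl; apply: (@le_trans _ _ (n.+1%:R * h)).
      by rewrite ler_wpM2r// ler_nat.
    by rewrite /h mulrC divfK// pnatr_eq0.
  split=> //.
  have := H (a + i%:R * h) (a + i.+1%:R * h).
  rewrite lerDl mulr_ge0// => /(_ isT); rewrite lerD2l ler_wpM2r// ?ler_nat//.
  move=> /(_ isT le).
  have -> : a + i.+1%:R * h - (a + i%:R * h) = h by rewrite -natr1; ring.
  move: IHi; rewrite !ler_norml => /andP[? ?] /andP[? ?].
  by apply/andP; split; lra.
have [_] := Hi n.+1 (leqnn _).
have -> : a + n.+1%:R * h = b by rewrite /h mulrC divfK ?pnatr_eq0//; ring.
by move=> /le_trans; apply; rewrite /h mulrAC.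
Qed.

Lemma der_ext f g g' : der f g -> g =1 g' -> der f g'.
Proof. by move=> H e t; rewrite -e. Qed.

Lemma derD f f' g g' : der f f' -> der g g' ->
  der (fun t => f t + g t) (fun t => f' t + g' t).
Proof. by move=> Hf Hg t; apply: is_deriveD. Qed.

Lemma derN f f' : der f f' -> der (fun t => - f t) (fun t => - f' t).
Proof. by move=> Hf t; apply: is_deriveN. Qed.

Lemma derB f f' g g' : der f f' -> der g g' ->
  der (fun t => f t - g t) (fun t => f' t - g' t).
Proof. by move=> Hf Hg; apply: derD => //; apply: derN. Qed.

Lemma der_cst c : der (fun=> c) (fun=> 0).
Proof. by move=> t; apply: is_derive_cst. Qed.

Lemma derZ c f f' : der f f' -> der (fun t => c * f t) (fun t => c * f' t).
Proof. by move=> Hf t; apply: is_deriveZ. Qed.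

Lemma derM f f' g g' : der f f' -> der g g' ->
  der (fun t => f t * g t) (fun t => f' t * g t + f t * g' t).
Proof.
move=> Hf Hg t; have := is_deriveM (Hf t) (Hg t).
by move/is_derive_eq; apply; rewrite addrC [X in X + _]mulrC.
Qed.

Lemma der_affine c d : der (fun t => c * t + d) (fun=> c).
Proof.
move=> t; have H := derD (derZ c (fun t => is_derive_id t 1)) (der_cst d).
by have := H t; move/is_derive_eq; apply; rewrite mulr1 addr0.
Qed.

Lemma der_comp f f' g g' : der f f' -> der g g' ->
  der (fun t => f (g t)) (fun t => f' (g t) * g' t).
Proof. by move=> Hf Hg t; apply: (is_derive1_comp (Hf (g t)) (Hg t)). Qed.

Lemma der_shift f f' c : der f f' -> der (fun t => f (t + c)) (fun t => f' (t + c)).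
Proof.
move=> Hf; have := der_comp Hf (der_affine 1 c).
move=> H t; have := H t; under [X in is_derive _ _ X]eq_fun do rewrite mul1r.
by move/is_derive_eq; apply; rewrite mulr1 mul1r.
Qed.

Lemma der_refl f f' c : der f f' -> der (fun t => f (c - t)) (fun t => - f' (c - t)).
Proof.
move=> Hf; have := der_comp Hf (der_affine (-1) c).
move=> H t; have := H t.
under [X in is_derive _ _ X]eq_fun do rewrite mulN1r addrC.
by move/is_derive_eq; apply; rewrite mulrN1 mulN1r addrC.
Qed.

(** A quadratic remainder is the form in which derivatives outside the elementary rules are found
    below: under an integral sign, of a convolution with a distribution, of a series, of a solution
    in terms of its datum. *)
Lemma is_derive_quad f t (d M : R) :
  (forall h, `|h| <= 1 -> `|f (t + h) - f t - h * d| <= M * h ^+ 2) ->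
  is_derive t 1 f d.
Proof.
move=> H.
have M0 : 0 <= M.
  by have := H 1; rewrite normr1 lexx expr1n mulr1 => /(_ isT); apply: le_trans.
have key : h^-1 *: ((f \o shift t) (h *: (1:R)) - f t) @[h --> 0^'] --> d.
  apply/cvgrPdist_le => e e0; near=> h.
  have h0 : h != 0 by near: h; exact: nbhs_dnbhs_neq.
  have h1 : `|h| <= 1.
    by near: h; exact: dnbhs0_le.
  have h2 : `|h| <= e / (M + 1).
    by near: h; apply: dnbhs0_le; rewrite divr_gt0// ltr_wpDl.
  rewrite /= /shift /=.
  have -> : d - h^-1 *: (f (h *: (1:R) + t) - f t)
      = - (h^-1 * (f (t + h) - f t - h * d)).
    by rewrite /GRing.scale /= mulr1 (addrC h t); field.
  rewrite normrN normrM normfV ler_pdivrMl ?normr_gt0//.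
  apply: (le_trans (H h h1)).
  rewrite -real_normK ?num_real// expr2 mulrA mulrC ler_wpM2l//.
  apply: (@le_trans _ _ ((M + 1) * `|h|)); first by rewrite ler_wpM2r// lerDl.
  by rewrite mulrC -ler_pdivlMr// ltr_wpDl.
by split; [apply/cvg_ex; exists d | apply: cvg_lim].
Unshelve. all: by end_near. Qed.

Lemma is_derive_continuous f t d : is_derive t 1 f d -> {for t, continuous f}.
Proof. by case=> H _; apply: differentiable_continuous; apply/derivable1_diffP. Qed.

Lemma der_continuous f g : der f g -> continuous f.
Proof. by move=> H t; apply: is_derive_continuous (H t). Qed.

Lemma der_MVT f g a b : der f g -> a <= b ->
  exists2 c, a <= c <= b & f b - f a = g c * (b - a).
Proof.
move=> H ab; have [|c] := @MVT_segment _ f g a b ab (fun x _ => H x).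
  by apply: continuous_subspaceT; exact: der_continuous H.
by rewrite in_itv/= => ? ?; exists c.
Qed.

Lemma der_nondecr f g a b : der f g -> a <= b ->
  (forall t, a <= t <= b -> 0 <= g t) -> f a <= f b.
Proof.
move=> H ab g0; have [c cab e] := der_MVT H ab.
by rewrite -subr_ge0 e mulr_ge0 ?g0// subr_ge0.
Qed.

Lemma der_lip f g M a b : der f g -> a <= b ->
  (forall t, a <= t <= b -> `|g t| <= M) -> `|f b - f a| <= M * (b - a).
Proof.
move=> H ab gM; have [c cab ->] := der_MVT H ab.
by rewrite normrM (@ger0_norm _ (b - a)) ?subr_ge0// ler_wpM2r ?gM// subr_ge0.
Qed.

Lemma der_lip_ball f g M T x y : der f g -> (forall t, `|t| <= T -> `|g t| <= M) ->
  `|x| <= T -> `|y| <= T -> `|f y - f x| <= M * `|y - x|.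
Proof.
move=> H gM; wlog xy : x y / x <= y.
  move=> W xT yT; have [|/ltW] := leP x y; first by move=> ?; exact: W.
  by move=> ?; rewrite distrC (distrC y); exact: W.
rewrite (ler_norml x) (ler_norml y) => /andP[? ?] /andP[? ?].
rewrite (@ger0_norm _ (y - x)) ?subr_ge0//; apply: der_lip H xy _ => t /andP[? ?].
by apply: gM; rewrite ler_norml; apply/andP; split; lra.
Qed.

Lemma der0_cst f : der f (fun=> 0) -> forall x y, f x = f y.
Proof.
move=> H x y; apply/eqP; rewrite -subr_eq0 -normr_le0.
have := @der_lip_ball f _ 0 (`|x| + `|y|) y x H.
rewrite mul0r; apply; rewrite ?lerDl ?lerDr// => t _.
by rewrite normr0.
Qed.

Lemma der_unique f g h : der f g -> der f h -> g =1 h.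
Proof. by move=> Hg Hh t; have [_ <-] := Hg t; have [_ <-] := Hh t. Qed.

Lemma taylor1 f g h M T x y : der f g -> der g h ->
  (forall t, `|t| <= T -> `|h t| <= M) -> `|x| <= T -> `|y| <= T ->
  `|f y - f x - (y - x) * g x| <= M * (y - x) ^+ 2.
Proof.
move=> Hf Hg hM xT yT.
have Hk : der (fun t => f t - (t - x) * g x) (fun t => g t - g x).
  apply: der_ext (derB Hf (derM (derD (fun t => is_derive_id t 1) (der_cst (- x)))
    (der_cst (g x)))) _ => t /=.
  by rewrite addr0 mul1r mulr0 addr0.
have -> : f y - f x - (y - x) * g x
    = (f y - (y - x) * g x) - (f x - (x - x) * g x) by ring.
have M0 : 0 <= M by apply: le_trans (hM x xT).
pose A := Num.min x y; pose B := Num.max x y.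
have bd t : A <= t <= B -> `|g t - g x| <= M * `|y - x|.
  move=> tAB; have tT : `|t| <= T /\ `|t - x| <= `|y - x|.
    move: tAB xT yT; rewrite /A /B ge_min le_max => /andP[]; rewrite !ler_norml.
    case/orP=> ?; case/orP=> ?; move=> /andP[? ?] /andP[? ?];
    have := ler_norm (y - x); have := ler_norm (x - y); rewrite distrC => ? ?;
    by split; apply/andP; split; lra.
  apply: (le_trans (der_lip_ball Hg hM xT tT.1)).
  by rewrite ler_wpM2l// tT.2.
have [xy|/ltW xy] := leP x y.
  have := @der_lip _ _ (M * `|y - x|) _ _ Hk xy.
  rewrite {1}/A {1}/B min_l// max_r// in bd => /(_ bd) /=.
  by rewrite (@ger0_norm _ (y - x)) ?subr_ge0// -mulrA -expr2.
have := @der_lip _ _ (M * `|y - x|) _ _ Hk xy.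
rewrite {1}/A {1}/B min_r// max_l// in bd => /(_ bd) /=.
by rewrite distrC [in leRHS]distrC (@ger0_norm _ (x - y)) ?subr_ge0// -mulrA -expr2 -(opprB y) sqrrN.
Qed.

(** The Lebesgue integral from a base point is a primitive only to the right of that point.
    Integrals based at [-n], normalised to vanish at [0], agree wherever two of them are meaningful,
    so they glue to a primitive on the whole line. *)
Lemma exists_primitive f : continuous f -> exists F, der F f.
Proof.
move=> cf; pose mu := @lebesgue_measure R.
pose I (a y : R) := (\int[mu]_(t in `]a, y]) f t)%R.
have intf a y : mu.-integrable `]a, y] (EFin \o f).
  apply: (@integrableS _ _ _ mu `[a, y]) => //.
    by apply: subset_itvr; rewrite bnd_simp.
  apply: continuous_compact_integrable; first exact: segment_compact.
  exact: continuous_subspaceT.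
pose G (n : nat) y := I (- n%:R) y - I (- n%:R) 0.
have GG n m y : (n <= m)%N -> - n%:R < y -> G n y = G m y.
  move=> nm ny; rewrite /G.
  have mn : - m%:R <= - n%:R :> R by rewrite lerN2 ler_nat.
  have E z : - n%:R <= z -> I (- n%:R) z = I (- m%:R) z - I (- m%:R) (- n%:R).
    by move=> nz; rewrite /I Rintegral_itvB ?bnd_simp.
  have n0 : - n%:R <= 0 :> R by rewrite oppr_le0.
  by rewrite (E _ (ltW ny)) (E _ n0); ring.
have dG n y : - n%:R < y -> is_derive y 1 (G n) (f y).
  move=> ny; have := @continuous_FTC1 _ f (BRight (- n%:R)) y (y + 1).
  rewrite ltrDl ltr01 => /(_ isT (intf _ _)) /=.
  rewrite lte_fin => /(_ ny (cf y))[d1]; rewrite derive1E => d2.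
  have d : is_derive y 1 (I (- n%:R)) (f y).
    exact: DeriveDef d1 d2.
  have := is_deriveB d (is_derive_cst (I (- n%:R) 0) y 1).
  by move/is_derive_eq; apply; rewrite subr0.
pose nn (y : R) := (Num.bound `|y|).+1.
have nnP y : `|y| < (nn y)%:R - 1.
  by rewrite /nn -natr1 addrK archi_boundP.
exists (fun y => G (nn y) y) => y.
(* One more than [nn y], so that [G m] remains meaningful at every [z] within distance 1 of [y],
   where it is compared with [G (nn z)]. *)
pose m := ((nn y)).+1%N.
have [ny1 ny2] : - m%:R < y /\ y < m%:R.
  by have := nnP y; rewrite /m -natr1 ltr_norml => /andP[? ?]; split; lra.
apply: near_eq_is_derive (dG m y ny1).
near=> z.
have zy : `|y - z| < 1 by near: z; apply: cvgr_dist_lt.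
have := nnP z; have := nnP y; move: zy; rewrite !ltr_norml.
move=> /andP[? ?] /andP[? ?] /andP[? ?].
have [le|/ltnW le] := leqP (nn z) m; first by rewrite -(GG (nn z))//; lra.
by apply: GG => //; rewrite /m -natr1; lra.
Unshelve. all: by end_near. Qed.

End Calculus.

(** * Oriented integrals of continuous functions, and Fubini's theorem for Lipschitz kernels *)

Definition primitive (R : realType) (f : R -> R) : R -> R :=
  if pselect (exists F, der F f) is left e then projT1 (cid e) else fun=> 0.

(** As a difference of values of one chosen primitive, the integral obeys the rules of orientation
    and additivity for all [f] and all end points; continuity is called upon only when the integrand
    is inspected. *)
Definition oint (R : realType) (f : R -> R) (a b : R) : R :=
  primitive f b - primitive f a.

Definition lip1 (R : realType) (f : R -> R) : Prop :=
  forall T : R, exists L : R, forall x y, `|x| <= T -> `|y| <= T ->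
    `|f x - f y| <= L * `|x - y|.

Definition lip2 (R : realType) (K : R -> R -> R) : Prop :=
  forall T : R, exists L : R, forall x y x' y',
    `|x| <= T -> `|y| <= T -> `|x'| <= T -> `|y'| <= T ->
    `|K x y - K x' y'| <= L * (`|x - x'| + `|y - y'|).

Section OrientedIntegral.
Context {R : realType}.
Implicit Types (f g F : R -> R) (K : R -> R -> R) (a b c d t x y M T : R).

Lemma oint_FTC F f a b : der F f -> oint f a b = F b - F a.
Proof.
move=> H; rewrite /oint /primitive; case: pselect => [e|]; last by case; exists F.
case: cid => G /= HG.
have := derB HG H; move/der_ext => /(_ (fun=> 0)) => D.
have /(_ a b)/= := der0_cst (D (fun t => subrr _)).
lra.
Qed.

Lemma oint_der f a : continuous f -> der (oint f a) f.
Proof.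
move=> /exists_primitive[F HF] t.
have -> : oint f a = fun b => F b - F a by apply/funext => b; exact: oint_FTC.
have := derB HF (der_cst (F a)); move=> /(_ t)/is_derive_eq; apply.
by rewrite subr0.
Qed.

Lemma oint_chasles f a b c : oint f a b + oint f b c = oint f a c.
Proof. by rewrite /oint; ring. Qed.

Lemma ointxx f a : oint f a a = 0. Proof. by rewrite /oint subrr. Qed.

Lemma oint_sym f a b : oint f a b = - oint f b a.
Proof. by rewrite /oint opprB. Qed.

Lemma ointD f g a b : continuous f -> continuous g ->
  oint (fun t => f t + g t) a b = oint f a b + oint g a b.
Proof.
move=> cf cg.
rewrite (oint_FTC a b (derD (oint_der a cf) (oint_der a cg))) !ointxx; ring.
Qed.

Lemma ointZ c f a b : continuous f -> oint (fun t => c * f t) a b = c * oint f a b.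
Proof.
by move=> cf; rewrite (oint_FTC a b (derZ c (oint_der a cf))) ointxx; ring.
Qed.

Lemma ointN f a b : continuous f -> oint (fun t => - f t) a b = - oint f a b.
Proof.
by move=> cf; rewrite (oint_FTC a b (derN (oint_der a cf))) ointxx; ring.
Qed.

Lemma contN f : continuous f -> continuous (fun t => - f t).
Proof. by move=> cf t; apply: continuousN; exact: cf. Qed.

Lemma contD f g : continuous f -> continuous g -> continuous (fun t => f t + g t).
Proof. by move=> cf cg t; apply: continuousD; [exact: cf|exact: cg]. Qed.

Lemma contB f g : continuous f -> continuous g -> continuous (fun t => f t - g t).
Proof. by move=> cf cg; apply: contD => //; exact: contN. Qed.

Lemma contM f g : continuous f -> continuous g -> continuous (fun t => f t * g t).
Proof. by move=> cf cg t; apply: continuousM; [exact: cf|exact: cg]. Qed.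

Lemma cont_cst c : continuous (fun _ : R => c).
Proof. by move=> t; exact: cst_continuous. Qed.

Lemma cont_comp f g : continuous f -> continuous g -> continuous (fun t => f (g t)).
Proof. by move=> cf cg t; apply: (@continuous_comp _ _ _ g f); [exact: cg|exact: cf]. Qed.

Lemma cont_abs f : continuous f -> continuous (fun t => `|f t|).
Proof. by move=> cf; apply: cont_comp cf; exact: norm_continuous. Qed.

Lemma cont_shift f c : continuous f -> continuous (fun t => f (t + c)).
Proof.
move=> cf; apply: cont_comp => //; apply: contD; last exact: cont_cst.
by move=> t; exact: cvg_id.
Qed.

Lemma cont_refl f c : continuous f -> continuous (fun t => f (c - t)).
Proof.
move=> cf; apply: cont_comp => //; apply: contB; first exact: cont_cst.
by move=> t; exact: cvg_id.
Qed.

Lemma ointB f g a b : continuous f -> continuous g ->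
  oint (fun t => f t - g t) a b = oint f a b - oint g a b.
Proof.
by move=> cf cg; rewrite ointD ?ointN//; exact: contN.
Qed.

Lemma oint0 a b : oint (fun=> 0) a b = 0 :> R.
Proof. by rewrite (oint_FTC a b (der_cst 0)) subrr. Qed.

Lemma oint_ge0 f a b : continuous f -> a <= b -> (forall t, a <= t <= b -> 0 <= f t) ->
  0 <= oint f a b.
Proof.
move=> cf ab f0; rewrite -(ointxx f a); apply: der_nondecr ab f0.
exact: oint_der.
Qed.

Lemma oint_le f g a b : continuous f -> continuous g -> a <= b ->
  (forall t, a <= t <= b -> f t <= g t) -> oint f a b <= oint g a b.
Proof.
move=> cf cg ab fg; rewrite -subr_ge0 -ointB//; apply: oint_ge0 => //.
  exact: contB.
by move=> t /fg; rewrite subr_ge0.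
Qed.

Lemma oint_abs_le f M a b : continuous f -> a <= b ->
  (forall t, a <= t <= b -> `|f t| <= M) -> `|oint f a b| <= M * (b - a).
Proof.
move=> cf ab fM; have := der_lip (oint_der a cf) ab fM.
by rewrite ointxx subr0.
Qed.

Lemma oint_abs_ball f M T a b : continuous f -> (forall t, `|t| <= T -> `|f t| <= M) ->
  `|a| <= T -> `|b| <= T -> `|oint f a b| <= M * `|b - a|.
Proof.
move=> cf fM aT bT; have := der_lip_ball (oint_der a cf) fM aT bT.
by rewrite ointxx subr0.
Qed.

Lemma oint_norm f a b : continuous f -> a <= b ->
  `|oint f a b| <= oint (fun t => `|f t|) a b.
Proof.
move=> cf ab; have ca := cont_abs cf; rewrite ler_norml -ointN//; apply/andP; split.
  by apply: oint_le => //; [exact: contN|move=> t _; rewrite lerNl -normrN ler_norm].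
by apply: oint_le => // t _; exact: ler_norm.
Qed.

Lemma oint_eq f g a b : continuous f -> continuous g -> a <= b ->
  (forall t, a <= t <= b -> f t = g t) -> oint f a b = oint g a b.
Proof.
by move=> cf cg ab fg; apply/eqP; rewrite eq_le !oint_le// => t /fg ->.
Qed.

Lemma oint_eq0 f a b : continuous f -> a <= b ->
  (forall t, a < t < b -> f t = 0) -> oint f a b = 0.
Proof.
move=> cf ab f0; apply/eqP; rewrite -normr_le0.
have H : forall x, x \in `]a, b[ -> is_derive x 1 (oint f a) 0.
  by move=> x; rewrite in_itv/= => /f0 e; rewrite -e; exact: oint_der.
have := @MVT_segment _ (oint f a) (fun=> 0) a b ab H.
case; first by apply: continuous_subspaceT; exact: der_continuous (oint_der a cf).
by move=> c _; rewrite mul0r ointxx subr0 => ->; rewrite normr0.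
Qed.

Lemma oint_shift f c a b : continuous f ->
  oint (fun t => f (t + c)) a b = oint f (a + c) (b + c).
Proof.
move=> cf; rewrite (oint_FTC a b (der_shift c (oint_der 0 cf))).
by rewrite -(oint_chasles f 0 (a + c) (b + c)); ring.
Qed.

Lemma oint_refl f c a b : continuous f ->
  oint (fun t => f (c - t)) a b = oint f (c - b) (c - a).
Proof.
move=> cf; have H := derN (der_refl c (oint_der 0 cf)).
rewrite (@oint_FTC (fun t => - oint f 0 (c - t))); last first.
  by apply: der_ext H _ => t /=; rewrite opprK.
rewrite -(oint_chasles f 0 (c - b) (c - a)); ring.
Qed.

Lemma oint_supp f a b c d : continuous f -> c <= a -> a <= b -> b <= d ->
  (forall t, t < a -> f t = 0) -> (forall t, b < t -> f t = 0) ->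
  oint f c d = oint f a b.
Proof.
move=> cf ca ab bd f1 f2.
rewrite -(oint_chasles f c a d) -(oint_chasles f a b d) (oint_eq0 cf ca); last first.
  by move=> t /andP[_]; exact: f1.
rewrite (oint_eq0 cf bd); first by rewrite add0r addr0.
by move=> t /andP[+ _]; exact: f2.
Qed.

Lemma lip1_continuous f : lip1 f -> continuous f.
Proof.
move=> H t; have [L HL] := H (`|t| + 1); apply/cvgrPdist_le => e e0; near=> s.
have s1 : `|t - s| <= 1 by near: s; apply: cvgr_dist_le.
have s2 : `|t - s| <= e / (`|L| + 1).
  by near: s; apply: cvgr_dist_le => //; rewrite divr_gt0// ltr_wpDl.
apply: (le_trans (HL t s _ _)); first by rewrite lerDl.
  have -> : s = t - (t - s) by ring.
  by apply: (le_trans (ler_normB _ _)); rewrite lerD2l.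
apply: (@le_trans _ _ ((`|L| + 1) * `|t - s|)).
  by rewrite ler_wpM2r//; apply: (le_trans (ler_norm L)); rewrite lerDl.
by rewrite mulrC -ler_pdivlMr// ltr_wpDl.
Unshelve. all: by end_near. Qed.

Lemma der_lip1 f g : der f g -> (forall T, exists M, forall t, `|t| <= T -> `|g t| <= M) ->
  lip1 f.
Proof.
move=> H gM T; have [M HM] := gM T; exists M => x y xT yT.
exact: der_lip_ball H HM yT xT.
Qed.

Lemma lip2_row K x : lip2 K -> lip1 (K x).
Proof.
move=> H T; have [L HL] := H (Num.max `|x| T); exists L => y y' yT y'T.
have := HL x y x y'; rewrite subrr normr0 add0r; apply.
- by rewrite le_max lexx.
- by rewrite le_max yT orbT.
- by rewrite le_max lexx.
- by rewrite le_max y'T orbT.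
Qed.

Lemma lip2_sym K : lip2 K -> lip2 (fun y x => K x y).
Proof.
move=> H T; have [L HL] := H T; exists L => x y x' y' *.
by rewrite [X in L * X]addrC; exact: HL.
Qed.

Lemma lip2_oint K c d : lip2 K -> lip1 (fun x => oint (K x) c d).
Proof.
move=> H T; set T' := `|T| + (`|c| + `|d|); have [L HL] := H T'.
exists (L * `|d - c|) => x y xT yT.
have cK z : continuous (K z) by apply: lip1_continuous; exact: lip2_row.
rewrite -ointB//.
have := @oint_abs_ball (fun t => K x t - K y t) (L * `|x - y|) T' c d.
rewrite mulrAC; apply.
- exact: contB.
- move=> t tT; have := HL x t y t; rewrite subrr normr0 addr0; apply => //;
  apply: (le_trans _ (_ : `|T| <= T')); rewrite ?lerDl ?addr_ge0//.
    exact: le_trans xT (ler_norm _).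
  exact: le_trans yT (ler_norm _).
- by rewrite /T' addrCA lerDl addr_ge0.
- by rewrite /T' addrA lerDr addr_ge0.
Qed.

(** Both sides vanish at [d = c], and as functions of [d] they have the same derivative: the
    Lipschitz bound makes the error of differentiating under the integral quadratic in the
    increment. *)
Lemma oint_swap K a b c d : lip2 K ->
  oint (fun x => oint (K x) c d) a b = oint (fun y => oint (K^~ y) a b) c d.
Proof.
move=> H.
have cK x : continuous (K x) by apply: lip1_continuous; exact: lip2_row.
have cK' y : continuous (K^~ y).
  by apply: lip1_continuous; exact: (lip2_row y (lip2_sym H)).
have cO e e' : continuous (fun x => oint (K x) e e').
  by apply: lip1_continuous; exact: lip2_oint.
have D : der (fun d => oint (fun x => oint (K x) c d) a b) (fun y => oint (K^~ y) a b).
  move=> t; set T := `|t| + 1 + `|a| + `|b|; have [L HL] := H T.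
  apply: (@is_derive_quad _ _ _ _ (`|L| * `|b - a|)) => h h1.
  have tT : `|t| <= T by rewrite /T -!addrA lerDl !addr_ge0.
  have aT : `|a| <= T by rewrite /T -addrA addrCA lerDl !addr_ge0.
  have bT : `|b| <= T by rewrite /T addrC lerDl !addr_ge0.
  have thT s : t - `|h| <= s <= t + `|h| -> `|s| <= T.
    move=> /andP[? ?]; have -> : s = t + (s - t) by ring.
    apply: (le_trans (ler_normD _ _)).
    apply: (@le_trans _ _ (`|t| + 1)); last by rewrite /T -addrA lerDl addr_ge0.
    by rewrite lerD2l; apply: le_trans h1; rewrite ler_norml; apply/andP; split; lra.
  rewrite -ointZ// -!ointB//; last 2 first.
    exact: contB.
    by apply: contM => //; exact: cont_cst.
  have -> : `|L| * `|b - a| * h ^+ 2 = `|L| * `|h| * `|h| * `|b - a|.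
    by rewrite -(real_normK (num_real h)); ring.
  apply: (@oint_abs_ball _ _ T) => //.
    apply: contB; first exact: contB.
    by apply: contM => //; exact: cont_cst.
  move=> x xT.
  have -> : oint (K x) c (t + h) - oint (K x) c t - h * K x t
     = oint (fun s => K x s - K x t) t (t + h).
    rewrite ointB//; last exact: cont_cst.
    rewrite (@oint_FTC (fun s => K x t * s + 0) (fun=> K x t)); last exact: der_affine.
    rewrite -(oint_chasles (K x) c t (t + h)); ring.
  have cc : continuous (fun s => K x s - K x t).
    by apply: contB => //; exact: cont_cst.
  have bd s : t - `|h| <= s <= t + `|h| -> `|K x s - K x t| <= `|L| * `|h|.
    move=> sh; have := HL x s x t xT (thT _ sh) xT tT.
    rewrite subrr normr0 add0r => /le_trans; apply.
    apply: (le_trans (ler_wpM2r _ (ler_norm L))) => //.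
    by rewrite ler_wpM2l//; move: sh => /andP[? ?]; rewrite ler_norml; apply/andP; split; lra.
  have [h0|/ltW h0] := leP 0 h.
    apply: le_trans (oint_abs_le cc (M := `|L| * `|h|) _ _) _; first lra.
      by move=> s sh; apply: bd; rewrite ger0_norm//; lra.
    by rewrite addrAC subrr add0r; rewrite (ger0_norm h0) lexx.
  rewrite oint_sym normrN.
  apply: le_trans (oint_abs_le cc (M := `|L| * `|h|) _ _) _; first lra.
    by move=> s sh; apply: bd; rewrite ler0_norm//; lra.
  by rewrite opprD addrA subrr add0r -(ler0_norm h0) lexx.
rewrite (oint_FTC c d D).
have -> : (fun x => oint (K x) c c) = (fun=> 0).
  by apply/funext => x; rewrite ointxx.
by rewrite oint0 subr0.
Qed.

End OrientedIntegral.

(** * Smooth functions and mollifiers *)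

Record smooth (R : realType) (f : R -> R) : Prop := Smooth {
  smooth_derivable : forall n t, derivable (f^`(n))%classic t 1 }.
Arguments smooth_derivable [R f] _ n t.

Definition csupp (R : realType) (r : R) (f : R -> R) : Prop :=
  forall t : R, r < `|t| -> f t = 0.

Section Smooth.
Context {R : realType}.
Implicit Types (f g : R -> R) (P : set (R -> R)) (r c d x y t : R) (k n : nat).

Lemma der_derive1 f g : der f g -> (f^`())%classic = g.
Proof. by move=> H; apply/funext => t; rewrite derive1E; have [_ ->] := H t. Qed.

(** A coinduction principle: smoothness is proved by exhibiting a family closed under
    differentiation that contains the function, without formulas for higher derivatives. *)
Lemma smooth_class P : (forall f, P f -> exists2 g, P g & der f g) ->
  forall f, P f -> smooth f.
Proof.
move=> H f Pf; split=> n; elim: n f Pf => [|n IH] f Pf t; have [g Pg fg] := H f Pf.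
  by have [] := fg t.
by rewrite derive1Sn (der_derive1 fg); exact: IH.
Qed.

Lemma smooth_der f : smooth f -> der f (f^`())%classic.
Proof. by move=> H t; rewrite derive1E; split => //; exact: (smooth_derivable H 0%N t). Qed.

Lemma smooth_derive1 f : smooth f -> smooth (f^`())%classic.
Proof. by move=> H; split=> n t; rewrite -derive1Sn; exact: smooth_derivable. Qed.

Lemma der_smooth f g : der f g -> smooth g -> smooth f.
Proof.
move=> fg sg; split=> -[|n] t; first by have [] := fg t.
by rewrite derive1Sn (der_derive1 fg); exact: smooth_derivable.
Qed.

Lemma smooth_continuous f : smooth f -> continuous f.
Proof. by move=> /smooth_der/der_continuous. Qed.

Lemma smoothD f g : smooth f -> smooth g -> smooth (fun t => f t + g t).
Proof.
move=> sf sg; apply: (@smooth_class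
  [set h | exists f g, [/\ smooth f, smooth g & h = fun t => f t + g t]]); last by exists f, g.
move=> _ [{sf sg} {}f [{}g [sf sg ->]]].
exists (fun t => (f^`())%classic t + (g^`())%classic t); last exact: derD (smooth_der sf) (smooth_der sg).
by exists (f^`())%classic, (g^`())%classic; split => //; exact: smooth_derive1.
Qed.

Lemma smooth_affine a c d f : smooth f -> smooth (fun t => a * f (c * t + d)).
Proof.
move=> sf; apply: (@smooth_class
  [set h | exists a f, smooth f /\ h = fun t => a * f (c * t + d)]); last by exists a, f.
move=> _ [{}a [{sf} {}f [sf ->]]].
exists (fun t => (a * c) * (f^`())%classic (c * t + d)).
  by exists (a * c), (f^`())%classic; split => //; exact: smooth_derive1.
apply: der_ext (derZ a (der_comp (smooth_der sf) (der_affine c d))) _ => t /=.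
by ring.
Qed.

Lemma smoothZ a f : smooth f -> smooth (fun t => a * f t).
Proof.
move=> /(smooth_affine a 1 0); congr smooth; apply/funext => t.
by rewrite mul1r addr0.
Qed.

Lemma smoothN f : smooth f -> smooth (fun t => - f t).
Proof.
by move=> /(smoothZ (-1)); congr smooth; apply/funext => t; rewrite mulN1r.
Qed.

Lemma smoothB f g : smooth f -> smooth g -> smooth (fun t => f t - g t).
Proof. by move=> sf sg; apply: smoothD => //; exact: smoothN. Qed.

Lemma smooth_shift c f : smooth f -> smooth (fun t => f (t + c)).
Proof.
by move=> /(smooth_affine 1 1 c); congr smooth; apply/funext => t; rewrite !mul1r.
Qed.

Lemma smooth_refl c f : smooth f -> smooth (fun t => f (c - t)).
Proof.
move=> /(smooth_affine 1 (-1) c); congr smooth; apply/funext => t.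
by rewrite !mul1r mulN1r addrC.
Qed.

Lemma csupp_der r f g : csupp r f -> der f g -> csupp r g.
Proof.
move=> sf fg t rt; have [_ <-] := fg t; rewrite -[RHS](@derive_cst _ _ _ 0 t 1).
apply: near_eq_derive; near=> s; apply: sf.
have : `|t - s| < `|t| - r by near: s; apply: cvgr_dist_lt; rewrite // subr_gt0.
have := ler_normD (t - s) s; rewrite subrK; lra.
Unshelve. all: by end_near. Qed.

Lemma csuppW r r' f : r <= r' -> csupp r f -> csupp r' f.
Proof. by move=> rr sf t /(le_lt_trans rr); exact: sf. Qed.

Lemma csupp_compact r f : csupp r f -> tsupp f `<=` `[- r, r] /\ compact (tsupp f).
Proof.
move=> sf; have sub : tsupp f `<=` `[- r, r].
  have cl : closed (`[- r, r] : set R) by exact: itv_closed.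
  rewrite ((closure_id `[- r, r]).1 cl) /tsupp; apply: closure_subset => t /= /eqP ft.
  rewrite in_itv/= -ler_norml leNgt; apply/negP => rt; apply: ft; exact: sf.
split=> //; apply: (subclosed_compact _ (@segment_compact _ (- r) r) sub).
exact: closed_closure.
Qed.

Lemma csupp_test_fun1 r f : smooth f -> csupp r f -> test_fun1 f.
Proof. by move=> [sf] /csupp_compact[]. Qed.

Lemma subset_tsupp f t : f t != 0 -> tsupp f t.
Proof. by move=> ft; exact: subset_closure. Qed.

Lemma test_fun1_csupp f : test_fun1 f -> exists r, csupp r f.
Proof.
move=> [_ /compact_bounded[M [_ HM]]]; exists (M + 1) => t Mt.
apply/eqP; apply: contraTT Mt => /subset_tsupp ft; rewrite -leNgt.
by apply: (HM (M + 1)) => //; rewrite ltrDl.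
Qed.

Lemma continuous_bounded f T : continuous f ->
  exists2 M, 0 <= M & forall t, `|t| <= T -> `|f t| <= M.
Proof.
move=> cf; have /compact_bounded[M [_ HM]] : compact (f @` `[- T, T]).
  apply: continuous_compact; first exact: continuous_subspaceT.
  exact: segment_compact.
exists (`|M| + 1); first by rewrite addr_ge0.
move=> t tT; apply: (HM (`|M| + 1)).
  by apply: (le_lt_trans (ler_norm M)); rewrite ltrDl.
by exists t => //=; rewrite in_itv/= -ler_norml.
Qed.

Lemma csupp_bounded r f : continuous f -> csupp r f -> exists M, forall t, `|f t| <= M.
Proof.
move=> cf sf; have [M M0 HM] := continuous_bounded r cf; exists M => t.
by have [/HM//|/sf ->] := leP `|t| r; rewrite normr0.
Qed.

(** Test functions have this property, and so have their primitives, which lose the compact support.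
    Data of the form [gam = c'] are later treated through the primitive [c]. *)
Record bsmooth f : Prop := BSmooth {
  bsmooth_smooth : smooth f ;
  bsmooth_bounded : forall n, exists M, forall t, `|(f^`(n))%classic t| <= M }.

Lemma bsmooth_class P :
  (forall f, P f -> (exists M, forall t, `|f t| <= M) /\ exists2 g, P g & der f g) ->
  forall f, P f -> bsmooth f.
Proof.
move=> H f Pf; split; first by apply: smooth_class Pf => h /H[].
move=> n; elim: n f Pf => [|n IH] f Pf; have [bf [g Pg fg]] := H f Pf; first exact: bf.
by have [M HM] := IH g Pg; exists M => t; rewrite derive1Sn (der_derive1 fg).
Qed.

Lemma bsmooth_bound f : bsmooth f -> exists2 M, 0 <= M & forall t, `|f t| <= M.
Proof.
move=> [_ /(_ 0%N)[M HM]]; exists M => //; exact: le_trans (normr_ge0 _) (HM 0).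
Qed.

Lemma bsmooth_derive1 f : bsmooth f -> bsmooth (f^`())%classic.
Proof.
move=> [sf bf]; split; first exact: smooth_derive1.
by move=> n; have [M HM] := bf n.+1; exists M => t; rewrite -derive1Sn.
Qed.

Lemma bsmooth_der f : bsmooth f -> der f (f^`())%classic.
Proof. by move=> [sf _]; exact: smooth_der. Qed.

Lemma der_bsmooth f g : der f g -> bsmooth g -> (exists M, forall t, `|f t| <= M) ->
  bsmooth f.
Proof.
move=> fg [sg bg] bf; split; first exact: der_smooth sg.
by case=> // n; have [M HM] := bg n; exists M => t; rewrite derive1Sn (der_derive1 fg).
Qed.

Lemma bsmooth_lin a b c d e f g : bsmooth f -> bsmooth g ->
  bsmooth (fun t => a * f (c * t + d) + b * g (t + e)).
Proof.
move=> bf bg; apply: (@bsmooth_class [set h | exists a b f g,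
  [/\ bsmooth f, bsmooth g & h = fun t => a * f (c * t + d) + b * g (t + e)]]); last first.
  by exists a, b, f, g.
move=> _ [{}a [{}b [{bf}f [{bg}g [bf bg ->]]]]]; split.
  have [M M0 HM] := bsmooth_bound bf; have [M' M'0 HM'] := bsmooth_bound bg.
  exists (`|a| * M + `|b| * M') => t; apply: (le_trans (ler_normD _ _)).
  by rewrite !normrM lerD// ler_wpM2l.
exists (fun t => (a * c) * (f^`())%classic (c * t + d) + b * (g^`())%classic (t + e)).
  exists (a * c), b, (f^`())%classic, (g^`())%classic.
  by split => //; exact: bsmooth_derive1.
apply: der_ext (derD (derZ a (der_comp (bsmooth_der bf) (der_affine c d)))
  (derZ b (der_shift e (bsmooth_der bg)))) _ => t /=.
by ring.
Qed.

Lemma bsmooth_shift e f : bsmooth f -> bsmooth (fun t => f (t + e)).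
Proof.
move=> bf; have := bsmooth_lin 0 1 0 0 e bf bf; congr bsmooth.
by apply/funext => t; rewrite mul0r add0r mul1r.
Qed.

Lemma bsmoothZD a f g : bsmooth f -> bsmooth g -> bsmooth (fun t => a * f t + g t).
Proof.
move=> bf bg; have := bsmooth_lin a 1 1 0 0 bf bg; congr bsmooth.
by apply/funext => t; rewrite !mul1r !addr0.
Qed.

Lemma bsmooth_refl c f : bsmooth f -> bsmooth (fun t => f (c - t)).
Proof.
move=> bf; have := bsmooth_lin 1 0 (-1) c 0 bf bf; congr bsmooth.
by apply/funext => t; rewrite mul0r addr0 mul1r mulN1r addrC.
Qed.

Lemma csupp_bsmooth r f : smooth f -> csupp r f -> bsmooth f.
Proof.
move=> sf cf; apply: (@bsmooth_class [set f | smooth f /\ csupp r f]) => // g [sg cg].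
split; first exact: csupp_bounded (smooth_continuous sg) cg.
exists (g^`())%classic; last exact: smooth_der.
by split; [exact: smooth_derive1|exact: csupp_der cg (smooth_der sg)].
Qed.

Lemma bsmooth_taylor f : bsmooth f -> exists2 M, 0 <= M & forall t h,
  `|f (t + h) - f t - h * (f^`())%classic t| <= M * h ^+ 2.
Proof.
move=> bf; have bf1 := bsmooth_derive1 bf.
have [M M0 HM] := bsmooth_bound (bsmooth_derive1 bf1); exists M => // t h.
have := @taylor1 _ _ _ _ M (`|t| + `|h|) t (t + h) (bsmooth_der bf) (bsmooth_der bf1).
rewrite (addrAC t) subrr add0r; apply => //; first by rewrite lerDl.
exact: ler_normD.
Qed.

Lemma bsmooth_lip f : bsmooth f -> exists2 M, 0 <= M & forall x y,
  `|f x - f y| <= M * `|x - y|.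
Proof.
move=> bf; have [M M0 HM] := bsmooth_bound (bsmooth_derive1 bf); exists M => // x y.
apply: (@der_lip_ball _ _ _ _ (`|x| + `|y|) _ _ (bsmooth_der bf)) => //.
  by rewrite lerDr.
by rewrite lerDl.
Qed.

Lemma bsmooth_primitive r f : smooth f -> csupp r f -> bsmooth (oint f (- r)).
Proof.
move=> sf cf; have cF := smooth_continuous sf.
apply: (der_bsmooth (oint_der _ cF) (csupp_bsmooth sf cf)).
have [r0|r0] := ltP r 0.
  exists 0 => t; have -> : f = fun=> 0.
    by apply/funext => s; apply: cf; apply: lt_le_trans r0 _.
  by rewrite oint0 normr0.
have [M M0 HM] := @continuous_bounded (oint f (- r)) r (der_continuous (oint_der _ cF)).
exists M => t; have [|] := leP `|t| r; first exact: HM.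
have sl s : s < - r -> f s = 0 by move=> sr; apply: cf; rewrite ltr_normr; apply/orP; right; lra.
have sr s : r < s -> f s = 0 by move=> sr; apply: cf; rewrite ltr_normr sr.
rewrite ltr_normr => /orP[rt|rt].
  rewrite (@oint_supp _ f (- r) r)//; [|lra|exact: ltW].
  by apply: HM; rewrite ger0_norm.
rewrite oint_sym oint_eq0 ?oppr0 ?normr0//; first lra.
by move=> s /andP[_]; exact: sl.
Qed.

End Smooth.

(** * Bump functions, mollifiers and localisation *)

Section Bump.
Context {R : realType}.
Implicit Types (f g rho : R -> R) (r c d x y t : R) (k n : nat).

(** The derivatives of [exp (-1/x)], extended by zero, are linear combinations of these functions:
    the family is closed under differentiation up to combinations. *)
Definition flat k x : R := if 0 < x then x^-1 ^+ k * expR (- x^-1) else 0.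

(** From [y^(k+2) / (k+2)! <= exp y] at [y = 1/x]. The square of [x] is what [is_derive_quad] asks
    for at the junction [x = 0]. *)
Lemma flat_le k x : `|flat k x| <= (k.+2)`!%:R * x ^+ 2.
Proof.
rewrite /flat; case: ifPn => x0; last by rewrite normr0 mulr_ge0// sqr_ge0.
have y0 : 0 <= x^-1 by rewrite invr_ge0 ltW.
rewrite ger0_norm; last by rewrite mulr_ge0 ?expR_ge0// exprn_ge0.
rewrite expRN ler_pdivrMr ?expR_gt0//.
have := expR_ge1Dxn k.+1 y0 => H.
have F0 : 0 < (k.+2)`!%:R :> R by rewrite ltr0n fact_gt0.
have {}H : x^-1 ^+ k.+2 / (k.+2)`!%:R <= expR x^-1 by apply: le_trans H; rewrite lerDr.
rewrite ler_pdivrMr// in H.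
have -> : x^-1 ^+ k = x ^+ 2 * x^-1 ^+ k.+2.
  rewrite (exprS _ k.+1) (exprS _ k); set z := _ ^+ k; field; by rewrite gt_eqF.
by rewrite [leLHS]mulrC [leRHS]mulrAC ler_wpM2r ?sqr_ge0// mulrC.
Qed.

Lemma flat_der k : der (flat k) (fun x => flat k.+2 x - k%:R * flat k.+1 x).
Proof.
move=> x; have [x0|] := ltP 0 x; last first.
  rewrite le_eqVlt => /orP[/eqP ->|x0].
    rewrite /flat ltxx mulr0 subrr.
    apply: (@is_derive_quad _ _ _ _ (k.+2)`!%:R) => h _.
    by rewrite add0r ltxx mulr0 !subr0; exact: flat_le.
  rewrite {2 3}/flat !ltNge (ltW x0) /= mulr0 subrr.
  apply: near_eq_is_derive (is_derive_cst 0 x 1).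
  near=> z; rewrite /flat ifN// -leNgt ltW//.
  have : `|x - z| < - x by near: z; apply: cvgr_dist_lt; rewrite // oppr_gt0.
  by rewrite ltr_norml => /andP[? ?]; lra.
have xn0 : x != 0 by by rewrite gt_eqF.
apply: (@near_eq_is_derive _ _ _ (fun x => x^-1 ^+ k * expR (- x^-1))).
  near=> z; rewrite /flat ifT//.
  have : `|x - z| < x by near: z; apply: cvgr_dist_lt.
  by rewrite ltr_norml => /andP[? ?]; lra.
have D1 : is_derive x 1 (fun z : R => z^-1) (- x ^- 2 *: 1).
  exact: (is_deriveV xn0 (is_derive_id x 1)).
have := is_deriveX k D1; rewrite exprfctE => D2.
have D3 := @is_derive1_comp _ expR (fun z => - z^-1) x _ _ (is_derive_expR (- x^-1)) (is_deriveN D1).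
have := is_deriveM D2 D3; move/is_derive_eq; apply.
rewrite /flat x0 /GRing.scale /= !mulr1.
case: k D2 => [|k] _; rewrite /= -exprVn.
  rewrite !expr0; ring.
rewrite !exprS.
have -> : k.+1%:R = k%:R + 1 :> R by rewrite -natr1.
ring.
Unshelve. all: by end_near. Qed.

(** The algebra generated by the flat functions at the end points [-1] and [1]. Being closed under
    differentiation, it feeds [smooth_class]. *)
Inductive bumpc : (R -> R) -> Prop :=
| bumpc_l k : bumpc (fun t => flat k (1 - t))
| bumpc_r k : bumpc (fun t => flat k (t + 1))
| bumpcD f g : bumpc f -> bumpc g -> bumpc (fun t => f t + g t)
| bumpcM f g : bumpc f -> bumpc g -> bumpc (fun t => f t * g t)
| bumpcZ c f : bumpc f -> bumpc (fun t => c * f t).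

Lemma bumpc_der f : bumpc f -> exists2 g, bumpc g & der f g.
Proof.
elim=> [k|k|{}f g Hf [f' Hf' df] Hg [g' Hg' dg]|{}f g Hf [f' Hf' df] Hg [g' Hg' dg]
       |c {}f Hf [f' Hf' df]].
- exists (fun t => (-1) * flat k.+2 (1 - t) + k%:R * flat k.+1 (1 - t)).
    by do 2!constructor; constructor.
  by apply: der_ext (der_refl 1 (flat_der k)) _ => t; ring.
- exists (fun t => flat k.+2 (t + 1) + (- k%:R) * flat k.+1 (t + 1)).
    by constructor; [|constructor]; constructor.
  by apply: der_ext (der_shift 1 (flat_der k)) _ => t; ring.
- by exists (fun t => f' t + g' t); [constructor|exact: derD].
- by exists (fun t => f' t * g t + f t * g' t); [constructor; constructor|exact: derM].
- by exists (fun t => c * f' t); [constructor|exact: derZ].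
Qed.

Definition bump r t : R := flat 0 (1 - r^-1 * t) * flat 0 (r^-1 * t + 1).

Lemma flat_gt0 k x : 0 < x -> 0 < flat k x.
Proof. by move=> x0; rewrite /flat x0 mulr_gt0 ?expR_gt0// exprn_gt0// invr_gt0. Qed.

Lemma flat_eq0 k x : x <= 0 -> flat k x = 0.
Proof. by move=> x0; rewrite /flat ltNge x0. Qed.

Lemma flat_ge0 k x : 0 <= flat k x.
Proof. by have [/(flat_gt0 k)/ltW//|/flat_eq0 ->] := ltP 0 x. Qed.

Lemma bump_smooth r : smooth (bump r).
Proof.
have -> : bump r = fun t => 1 * (fun t => flat 0 (1 - t) * flat 0 (t + 1)) (r^-1 * t + 0).
  by apply/funext => t; rewrite addr0 mul1r.
apply: (@smooth_affine _ 1 r^-1 0 (fun t => flat 0 (1 - t) * flat 0 (t + 1))).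
by apply: (smooth_class bumpc_der); constructor; constructor.
Qed.

Lemma bump_ge0 r t : 0 <= bump r t.
Proof. by rewrite mulr_ge0 ?flat_ge0. Qed.

Lemma bump_even r t : bump r (- t) = bump r t.
Proof. by rewrite /bump mulrC; congr (flat 0 _ * flat 0 _); ring. Qed.

Lemma bump_gt0 r t : 0 < r -> `|t| < r -> 0 < bump r t.
Proof.
move=> r0; rewrite ltr_norml => /andP[t1 t2].
have H : -1 < r^-1 * t < 1.
  by rewrite mulrC ltr_pdivlMr// ltr_pdivrMr// mulN1r mul1r t1.
by move: H => /andP[? ?]; rewrite mulr_gt0// flat_gt0//; lra.
Qed.

Lemma bump_csupp r : 0 < r -> csupp r (bump r).
Proof.
move=> r0 t; rewrite ltr_normr => /orP[rt|rt].
  by rewrite /bump flat_eq0 ?mul0r// subr_le0 mulrC ler_pdivlMr// mul1r ltW.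
rewrite /bump [X in _ * X]flat_eq0 ?mulr0//.
have : r^-1 * t <= -1; last lra.
by rewrite mulrC ler_pdivrMr// mulN1r; lra.
Qed.

Lemma bump_oint_gt0 r : 0 < r -> 0 < oint (bump r) (- r) r.
Proof.
move=> r0; have cb := smooth_continuous (bump_smooth r).
have : 0 <= oint (bump r) (- r) r by apply: oint_ge0; [|lra|move=> t _; exact: bump_ge0].
rewrite le_eqVlt => /orP[/eqP e|//].
(* A zero integral would force this nondecreasing primitive to be constant on [[-r, r]], and its
   derivative at [0] to vanish. *)
pose F := oint (bump r) (- r); have DF : der F (bump r) by exact: oint_der.
have mono x y : x <= y -> F x <= F y.
  by move=> xy; apply: der_nondecr DF xy _ => t _; exact: bump_ge0.
have F0 x : `|x| <= r -> F x = 0.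
  rewrite ler_norml => /andP[x1 x2]; apply/eqP; rewrite eq_le -{2}(ointxx (bump r) (- r)).
  by rewrite {1}e !mono.
have := DF 0 => -[_ dF].
have : bump r 0 = 0.
  rewrite -dF -[RHS](@derive_cst _ _ _ (0:R) (0:R) 1); apply: near_eq_derive; near=> z.
  apply: F0; have : `|0 - z| < r by near: z; apply: cvgr_dist_lt.
  by rewrite sub0r normrN => /ltW.
by move=> b0; have := @bump_gt0 r 0 r0; rewrite normr0 r0 b0 ltxx => /(_ isT).
Unshelve. all: by end_near. Qed.

(** Evenness serves twice: it makes the second primitive agree with [pos_part] away from [[-r, r]],
    and it makes the datum [c'] odd. *)
Definition mollifier r rho : Prop :=
  [/\ smooth rho, csupp r rho, forall t, 0 <= rho t, forall t, rho (- t) = rho t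
    & oint rho (- r) r = 1].

Lemma exists_mollifier r : 0 < r -> exists rho, mollifier r rho.
Proof.
move=> r0; pose I := oint (bump r) (- r) r; have I0 : 0 < I by exact: bump_oint_gt0.
exists (fun t => I^-1 * bump r t); split.
- exact: smoothZ (bump_smooth r).
- by move=> t /(bump_csupp r0) ->; rewrite mulr0.
- by move=> t; rewrite mulr_ge0 ?bump_ge0// invr_ge0 ltW.
- by move=> t; rewrite bump_even.
- rewrite ointZ; last exact: smooth_continuous (bump_smooth r).
  by rewrite mulVf// gt_eqF.
Qed.

Lemma mollifier_oint_le rho r f e a : 0 < r -> mollifier r rho -> continuous f ->
  (forall t, `|t| <= r -> `|f t - a| <= e) ->
  `|oint (fun t => rho t * f t) (- r) r - a| <= e.
Proof.
move=> r0 [s1 s2 s3 s4 s5] cf H; have cr := smooth_continuous s1.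
have -> : a = oint (fun t => a * rho t) (- r) r by rewrite ointZ// s5 mulr1.
rewrite -ointB; [|exact: contM|by apply: contM => //; exact: cont_cst].
apply: (le_trans (oint_norm _ _)); [|lra|].
  by apply: contB; apply: contM => //; exact: cont_cst.
have -> : e = oint (fun t => e * rho t) (- r) r by rewrite ointZ// s5 mulr1.
apply: oint_le; [| |lra|].
- by apply: cont_abs; apply: contB; apply: contM => //; exact: cont_cst.
- by apply: contM => //; exact: cont_cst.
- move=> t tr; rewrite mulrC -mulrBl normrM (ger0_norm (s3 t)) ler_wpM2r//.
  by apply: H; rewrite ler_norml.
Qed.

Lemma continuous_at_le f s e : continuous f -> 0 < e ->
  exists2 r, 0 < r & forall t, `|t - s| <= r -> `|f t - f s| <= e.
Proof.
move=> cf e0; have := cf s; move/cvgrPdist_le => /(_ e e0).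
rewrite -nbhs_ballE => -[r /= r0 H]; exists (r / 2); first by rewrite divr_gt0.
move=> t tr; rewrite distrC; apply: H; rewrite /ball /= distrC.
by apply: (le_lt_trans tr); rewrite gtr_pMr// invf_lt1 ?ltr1n.
Qed.

(** The fundamental lemma of the calculus of variations, at a point. Near [s] the average differs
    from [f s] times the mass of the bump by a small multiple of that mass, and the mass is
    positive. *)
Lemma bump_oint_eq0 f s r0 : 0 < r0 -> continuous f ->
  (forall r, 0 < r < r0 -> oint (fun t => bump r t * f (s - t)) (- r) r = 0) ->
  f s = 0.
Proof.
move=> r00 cf H; apply: (@le_div_nat_eq0 _ _ 1) => n.
have e0 : 0 < 1 / n.+1%:R :> R by rewrite divr_gt0.
have [r r_gt0 Hr] := continuous_at_le s cf e0.
pose d := Num.min r (r0 / 2).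
have d0 : 0 < d by rewrite lt_min r_gt0 divr_gt0.
have dr : d <= r by rewrite ge_min lexx.
have dr0 : d < r0.
  by apply: (@le_lt_trans _ _ (r0 / 2)); [rewrite ge_min lexx orbT|lra].
have cb := smooth_continuous (bump_smooth d).
have cfs : continuous (fun t => f (s - t)) by exact: cont_refl.
have := H d; rewrite d0 dr0 => /(_ isT) H0.
have I0 := bump_oint_gt0 d0.
have : `|f s * oint (bump d) (- d) d| <= 1 / n.+1%:R * oint (bump d) (- d) d.
  rewrite -[X in `|X|]subr0 -[X in _ - X]H0 -!ointZ// -ointB//; last 2 first.
    by apply: contM => //; exact: cont_cst.
    exact: contM.
  apply: (le_trans (oint_norm _ _)); [|lra|].
    by apply: contB; apply: contM => //; exact: cont_cst.
  apply: oint_le; [| |lra|].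
  - by apply: cont_abs; apply: contB; apply: contM => //; exact: cont_cst.
  - by apply: contM => //; exact: cont_cst.
  - move=> t /andP[t1 t2].
    rewrite (mulrC (bump d t)) -mulrBl normrM (ger0_norm (bump_ge0 _ _)) ler_wpM2r ?bump_ge0//.
    rewrite distrC; apply: Hr; apply: le_trans dr.
    by rewrite ler_norml; apply/andP; split; lra.
by rewrite normrM (gtr0_norm I0) ler_pM2r.
Qed.

End Bump.

(** * Lebesgue integrals over intervals *)

(** The integral in [x], for merely integrable coefficients. Half-open intervals fit together
    without overlap; unlike [oint], this integral is not oriented and is zero when [b <= a]. *)
Definition itg (R : realType) (a b : R) (f : R -> R) : R :=
  (\int[@lebesgue_measure R]_(x in `]a, b]) f x)%R.

Definition ig (R : realType) (a b : R) (f : R -> R) : Prop :=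
  (@lebesgue_measure R).-integrable `]a, b] (EFin \o f).

Section LebesgueIntegral.
Context {R : realType}.
Implicit Types (f g q : R -> R) (a b c d x y t M : R).
Local Notation mu := (@lebesgue_measure R).

Lemma ig_cont a b f : continuous f -> ig a b f.
Proof.
move=> cf; apply: (@integrableS _ _ _ mu `[a, b]) => //.
  by apply: subset_itvr; rewrite bnd_simp.
apply: continuous_compact_integrable; first exact: segment_compact.
exact: continuous_subspaceT.
Qed.

Lemma ig_mul a b q f : ig a b q -> continuous f -> ig a b (fun x => q x * f x).
Proof.
move=> iq cf.
have [M M0 HM] := continuous_bounded (`|a| + `|b|) cf.
have mf : measurable_fun `]a, b] f.
  apply: subspace_continuous_measurable_fun => //.
  exact: continuous_subspaceT.
have iq' : mu.-integrable `]a, b] (EFin \o q) := iq.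
have mq : measurable_fun `]a, b] q by apply/measurable_EFinP; exact: measurable_int iq'.
apply: (@le_integrable _ _ _ mu `]a, b] _ _ (EFin \o (fun x => M * q x))) => //.
- by apply/measurable_EFinP; exact: measurable_funM.
- move=> x /=; rewrite in_itv/= => /andP[ax xb]; rewrite lee_fin !normrM mulrC.
  rewrite (ger0_norm M0) ler_wpM2r//; apply: HM; rewrite ler_norml.
  have := ler_norm b; have := ler_norm (- a); rewrite normrN.
  have := normr_ge0 a; have := normr_ge0 b => *; apply/andP; split; lra.
- by apply: (integrableZl _ _ iq').
Qed.

Lemma igZ a b c f : ig a b f -> ig a b (fun x => c * f x).
Proof. by move=> H; apply: (integrableZl _ _ H). Qed.

Lemma igD a b f g : ig a b f -> ig a b g -> ig a b (fun x => f x + g x).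
Proof. by move=> Hf Hg; apply: (integrableD _ Hf Hg). Qed.

Lemma igB a b f g : ig a b f -> ig a b g -> ig a b (fun x => f x - g x).
Proof. by move=> Hf Hg; apply: (integrableB _ Hf Hg). Qed.

Lemma ig_abs a b f : ig a b f -> ig a b (fun x => `|f x|).
Proof. by move=> H; have := integrable_abse H. Qed.

Lemma itg_eq a b f g : (forall x, a < x <= b -> f x = g x) -> itg a b f = itg a b g.
Proof. by move=> H; apply: eq_Rintegral => x; rewrite inE/= in_itv/= => /H. Qed.

Lemma ig_eq a b f g : (forall x, a < x <= b -> f x = g x) -> ig a b f -> ig a b g.
Proof.
move=> H; apply: eq_integrable => // x; rewrite inE/= in_itv/= => /H.
by move=> /= ->.
Qed.

Lemma itgZ a b c f : ig a b f -> itg a b (fun x => c * f x) = c * itg a b f.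
Proof. by move=> H; rewrite /itg RintegralZl. Qed.

Lemma itgD a b f g : ig a b f -> ig a b g ->
  itg a b (fun x => f x + g x) = itg a b f + itg a b g.
Proof. by move=> Hf Hg; rewrite /itg RintegralD. Qed.

Lemma itgB a b f g : ig a b f -> ig a b g ->
  itg a b (fun x => f x - g x) = itg a b f - itg a b g.
Proof. by move=> Hf Hg; rewrite /itg RintegralB. Qed.

Lemma itg_split a b c f : a <= c -> c <= b -> ig a b f -> itg a b f = itg a c f + itg c b f.
Proof.
move=> ac cb H; have := @Rintegral_itvB _ f (BRight a) (BRight b) c H.
by rewrite !bnd_simp => /(_ ac cb); rewrite -/(itg c b f) => <-; rewrite addrC subrK.
Qed.

Lemma itg_empty a b f : b <= a -> itg a b f = 0.
Proof.
by move=> ba; rewrite /itg set_itv_ge ?Rintegral_set0// bnd_simp -leNgt.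
Qed.

Lemma itg0 a b : itg a b (fun=> 0) = 0 :> R.
Proof. by rewrite /itg Rintegral_cst// mul0r. Qed.

Lemma itg_ge0 a b f : (forall x, a < x <= b -> 0 <= f x) -> 0 <= itg a b f.
Proof. by move=> H; apply: Rintegral_ge0 => x /=; rewrite in_itv/= => /H. Qed.

Lemma itg_le a b f g : ig a b f -> ig a b g -> (forall x, a < x <= b -> f x <= g x) ->
  itg a b f <= itg a b g.
Proof. by move=> Hf Hg H; apply: le_Rintegral => // x /=; rewrite in_itv/= => /H. Qed.

Lemma itg_norm a b f : ig a b f -> `|itg a b f| <= itg a b (fun x => `|f x|).
Proof. by move=> H; apply: le_normr_Rintegral. Qed.

Lemma itg_bound a b f g : ig a b g -> ig a b f ->
  (forall x, a < x <= b -> `|f x| <= g x) -> `|itg a b f| <= itg a b g.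
Proof.
move=> ig_g ig_f H; apply: (le_trans (itg_norm ig_f)); apply: itg_le => //.
exact: ig_abs.
Qed.

Lemma itg_cont a b f : a <= b -> continuous f -> itg a b f = oint f a b.
Proof.
move=> ab cf; have := continuous_FTC1 (f := f) (a := BRight (a - 1)).
pose G y := itg (a - 1) y f => H.
have dG y : a - 1 < y -> is_derive y 1 G (f y).
  move=> ay; have := H y (y + 1); rewrite ltrDl ltr01 => /(_ isT (ig_cont _ _ cf)) /=.
  rewrite lte_fin => /(_ ay (cf y))[d1]; rewrite derive1E => d2.
  exact: DeriveDef d1 d2.
have ->: itg a b f = G b - G a.
  by rewrite /G (@itg_split (a - 1) b a)//; [ring|lra|exact: ig_cont].
apply/eqP; rewrite -subr_eq0; apply/eqP.
pose K y := G y - oint f a y.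
have dK y : y \in `]a, b[ -> is_derive y 1 K 0.
  rewrite in_itv/= => /andP[ay _].
  have := is_deriveB (dG y _) (oint_der a cf y); rewrite subrr; apply; lra.
have [|c _] := MVT_segment ab dK.
  apply: continuous_in_subspaceT => y; rewrite inE/= in_itv/= => /andP[ay _].
  apply: (@is_derive_continuous _ _ _ (f y - f y)).
  by apply: (is_deriveB (dG y _) (oint_der a cf y)); lra.
by rewrite mul0r /K ointxx; lra.
Qed.

End LebesgueIntegral.

(** * Weak second derivatives on an interval *)

Section WeakSecondDerivative.
Context {R : realType}.
Implicit Types (f g h U rho : R -> R) (r a b c d x y z k t : R).

(** The second primitive of [rho], started at [-r]. For a mollifier it is a smooth replacement of
    [pos_part], within [r] of it everywhere and equal to it outside []-r, r[]. *)
Definition ramp r rho : R -> R := oint (oint rho (- r)) (- r).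

Definition pos_part x : R := Num.max x 0.

Lemma pos_part_continuous : continuous pos_part.
Proof.
apply: lip1_continuous => T; exists 1 => x y _ _; rewrite mul1r /pos_part /Num.max.
have := ler_norm (x - y); have := ler_norm (y - x); rewrite (distrC y).
have := normr_ge0 (x - y).
by case: ifPn; case: ifPn; rewrite -?leNgt => *; rewrite ler_norml; apply/andP; split; lra.
Qed.

Section Ramp.
Context (r : R) (rho : R -> R) (r0 : 0 < r) (Hrho : mollifier r rho).

Let crho : continuous rho.
Proof. by case: Hrho => /smooth_continuous. Qed.

Let step := oint rho (- r).

Let dstep : der step rho. Proof. exact: oint_der. Qed.

Let dramp : der (ramp r rho) step.
Proof. by apply: oint_der; exact: der_continuous dstep. Qed.

Lemma ramp_der2 : exists2 g, der (ramp r rho) g & der g rho.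
Proof. by exists step. Qed.

Lemma ramp_smooth : smooth (ramp r rho).
Proof.
by apply: der_smooth dramp _; apply: der_smooth dstep _; case: Hrho.
Qed.

Let step_l y : y <= - r -> step y = 0.
Proof.
case: Hrho => _ sr _ _ _ yr; rewrite /step oint_sym oint_eq0 ?oppr0// => t /andP[_ tr].
by apply: sr; rewrite ltr_normr; apply/orP; right; lra.
Qed.

Lemma ramp_l y : y <= - r -> ramp r rho y = 0.
Proof.
move=> yr; rewrite /ramp oint_sym oint_eq0 ?oppr0//; first exact: der_continuous dstep.
by move=> t /andP[_ /ltW/step_l].
Qed.

Let step_refl t : step t + step (- t) = 1.
Proof.
case: Hrho => _ sr _ ev i1.
have D : der (fun t => step t + step (0 - t)) (fun=> 0).
  by apply: der_ext (derD dstep (der_refl 0 dstep)) _ => u; rewrite sub0r ev subrr.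
have := der0_cst D t r; rewrite !sub0r => ->.
by rewrite (step_l (lexx _)) addr0.
Qed.

Let ramp_refl t : ramp r rho t - ramp r rho (- t) = t.
Proof.
have D : der (fun t => ramp r rho t - ramp r rho (0 - t) - (1 * t + 0)) (fun=> 0).
  apply: der_ext (derB (derB dramp (der_refl 0 dramp)) (der_affine 1 0)) _ => u.
  by rewrite opprK sub0r step_refl subrr.
have := der0_cst D t 0; rewrite !sub0r oppr0 mul1r mulr0 !addr0 subrr subr0.
by move/eqP; rewrite subr_eq0 => /eqP.
Qed.

Lemma ramp_r y : r <= y -> ramp r rho y = y.
Proof. by move=> ry; have := ramp_refl y; rewrite (@ramp_l (- y)) ?subr0// lerN2. Qed.

Lemma ramp_pos_part y : `|ramp r rho y - pos_part y| <= r.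
Proof.
case: (Hrho) => _ _ rho0 _ _.
have mono_step x z : x <= z -> step x <= step z by move=> xz; exact: der_nondecr dstep xz _.
have step0 x : 0 <= step x.
  have [/step_l ->//|/ltW/mono_step] := leP x (- r).
  by rewrite (step_l (lexx _)).
have mono x z : x <= z -> ramp r rho x <= ramp r rho z.
  by move=> xz; exact: der_nondecr dramp xz _.
rewrite /pos_part; have [yr|yr] := leP y (- r).
  have y0 : y <= 0 by apply: le_trans yr _; rewrite oppr_le0 ltW.
  by rewrite (ramp_l yr) (max_r y0) subrr normr0 ltW.
have [ry|ry] := leP r y.
  have y0 : 0 <= y by apply: le_trans ry; exact: ltW.
  by rewrite (ramp_r ry) (max_l y0) subrr normr0 ltW.
have := mono _ _ (ltW yr); rewrite (ramp_l (lexx _)) => R0.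
have := mono _ _ (ltW ry); rewrite (ramp_r (lexx _)) => R1.
by have [y0|y0] := leP 0 y; rewrite ler_norml; apply/andP; split; lra.
Qed.

End Ramp.

Lemma mollifier_avg r rho U z : 0 < r -> mollifier r rho -> continuous U ->
  oint (fun y => rho (z - y) * U y) (z - r) (z + r) = oint (fun t => rho t * U (z - t)) (- r) r.
Proof.
move=> r0 [/smooth_continuous cr _ _ _ _] cU.
have -> : (fun y => rho (z - y) * U y) = fun y => (fun t => rho t * U (z - t)) (z - y).
  by apply/funext => y /=; congr (_ * U _); ring.
rewrite (@oint_refl _ (fun t => rho t * U (z - t)) z); first by congr oint; ring.
by apply: contM => //; exact: cont_refl.
Qed.

Definition tent x k y : R := pos_part (x + k - y) - 2 * pos_part (x - y) + pos_part (x - k - y).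

(* [alpha] below is a smoothed tent, and its second derivative is a second
   difference of approximate deltas. *)
Lemma weak_second_diff U g X x k : continuous U -> ig 0 X g ->
  (forall alpha beta : R -> R, smooth alpha ->
    (exists2 f, der alpha f & der f beta) ->
    (exists a b, [/\ 0 < a, b < X & forall y, (y < a) || (b < y) -> alpha y = 0]) ->
    itg 0 X (fun y => beta y * U y) = itg 0 X (fun y => alpha y * g y)) ->
  0 <= k -> 0 < x - k -> x + k < X ->
  U (x + k) - 2 * U x + U (x - k) = itg 0 X (fun y => tent x k y * g y).
Proof.
move=> cU Ig H k0 xk xkX; apply/eqP; rewrite -subr_eq0; apply/eqP.
set G := itg 0 X (fun y => `|g y|).
(* The three averages of [U] carry the weights 1, 2, 1 and each is off by at most [e = 1/(n+1)];
   replacing the smoothed tent by [tent] costs at most [4 e] times the [L^1] norm of [g]. *)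
apply: (@le_div_nat_eq0 _ _ (4 + 4 * G)) => n.
set e := n.+1%:R^-1 : R; have e0 : 0 < e by rewrite invr_gt0.
have [r1 r1_gt0 Hr1] := continuous_at_le (x + k) cU e0.
have [r2 r2_gt0 Hr2] := continuous_at_le x cU e0.
have [r3 r3_gt0 Hr3] := continuous_at_le (x - k) cU e0.
have [r [r0 rr1 rr2 rr3 [re rx rX]]] : exists r, [/\ 0 < r, r <= r1, r <= r2, r <= r3 &
    [/\ r <= e, r < x - k & r < X - (x + k)]].
  exists (Num.min r1 (Num.min r2 (Num.min r3 (Num.min e
    (Num.min ((x - k) / 2) ((X - (x + k)) / 2)))))).
  rewrite !lt_min !ge_min !lexx !orbT r1_gt0 r2_gt0 r3_gt0 e0 /=.
  rewrite !gt_min; split => //.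
    by apply/andP; split; lra.
  split=> //; apply/orP; right; apply/orP; right; apply/orP; right; apply/orP; right;
    apply/orP; [left|right]; lra.
have [rho Hrho] := exists_mollifier r0; case: (Hrho) => sr cr _ ev _.
have cR := smooth_continuous sr.
pose B := ramp r rho; have [f df dr] := ramp_der2 Hrho.
pose alpha y := B (x + k - y) - 2 * B (x - y) + B (x - k - y).
pose beta y := rho (x + k - y) - 2 * rho (x - y) + rho (x - k - y).
have sB := ramp_smooth Hrho.
have sa : smooth alpha.
  by apply: smoothD; [apply: smoothB|]; [|apply: smoothZ|]; exact: smooth_refl.
have dd : exists2 f', der alpha f' & der f' beta.
  exists (fun y => - f (x + k - y) + 2 * f (x - y) - f (x - k - y)).
    apply: der_ext (derD (derB (der_refl _ df) (derZ 2 (der_refl _ df))) (der_refl _ df)) _.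
    by move=> y; ring.
  have := derB (derD (derN (der_refl (x + k) dr)) (derZ 2 (der_refl x dr))) (der_refl (x - k) dr).
  by move/der_ext; apply => y; rewrite /beta; ring.
have supp : exists a b, [/\ 0 < a, b < X & forall y, (y < a) || (b < y) -> alpha y = 0].
  exists (x - k - r), (x + k + r); split; [lra|lra|] => y /orP[yl|yl]; rewrite /alpha /B.
    rewrite !(ramp_r Hrho); first ring; lra.
  rewrite !(ramp_l Hrho); first ring; lra.
have {H} := H alpha beta sa dd supp.
have cz z : continuous (fun y => rho (z - y) * U y).
  by apply: contM => //; exact: cont_refl.
have iz z : r < z -> z < X - r ->
    itg 0 X (fun y => rho (z - y) * U y) = oint (fun t => rho t * U (z - t)) (- r) r.
  move=> rz zX; rewrite itg_cont//; last lra.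
  rewrite -mollifier_avg//; apply: oint_supp => //; [lra|lra|lra| |] => t tz.
    by rewrite cr ?mul0r// ltr_normr; apply/orP; left; lra.
  by rewrite cr ?mul0r// ltr_normr; apply/orP; right; lra.
have ci z : ig 0 X (fun y => rho (z - y) * U y) by exact: ig_cont.
have -> : itg 0 X (fun y => beta y * U y) =
   oint (fun t => rho t * U (x + k - t)) (- r) r - 2 * oint (fun t => rho t * U (x - t)) (- r) r
   + oint (fun t => rho t * U (x - k - t)) (- r) r.
  rewrite -!iz; [|lra..]; rewrite -itgZ// -itgB//; last exact: igZ.
  rewrite -itgD//; last by apply: igB => //; exact: igZ.
  by congr itg; apply/funext => y; rewrite /beta; ring.
have near z (r' : R) : r <= r' -> (forall t, `|t - z| <= r' -> `|U t - U z| <= e) ->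
    `|oint (fun t => rho t * U (z - t)) (- r) r - U z| <= e.
  move=> rr' HU; apply: mollifier_oint_le => //; first exact: cont_refl.
  move=> t tr; apply: HU; apply: le_trans rr'.
  by rewrite addrAC subrr add0r normrN.
have := near _ _ rr1 Hr1; have := near _ _ rr2 Hr2; have := near _ _ rr3 Hr3.
have calpha := smooth_continuous sa.
have cpp c : continuous (fun y => pos_part (c - y)).
  exact: cont_refl pos_part_continuous.
have ctent : continuous (tent x k).
  apply: contD => //; apply: contB => //; apply: contM => //; exact: cont_cst.
have igm h : continuous h -> ig 0 X (fun y => h y * g y).
  by move=> ch; apply: ig_eq (ig_mul Ig ch) => y _; rewrite mulrC.
have : `|itg 0 X (fun y => alpha y * g y) - itg 0 X (fun y => tent x k y * g y)| <= 4 * e * G.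
  rewrite -itgB; [|exact: igm|exact: igm].
  rewrite -itgZ; last exact: ig_abs.
  apply: itg_bound; [by apply: igZ; exact: ig_abs|by apply: igB; exact: igm|] => y _.
  rewrite -mulrBl normrM ler_wpM2r//.
  have P z : `|B z - pos_part z| <= e by apply: le_trans re; exact: ramp_pos_part.
  have := P (x + k - y); have := P (x - y); have := P (x - k - y).
  rewrite /alpha /tent !ler_norml => /andP[? ?] /andP[? ?] /andP[? ?].
  by apply/andP; split; lra.
have -> : (4 + 4 * G) / n.+1%:R = 4 * e + 4 * e * G by rewrite -/e; ring.
move=> h1 h2 h3 h4 h5; move: h1 h2 h3 h4; rewrite !ler_norml => /andP[? ?] /andP[? ?] /andP[? ?] /andP[? ?].
by apply/andP; split; lra.
Qed.

(** A maximum principle. At a point [c] with a positive maximum, [k] is chosen so that [c - k] or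
    [c + k] is close to the nearer end point, where [h] is at most [h c / 2]. The other value is at
    most [h c], which contradicts the midpoint identity. *)
Lemma midpoint_le0 h X : continuous h -> 0 < X -> h 0 = 0 -> h X = 0 ->
  (forall x k, 0 <= k -> 0 < x - k -> x + k < X -> h (x + k) - 2 * h x + h (x - k) = 0) ->
  forall x, 0 <= x <= X -> h x <= 0.
Proof.
move=> ch X0 h0 hX H x xX; rewrite leNgt; apply/negP => hx.
have [c] := EVT_max (ltW X0) (continuous_subspaceT ch).
rewrite in_itv/= => /andP[c0 cX] Hmax.
have hc : 0 < h c by apply: lt_le_trans hx _; apply: Hmax; rewrite in_itv/=.
have {}Hmax y : 0 <= y -> y <= X -> h y <= h c.
  by move=> *; apply: Hmax; rewrite in_itv/=; apply/andP.
have cc0 : 0 < c by rewrite lt_neqAle c0 andbT; apply/eqP => e; move: hc; rewrite -e h0 ltxx.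
have ccX : c < X by rewrite lt_neqAle cX andbT; apply/eqP => e; move: hc; rewrite e hX ltxx.
have hc2 : 0 < h c / 2 by lra.
have [r r0 Hr] := continuous_at_le 0 ch hc2.
have [s s0 Hs] := continuous_at_le X ch hc2.
pose d := Num.min (Num.min r s) (Num.min (c / 2) ((X - c) / 2)).
have d0 : 0 < d by rewrite !lt_min r0 s0 /=; apply/andP; split; lra.
have dr : d <= r by rewrite !ge_min lexx.
have ds : d <= s by rewrite !ge_min lexx orbT.
have dc : d <= c / 2 by rewrite !ge_min lexx !orbT.
have dX : d <= (X - c) / 2 by rewrite !ge_min lexx !orbT.
have [cX2|cX2] := leP c (X / 2).
  have := Hr d; rewrite subr0 (ger0_norm (ltW d0)) dr h0 subr0 => /(_ isT).
  rewrite ler_norml => /andP[_ hd].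
  have := H c (c - d).
  have -> : c - (c - d) = d by ring.
  have := Hmax (c + (c - d)).
  move=> A1 A2; have := A1 _ _; have := A2 _ d0 _; lra.
have := Hs (X - d); rewrite addrAC subrr add0r normrN (ger0_norm (ltW d0)) ds hX subr0 => /(_ isT).
rewrite ler_norml => /andP[_ hd].
have := H c (X - d - c).
have -> : c + (X - d - c) = X - d by ring.
have := Hmax (c - (X - d - c)).
move=> A1 A2; have := A1 _ _; have := A2 _ _ _; lra.
Qed.

(** The maximum principle is applied to the difference between [h] and its chord, and to the
    opposite of that difference. *)
Lemma midpoint_affine h X : continuous h -> 0 < X ->
  (forall x k, 0 <= k -> 0 < x - k -> x + k < X -> h (x + k) - 2 * h x + h (x - k) = 0) ->
  forall x, 0 <= x <= X -> h x = h 0 + x * ((h X - h 0) / X).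
Proof.
move=> ch X0 H x xX; set s := (h X - h 0) / X.
have sX : s * X = h X - h 0 by rewrite /s divfK// gt_eqF.
have ca : continuous (fun x => s * x + h 0) by exact: der_continuous (der_affine s (h 0)).
have c1 : continuous (fun x => h x - (s * x + h 0)) by exact: contB.
have c2 : continuous (fun x => (s * x + h 0) - h x) by exact: contB.
have := midpoint_le0 c1 X0; have := midpoint_le0 c2 X0 => /= A B.
have {A}A : s * x + h 0 - h x <= 0.
  by apply: A xX; [ring|lra|] => y k *; have := H y k; lra.
have {B}B : h x - (s * x + h 0) <= 0.
  by apply: B xX; [ring|lra|] => y k *; have := H y k; lra.
by lra.
Qed.

End WeakSecondDerivative.

(** * Mollified distributional solutions *)

Section Geometric.
Context {R : realType}.
Implicit Types (a : nat -> R) (r x B C K : R).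

(** The intervals [[a n - D n, a n + D n]] are nested, and the supremum of their left ends lies in
    all of them. *)
Lemma geo_sum_cvg a r C : 0 <= r -> r < 1 ->
  (forall n, `|a n.+1 - a n| <= C * r ^+ n) ->
  exists l, forall n, `|l - a n| <= C / (1 - r) * r ^+ n.
Proof.
move=> r0 r1 H; pose D n := C / (1 - r) * r ^+ n.
have DD n : D n - D n.+1 = C * r ^+ n by rewrite /D exprS; field; lra.
have lo n m : (n <= m)%N -> a n - D n <= a m - D m.
  move=> /subnK <-; elim: (m - n)%N => // j IH; apply: (le_trans IH).
  by have := H (j + n)%N; have := DD (j + n)%N; rewrite ler_norml => e /andP[? ?]; rewrite addSn; lra.
have hi n m : (n <= m)%N -> a m + D m <= a n + D n.
  move=> /subnK <-; elim: (m - n)%N => // j IH; apply: le_trans IH.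
  by have := H (j + n)%N; have := DD (j + n)%N; rewrite ler_norml => e /andP[? ?]; rewrite addSn; lra.
have D0 n : 0 <= D n.
  have C0 : 0 <= C by have := H 0%N; rewrite expr0 mulr1; exact: le_trans.
  by rewrite mulr_ge0 ?exprn_ge0// divr_ge0//; lra.
have lohi n m : a n - D n <= a m + D m.
  have := lo n (maxn n m); have := hi m (maxn n m); rewrite leq_maxl leq_maxr => h1 h2.
  by have := h1 isT; have := h2 isT; have := D0 (maxn n m); lra.
pose S := range (fun n => a n - D n).
have S0 : S !=set0 by exists (a 0%N - D 0%N), 0%N.
exists (sup S) => n; rewrite ler_norml; apply/andP; split.
  have : a n - D n <= sup S; last by rewrite -/(D n); lra.
  apply: sup_upper_bound; last by exists n.
  by split=> //; exists (a 0%N + D 0%N) => _ [m _ <-].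
have : sup S <= a n + D n; last by rewrite -/(D n); lra.
by apply: sup_le_ub => // _ [m _ <-].
Qed.

Lemma expr_le_inv_nat r n : 0 <= r -> r <= 2^-1 -> r ^+ n <= n.+1%:R^-1.
Proof.
move=> r0 r2; apply: (@le_trans _ _ (2^-1 ^+ n)).
  by apply: lerXn2r => //; rewrite nnegrE.
rewrite exprVn lef_pV2 ?posrE ?exprn_gt0//.
by rewrite -natrX ler_nat; elim: n => // n IH; rewrite expnS; lia.
Qed.

(** Removes a geometric error from an inequality. With [r <= 1/2] the powers are compared with
    [1/(n+1)], which reduces the claim to the Archimedean property. *)
Lemma le_geo x B K r : 0 <= r -> r <= 2^-1 -> (forall n, x <= B + K * r ^+ n) -> x <= B.
Proof.
move=> r0 r2 H; rewrite -subr_le0 leNgt; apply/negP => xB.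
have : x - B = 0; last by move: xB => /[swap] ->; rewrite ltxx.
apply: (@le_div_nat_eq0 _ _ `|K|) => n; rewrite ger0_norm; last exact: ltW.
apply: (@le_trans _ _ (`|K| * r ^+ n)).
  have := H n; have : K * r ^+ n <= `|K| * r ^+ n by rewrite ler_wpM2r ?exprn_ge0// ler_norm.
  by lra.
by rewrite ler_wpM2l// expr_le_inv_nat.
Qed.

(** The limit is unique, so an error estimate with any constant [K] improves to the one given by the
    increments. This frees the choice of a limit from the choice of a bound [M]. *)
Lemma geo_sum_near (a : nat -> R) (l M K r : R) : 0 <= r -> r <= 2^-1 ->
  (forall n, `|a n.+1 - a n| <= M * r ^+ n) -> (forall n, `|l - a n| <= K * r ^+ n) ->
  forall n, `|l - a n| <= M / (1 - r) * r ^+ n.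
Proof.
move=> r0 r2 H Hl n; have r1 : r < 1 by apply: le_lt_trans r2 _; lra.
have [l' Hl'] := geo_sum_cvg r0 r1 H.
suff -> : l = l' by exact: Hl'.
apply/eqP; rewrite -subr_eq0 -normr_le0.
apply: (@le_geo _ _ (K + M / (1 - r)) r) => // m; rewrite add0r mulrDl.
have -> : l - l' = (l - a m) - (l' - a m) by ring.
exact: le_trans (ler_normB _ _) (lerD (Hl m) (Hl' m)).
Qed.

Lemma fin_bound (Q : nat -> R -> Prop) (N : nat) :
  (forall k, exists2 M, 0 <= M & Q k M) -> (forall k M M', M <= M' -> Q k M -> Q k M') ->
  exists2 M, 0 <= M & forall k, (k <= N)%N -> Q k M.
Proof.
move=> H mono; elim: N => [|N [M M0 HM]].
  by have [M M0 HM] := H 0%N; exists M => // k; rewrite leqn0 => /eqP ->.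
have [M' M'0 HM'] := H N.+1; exists (M + M'); first exact: addr_ge0.
move=> k; rewrite leq_eqVlt => /orP[/eqP ->|kN].
  by apply: mono HM'; rewrite lerDr.
by apply: mono (HM k kN); rewrite lerDl.
Qed.

End Geometric.

(** * Convolution of a distribution with a test function *)

Section Distributions.
Context {R : realType}.
Implicit Types (f g b chi : R -> R) (T : (R -> R) -> R) (r c t s h x M B : R) (k n N : nat).

Lemma derive1n_lin a f g n : smooth f -> smooth g ->
  ((fun t => a * f t + g t)^`(n))%classic
  = fun t => a * (f^`(n))%classic t + (g^`(n))%classic t.
Proof.
elim: n f g => // n IH f g sf sg.
rewrite derive1Sn (der_derive1 (derD (derZ a (smooth_der sf)) (smooth_der sg))).
rewrite (IH _ _ (smooth_derive1 sf) (smooth_derive1 sg)).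
by apply/funext => t; rewrite !derive1Sn.
Qed.

Lemma derive1nZ a f n : smooth f ->
  ((fun t => a * f t)^`(n))%classic = fun t => a * (f^`(n))%classic t.
Proof.
elim: n f => // n IH f sf.
rewrite derive1Sn (der_derive1 (derZ a (smooth_der sf))) (IH _ (smooth_derive1 sf)).
by apply/funext => t; rewrite derive1Sn.
Qed.

Lemma derive1n_shift h f n : smooth f ->
  ((fun t => f (t + h))^`(n))%classic = fun t => (f^`(n))%classic (t + h).
Proof.
elim: n f => // n IH f sf.
rewrite derive1Sn (der_derive1 (der_shift h (smooth_der sf))).
rewrite (IH _ (smooth_derive1 sf)).
by apply/funext => t; rewrite !derive1Sn.
Qed.

Lemma derive1n_refl c f n : smooth f ->
  ((fun t => f (c - t))^`(n))%classic = fun t => (- 1) ^+ n * (f^`(n))%classic (c - t).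
Proof.
elim: n f => [|n IH] f sf; first by apply/funext => t; rewrite expr0 mul1r.
have sf1 := smooth_derive1 sf.
rewrite derive1Sn (der_derive1 (der_refl c (smooth_der sf))).
have -> : (fun t => - (f^`())%classic (c - t)) = fun t => -1 * (f^`())%classic (c - t).
  by apply/funext => t; rewrite mulN1r.
rewrite derive1nZ ?IH//; last exact: smooth_refl.
by apply/funext => t; rewrite derive1Sn exprS mulrA.
Qed.

Lemma smooth_derive1n f n : smooth f -> smooth (f^`(n))%classic.
Proof. by elim: n f => // n IH f sf; rewrite derive1Sn; apply: IH; exact: smooth_derive1. Qed.

Lemma csupp_derive1n r f n : smooth f -> csupp r f -> csupp r (f^`(n))%classic.
Proof.
elim: n f => // n IH f sf cf; rewrite derive1Sn; apply: IH; first exact: smooth_derive1.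
exact: csupp_der cf (smooth_der sf).
Qed.

Lemma csupp_refl r c f : csupp r f -> csupp (r + `|c|) (fun t => f (c - t)).
Proof.
move=> cf t rt; apply: cf; have := ler_normB c (c - t).
by rewrite opprB addrC subrK => ?; lra.
Qed.

Lemma csupp_shift r c f : csupp r f -> csupp (r + `|c|) (fun t => f (t + c)).
Proof.
move=> cf t rt; apply: cf; have := ler_normB (t + c) c.
by rewrite addrK => ?; lra.
Qed.

Lemma distribution1_lin T c f g : distribution1 T -> test_fun1 f -> test_fun1 g ->
  T (fun t => c * f t + g t) = c * T f + T g.
Proof. by move=> [H _]; exact: H. Qed.

(** Continuity in terms of a single bound for the derivatives up to order [N]; the number of
    summands is absorbed into the constant. *)
Lemma distribution1_bound T r : distribution1 T ->
  exists2 C, 0 <= C & exists N, forall chi B, smooth chi -> csupp r chi ->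
    (forall k t, (k <= N)%N -> `|(chi^`(k))%classic t| <= B) -> `|T chi| <= C * B.
Proof.
move=> [_ /(_ [set` `[- r, r]] (@segment_compact _ (- r) r))[C [N H]]].
exists (`|C| * N.+1%:R); first by rewrite mulr_ge0.
exists N => chi B sc cc HB; have [sub _] := csupp_compact cc.
apply: (le_trans (H chi (csupp_test_fun1 sc cc) sub)).
have S0 : 0 <= \sum_(k < N.+1) sup (range (fun t => `|(chi^`(k))%classic t|)).
  apply: sumr_ge0 => k _; apply: (@le_trans _ _ `|(chi^`(k))%classic 0|) => //.
  apply: sup_upper_bound; last by exists 0.
  split; first by exists `|(chi^`(k))%classic 0|, 0.
  by exists B => _ [t _ <-]; apply: HB; rewrite -ltnS.
apply: (le_trans (ler_wpM2r S0 (ler_norm C))); rewrite -mulrA ler_wpM2l//.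
rewrite mulr_natl -[N.+1 in leRHS]card_ord -sumr_const; apply: ler_sum => k _.
apply: sup_le_ub; first by exists `|(chi^`(k))%classic 0|, 0.
by move=> _ [t _ <-]; apply: HB; rewrite -ltnS.
Qed.

Definition mollified (u : R -> (R -> R) -> R) b x t : R := u x (fun s => b (t - s)).

(** The continuity estimate is applied to the Taylor remainder of [b] for the step [h]. Its
    derivatives up to the order of the distribution are, up to sign, Taylor remainders of
    derivatives of [b], hence all quadratic in [h]. *)
Lemma mollified_der u b r x : distribution1 (u x) -> smooth b -> csupp r b ->
  der (mollified u b x) (mollified u (b^`())%classic x).
Proof.
move=> Du sb cb t.
have [C C0 [N HC]] := distribution1_bound (r + 1 + `|t|) Du.
have [M M0 HM] := @fin_bound R (fun k M => forall s h,
    `|(b^`(k))%classic (s + h) - (b^`(k))%classic s - h * (b^`(k.+1))%classic s| <= M * h ^+ 2) N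
  (fun k => bsmooth_taylor (csupp_bsmooth (smooth_derive1n k sb) (csupp_derive1n k sb cb)))
  (fun k M M' MM' H s h => le_trans (H s h) (ler_wpM2r (sqr_ge0 h) MM')).
apply: (@is_derive_quad _ _ _ _ (C * M)) => h h1.
have sb' := smooth_derive1 sb; have cb' := csupp_der cb (smooth_der sb).
pose f s := (- h) * (b^`())%classic s + ((- 1) * b s + b (s + h)).
have sf : smooth f.
  by apply: smoothD; [exact: smoothZ|apply: smoothD; [exact: smoothZ|exact: smooth_shift]].
have cf : csupp (r + 1) f.
  move=> s rs; have rs' : r < `|s| by apply: le_lt_trans rs; rewrite lerDl.
  rewrite /f cb'// cb// (csupp_shift (c := h) cb) ?mulr0 ?addr0//.
  by apply: le_lt_trans rs; rewrite lerD2l.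
have tf g r' c : smooth g -> csupp r' g -> test_fun1 (fun s => g (c - s)).
  by move=> sg cg; apply: csupp_test_fun1 (csupp_refl cg); exact: smooth_refl.
have -> : mollified u b x (t + h) - mollified u b x t - h * mollified u (b^`())%classic x t
    = u x (fun s => f (t - s)).
  rewrite /f; rewrite distribution1_lin//; [|exact: tf cb'|]; last first.
    apply: (tf (fun s => -1 * b s + b (s + h)) (r + `|h|)); first by apply: smoothD; [exact: smoothZ|exact: smooth_shift].
    move=> s rs; rewrite (csupp_shift (c := h) cb)// cb ?mulr0 ?addr0//.
    by apply: le_lt_trans rs; rewrite lerDl.
  have -> : (fun s => -1 * b (t - s) + b (t - s + h)) = fun s => -1 * b (t - s) + b (t + h - s).
    by apply/funext => s; rewrite addrAC.
  rewrite distribution1_lin//; [|exact: tf cb|exact: tf cb].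
  by rewrite /mollified; ring.
rewrite -mulrA; apply: HC; [exact: smooth_refl|exact: csupp_refl|] => k s kN.
rewrite derive1n_refl// normrM normrX normrN1 expr1n mul1r.
rewrite /f derive1n_lin//; [|by apply: smoothD; [exact: smoothZ|exact: smooth_shift]].
rewrite derive1n_lin//; last exact: smooth_shift.
rewrite derive1n_shift//; have := HM k kN (t - s) h.
by rewrite derive1Sn; congr (`|_| <= _); ring.
Qed.

Lemma mollified_continuous u b r x : distribution1 (u x) -> smooth b -> csupp r b ->
  continuous (mollified u b x).
Proof. by move=> Du sb cb; exact: der_continuous (mollified_der Du sb cb). Qed.

End Distributions.

(** * Uniform boundedness on compact sets *)

Section UniformBoundedness.
Context {R : realType}.
Implicit Types (f g b chi : R -> R) (r t s h x M B : R) (k n m : nat).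

Section Hump.
Context (c tau : nat -> R) (T : R) (hc : forall k, `|c k| <= 3^-1 ^+ k)
  (htau : forall k, `|tau k| <= T).

Let t0 : (0 : R) <= 3^-1. Proof. by rewrite invr_ge0. Qed.
Let t2 : (3^-1 : R) <= 2^-1. Proof. by rewrite lef_pV2 ?posrE// ler_nat. Qed.
Let t1 : (3^-1 : R) < 1. Proof. by rewrite invf_lt1// ltr1n. Qed.

(** Partial sums of a series of translates with [|c k| <= 3^-k]. With ratio 1/3, the coefficients
    after the [n]-th add up to at most half of [3^-n], so a later tail cannot cancel a dominant
    [n]-th term. *)
Definition hump_sum f n s : R := \sum_(k < n) c k * f (tau k - s).

Let hump_sumS f n s : hump_sum f n.+1 s = c n * f (tau n - s) + hump_sum f n s.
Proof. by rewrite /hump_sum big_ord_recr /= [LHS]addrC. Qed.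

Lemma hump_sum_smooth f n : smooth f -> smooth (hump_sum f n).
Proof.
move=> sf; elim: n => [|n IH].
  have -> : hump_sum f 0 = fun t => 0 * f t.
    by apply/funext => t; rewrite /hump_sum big_ord0 mul0r.
  exact: smoothZ.
have -> : hump_sum f n.+1 = fun s => c n * f (tau n - s) + hump_sum f n s.
  by apply/funext => s; rewrite hump_sumS.
by apply: smoothD => //; apply: smoothZ; exact: smooth_refl.
Qed.

Lemma hump_sum_der f g n : der f g -> der (hump_sum f n) (fun s => - hump_sum g n s).
Proof.
move=> fg; elim: n => [|n IH].
  have -> : hump_sum f 0 = fun=> 0 by apply/funext => t; rewrite /hump_sum big_ord0.
  by apply: der_ext (der_cst 0) _ => t; rewrite /hump_sum big_ord0 oppr0.
have -> : hump_sum f n.+1 = fun s => c n * f (tau n - s) + hump_sum f n s.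
  by apply/funext => s; rewrite hump_sumS.
by apply: der_ext (derD (derZ (c n) (der_refl (tau n) fg)) IH) _ => s; rewrite hump_sumS; ring.
Qed.

Lemma hump_sum_csupp f r n : csupp r f -> csupp (r + T) (hump_sum f n).
Proof.
move=> cf s rs; rewrite /hump_sum big1// => k _; rewrite cf ?mulr0//.
have := ler_normB (tau k) (tau k - s).
have -> : tau k - (tau k - s) = s by ring.
by have := htau k; lra.
Qed.

Let hump_step f M : (forall t, `|f t| <= M) ->
  forall s n, `|hump_sum f n.+1 s - hump_sum f n s| <= M * 3^-1 ^+ n.
Proof.
move=> fM s n; rewrite hump_sumS addrK normrM [leRHS]mulrC.
by apply: ler_pM.
Qed.

(** One operator [F] is chosen for all functions, so that the limits attached to a function and to
    its derivatives can be compared. *)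
Lemma hump_limit : exists F : (R -> R) -> R -> R,
  forall f M, (forall t, `|f t| <= M) -> forall s n,
    `|F f s - hump_sum f n s| <= M / (1 - 3^-1) * 3^-1 ^+ n.
Proof.
have H (z : (R -> R) * R) : exists l, forall M, (forall t, `|z.1 t| <= M) ->
    forall n, `|l - hump_sum z.1 n z.2| <= M / (1 - 3^-1) * 3^-1 ^+ n.
  case: z => f s /=.
  have [[M0 HM0]|N] := pselect (exists M, forall t, `|f t| <= M); last first.
    by exists 0 => M HM; case: N; exists M.
  have [l Hl] := geo_sum_cvg t0 t1 (hump_step HM0 s); exists l => M HM n.
  exact: geo_sum_near t0 t2 (hump_step HM s) Hl n.
have [F HF] := choice H.
by exists (fun f s => F (f, s)) => f M HM s n; apply: (HF (f, s)).
Qed.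

Context (F : (R -> R) -> R -> R)
  (HF : forall f M, (forall t, `|f t| <= M) -> forall s n,
    `|F f s - hump_sum f n s| <= M / (1 - 3^-1) * 3^-1 ^+ n).

Let sumdiff n f f1 M h s : (forall t, `|f (t - h) - f t - (- h) * f1 t| <= M) ->
  `|hump_sum f n (s + h) - hump_sum f n s - h * - hump_sum f1 n s| <= M / (1 - 3^-1).
Proof.
move=> H; have M0 : 0 <= M by apply: le_trans (H 0).
(* For the induction, the bound is sharpened to the exact partial sum [(1 - 3^-n) / (1 - 3^-1)] of
   the geometric series. *)
suff : `|hump_sum f n (s + h) - hump_sum f n s - h * - hump_sum f1 n s|
    <= M / (1 - 3^-1) * (1 - 3^-1 ^+ n).
  move/le_trans; apply; rewrite ler_piMr//; first by rewrite divr_ge0// subr_ge0 ltW.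
elim: n => [|n IH].
  rewrite /hump_sum !big_ord0 expr0.
  have -> : 0 - 0 - h * - 0 = 0 :> R by ring.
  by rewrite normr0 subrr mulr0.
rewrite !hump_sumS.
have -> : c n * f (tau n - (s + h)) + hump_sum f n (s + h) - (c n * f (tau n - s) + hump_sum f n s)
   - h * - (c n * f1 (tau n - s) + hump_sum f1 n s)
  = c n * (f (tau n - s - h) - f (tau n - s) - (- h) * f1 (tau n - s))
    + (hump_sum f n (s + h) - hump_sum f n s - h * - hump_sum f1 n s).
  by rewrite opprD addrA; ring.
apply: (le_trans (ler_normD _ _)).
have -> : M / (1 - 3^-1) * (1 - 3^-1 ^+ n.+1) = 3^-1 ^+ n * M + M / (1 - 3^-1) * (1 - 3^-1 ^+ n).
  by rewrite exprS; field; lra.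
apply: lerD => //; rewrite normrM; apply: ler_pM => //.
Qed.

(** Termwise differentiation: the quadratic remainder is estimated on partial sums, uniformly in
    [n], and the error of order [3^-n] is removed by [le_geo]. *)
Let F_der f : bsmooth f -> der (F f) (fun s => - F (f^`())%classic s).
Proof.
move=> bf s; have [M M0 HM] := bsmooth_taylor bf.
have [A A0 HA] := bsmooth_bound bf; have [A1 A10 HA1] := bsmooth_bound (bsmooth_derive1 bf).
apply: (@is_derive_quad _ _ _ _ (M / (1 - 3^-1))) => h _.
rewrite mulrAC; apply: (@le_geo _ _ _ (A / (1 - 3^-1) + A / (1 - 3^-1)
   + `|h| * (A1 / (1 - 3^-1))) 3^-1) => // n.
have := HF HA (s + h) n; have := HF HA s n; have := HF HA1 s n.
have HT t : `|f (t - h) - f t - (- h) * (f^`())%classic t| <= M * h ^+ 2.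
  by have := HM t (- h); rewrite sqrrN.
have := @sumdiff n f _ (M * h ^+ 2) h s HT.
set X := F f (s + h); set Y := F f s; set Z := F _ s.
set X' := hump_sum f n (s + h); set Y' := hump_sum f n s; set Z' := hump_sum _ n s.
set E := 3^-1 ^+ n; move=> h1 h2 h3 h4.
have -> : X - Y - h * - Z = (X' - Y' - h * - Z') + (X - X') - (Y - Y') + h * (Z - Z') by ring.
have -> : M * h ^+ 2 / (1 - 3^-1) + (A / (1 - 3^-1) + A / (1 - 3^-1) + `|h| * (A1 / (1 - 3^-1))) * E
  = M * h ^+ 2 / (1 - 3^-1) + A / (1 - 3^-1) * E + A / (1 - 3^-1) * E
    + `|h| * (A1 / (1 - 3^-1) * E) by ring.
apply: (le_trans (ler_normD _ _)); apply: lerD; last by rewrite normrM ler_wpM2l.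
apply: (le_trans (ler_normB _ _)); apply: lerD => //.
by apply: (le_trans (ler_normD _ _)); apply: lerD.
Qed.

Lemma hump_remainder_der f n : bsmooth f ->
  der (fun s => F f s - hump_sum f n s)
      (fun s => - (F (f^`())%classic s - hump_sum (f^`())%classic n s)).
Proof.
move=> bf; apply: der_ext (derB (F_der bf) (hump_sum_der n (bsmooth_der bf))) _ => s.
by ring.
Qed.

Lemma hump_csupp f r : bsmooth f -> csupp r f -> csupp (r + T) (F f).
Proof.
move=> bf cf s rs; have [A A0 HA] := bsmooth_bound bf.
apply/eqP; rewrite -normr_le0.
apply: (@le_geo _ _ _ (A / (1 - 3^-1)) 3^-1) => // n; rewrite add0r.
by have := HF HA s n; rewrite (hump_sum_csupp n cf rs) subr0.
Qed.

Lemma hump_smooth f : bsmooth f -> smooth (F f).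
Proof.
move=> bf; apply: (@smooth_class _ [set g | exists a f, bsmooth f /\ g = fun s => a * F f s]).
  move=> _ [a [{bf} f [bf ->]]].
  exists (fun s => (- a) * F (f^`())%classic s).
    by exists (- a), (f^`())%classic; split => //; exact: bsmooth_derive1.
  by apply: der_ext (derZ a (F_der bf)) _ => s; ring.
by exists 1, f; split=> //; apply/funext => s; rewrite mul1r.
Qed.

Lemma hump_remainder_derive1n f n k : bsmooth f ->
  ((fun s => F f s - hump_sum f n s)^`(k))%classic =
  fun s => (-1) ^+ k * (F (f^`(k))%classic s - hump_sum (f^`(k))%classic n s).
Proof.
elim: k f => [|k IH] f bf; first by apply/funext => s; rewrite expr0 mul1r.
have bf1 := bsmooth_derive1 bf.
rewrite derive1Sn (der_derive1 (hump_remainder_der n bf)).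
have -> : (fun s => - (F (f^`())%classic s - hump_sum (f^`())%classic n s)) =
    fun s => (-1) * (F (f^`())%classic s - hump_sum (f^`())%classic n s).
  by apply/funext => s; rewrite mulN1r.
rewrite derive1nZ; last first.
  by apply: smoothB; [exact: hump_smooth|exact: hump_sum_smooth (bsmooth_smooth bf1)].
by rewrite IH//; apply/funext => s; rewrite !derive1Sn exprS mulrA.
Qed.

(** The derivatives of the remainder are, up to sign, the remainders of the derivatives, and decay
    like [3^-n] on a fixed compact set. Having finite order there, [S] acts on the series term by
    term. *)
Lemma hump_pairing (S : (R -> R) -> R) b r : distribution1 S -> smooth b -> csupp r b ->
  exists K, forall n, `|S (F b) - \sum_(k < n) c k * S (fun s => b (tau k - s))| <= K * 3^-1 ^+ n.
Proof.
move=> DS sb cb; have bb := csupp_bsmooth sb cb.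
have tb k : test_fun1 (fun s => b (tau k - s)).
  by apply: csupp_test_fun1 (csupp_refl cb); exact: smooth_refl.
have T0 : 0 <= T by apply: le_trans (htau 0).
have S0 : S (fun=> 0) = 0.
  have z : test_fun1 (fun _ : R => 0 : R).
    apply: (@csupp_test_fun1 _ r) => //; have := smoothZ 0 sb; congr smooth.
    by apply/funext => s; rewrite mul0r.
  have := distribution1_lin (-1) DS z z.
  have -> : (fun _ : R => -1 * 0 + 0 : R) = fun=> 0 by apply/funext => s; rewrite mulr0 addr0.
  lra.
have Ssum n : S (hump_sum b n) = \sum_(k < n) c k * S (fun s => b (tau k - s)).
  elim: n => [|n IH].
    rewrite big_ord0 -[RHS]S0; congr S; apply/funext => s; exact: big_ord0.
  have -> : hump_sum b n.+1 = fun s => c n * b (tau n - s) + hump_sum b n s.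
    by apply/funext => s; rewrite hump_sumS.
  rewrite distribution1_lin//; last first.
    exact: csupp_test_fun1 (hump_sum_smooth n sb) (hump_sum_csupp n cb).
  by rewrite IH big_ord_recr /= [RHS]addrC.
have [C C0 [N HC]] := distribution1_bound (r + T) DS.
have [M M0 HM] := @fin_bound R (fun k M => forall s, `|(b^`(k))%classic s| <= M) N
  (fun k => bsmooth_bound (csupp_bsmooth (smooth_derive1n k sb) (csupp_derive1n k sb cb)))
  (fun k M M' MM' H s => le_trans (H s) MM').
exists (C * (M / (1 - 3^-1))) => n.
have tF : test_fun1 (F b) by apply: csupp_test_fun1 (hump_csupp bb cb); exact: hump_smooth.
have ts : test_fun1 (hump_sum b n).
  exact: csupp_test_fun1 (hump_sum_smooth n sb) (hump_sum_csupp n cb).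
have := distribution1_lin (-1) DS ts tF; rewrite Ssum.
have -> : (fun t => -1 * hump_sum b n t + F b t) = fun t => F b t - hump_sum b n t.
  by apply/funext => t; ring.
move=> e; have -> : S (F b) - \sum_(k < n) c k * S (fun s => b (tau k - s))
   = S (fun t => F b t - hump_sum b n t) by rewrite e; ring.
rewrite -mulrA; apply: HC.
- by apply: smoothB; [exact: hump_smooth|exact: hump_sum_smooth].
- by move=> s rs; rewrite (hump_csupp bb cb rs) (hump_sum_csupp n cb rs) subrr.
- move=> k t kN; rewrite hump_remainder_derive1n// normrM normrX normrN1 expr1n mul1r.
  exact: HF (HM k kN) t n.
Qed.

End Hump.

(* A gliding hump: if the mollified values were unbounded, a lacunary sum of
   translates of [b] would be a test function with unbounded pairings. *)
Lemma mollified_bounded (u : R -> (R -> R) -> R) b r X T : 0 <= X -> 0 <= T ->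
  (forall x, 0 <= x -> distribution1 (u x)) ->
  (forall chi, test_fun1 chi -> {within `[0, +oo[, continuous (fun x => u x chi)}) ->
  smooth b -> csupp r b ->
  exists2 M, 0 <= M & forall x t, 0 <= x <= X -> `|t| <= T -> `|mollified u b x t| <= M.
Proof.
move=> X0 T0 Du cu sb cb; apply: contrapT => Hno.
have t0 : (0 : R) <= 3^-1 by rewrite invr_ge0.
have t1 : (3^-1 : R) < 1 by rewrite invf_lt1// ltr1n.
have t2 : (3^-1 : R) <= 2^-1 by rewrite lef_pV2 ?posrE// ler_nat.
pose v := mollified u b.
(* At an [x] where [|v|] exceeds [2 n 3^n], the time is moved to a maximum of [|v x|] on [[-T, T]].
   That maximum dominates the values of [v x] at all the other translations [tau k]. *)
have H n : exists z : R * R, [/\ 0 <= z.1 <= X, `|z.2| <= T,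
    3 ^+ n * (2 * n%:R) <= `|v z.1 z.2| & forall t, `|t| <= T -> `|v z.1 t| <= `|v z.1 z.2|].
  have [x [s [xX sT vM]]] : exists x s, [/\ 0 <= x <= X, `|s| <= T & 3 ^+ n * (2 * n%:R) < `|v x s|].
    apply: contrapT => N; apply: Hno; exists (3 ^+ n * (2 * n%:R)).
      by rewrite mulr_ge0 ?exprn_ge0// mulr_ge0.
    by move=> x s xX sT; rewrite leNgt; apply/negP => vM; apply: N; exists x, s.
  have x0 : 0 <= x by case/andP: xX.
  have cv := mollified_continuous (Du x x0) sb cb.
  have TT : - T <= T by lra.
  have [t] := EVT_max TT (continuous_subspaceT (cont_abs cv)).
  rewrite in_itv/= -ler_norml => tT Hmax; exists (x, t).
  have HM s' : `|s'| <= T -> `|v x s'| <= `|v x t|.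
    by move=> s'T; apply: Hmax; rewrite in_itv/= -ler_norml.
  split => //=; exact: le_trans (ltW vM) (HM s sT).
have [z Hz] := choice H; pose xi n := (z n).1; pose tau n := (z n).2.
have xiX n : 0 <= xi n <= X by have [] := Hz n.
have tauT n : `|tau n| <= T by have [] := Hz n.
have big n : 3 ^+ n * (2 * n%:R) <= `|v (xi n) (tau n)| by have [] := Hz n.
have dom n t : `|t| <= T -> `|v (xi n) t| <= `|v (xi n) (tau n)| by have [_ _ _] := Hz n; apply.
(* The sign is chosen so that the new term and the partial sum already built agree in sign at [xi n]
   and cannot cancel. *)
pose sg n (S : R -> R) : R := (if 0 <= S (xi n) * v (xi n) (tau n) then 1 else -1) * 3^-1 ^+ n.
pose Sf := fun n => nat_rect (fun=> R -> R) (fun=> 0)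
  (fun n S => fun x => S x + sg n S * v x (tau n)) n.
pose c n := sg n (Sf n).
have SfS n x : Sf n.+1 x = Sf n x + c n * v x (tau n) by [].
have normc n : `|c n| = 3^-1 ^+ n.
  rewrite /c /sg normrM (ger0_norm (exprn_ge0 _ t0)).
  by case: ifP; rewrite ?normrN normr1 mul1r.
have hc n : `|c n| <= 3^-1 ^+ n by rewrite normc.
have Sfsum n x : Sf n x = \sum_(k < n) c k * v x (tau k).
  by elim: n => [|n IH]; rewrite ?big_ord0// SfS IH big_ord_recr.
have low n : 3^-1 ^+ n * `|v (xi n) (tau n)| <= `|Sf n.+1 (xi n)|.
  rewrite SfS -normc -normrM; set A := Sf n _; set B := v _ _.
  have : 0 <= A * (c n * B).
    rewrite /c /sg -/A -/B mulrCA; case: ifPn => [h|].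
      by rewrite mul1r mulr_ge0// exprn_ge0.
    by rewrite -ltNge => /ltW h; rewrite mulN1r mulNr -mulrN mulr_ge0 ?exprn_ge0// oppr_ge0.
  move: (c n * B) => C AC.
  have [A0|A0] := leP 0 A; have [C0|C0] := leP 0 C.
  - by rewrite !ger0_norm ?lerDr// addr_ge0.
  - have A00 : A = 0.
      apply/eqP; rewrite eq_le A0 andbT leNgt; apply/negP => A1.
      by move: AC; rewrite leNgt pmulr_rlt0 ?C0.
    by rewrite A00 add0r.
  - have C00 : C = 0.
      apply/eqP; rewrite eq_le C0 andbT leNgt; apply/negP => C1.
      by move: AC; rewrite leNgt nmulr_rlt0 ?C1.
    by rewrite C00 normr0.
  - by rewrite (ltr0_norm C0) ltr0_norm; lra.
(* All terms after the [n]-th, evaluated at [xi n], stay below half of the [n]-th one. *)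
have tail n j : `|Sf (n.+1 + j)%N (xi n) - Sf n.+1 (xi n)|
    <= `|v (xi n) (tau n)| * ((3^-1 ^+ n - 3^-1 ^+ (n + j)) / 2).
  elim: j => [|j IH]; first by rewrite !addn0 !subrr mul0r mulr0 normr0.
  rewrite !addnS SfS addrAC.
  apply: (le_trans (ler_normD _ _)); apply: (le_trans (lerD IH _)).
    rewrite normrM normc; apply: ler_wpM2l (dom n _ (tauT _)); exact: exprn_ge0.
  rewrite addSn exprS; set m := `|v _ _|; set e := _ ^+ (n + j); lra.
have T1 k : `|tau k| <= T by exact: tauT.
have [F HF] := hump_limit tau hc.
have bb := csupp_bsmooth sb cb.
have tF : test_fun1 (F b).
  by apply: csupp_test_fun1 (hump_csupp T1 HF bb cb); apply: (hump_smooth hc HF).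
(* Weak continuity in [x] bounds the pairing with the single test function [F b] over all of
   [[0, X]]. *)
have [B HB] : exists B, forall x, 0 <= x <= X -> `|u x (F b)| <= B.
  have cw : {within `[0, X], continuous (fun x => u x (F b))}.
    apply: continuous_subspaceW (cu _ tF).
    by move=> x /=; rewrite !in_itv/= => /andP[->].
  have [c1 _ H1] := EVT_max X0 cw; have [c2 _ H2] := EVT_min X0 cw.
  exists (`|u c1 (F b)| + `|u c2 (F b)|) => x xX.
  have xin : x \in `[0, X] by rewrite in_itv.
  have := H1 x xin; have := H2 x xin.
  have := ler_norm (u c1 (F b)); have := ler_norm (- u c2 (F b)); rewrite normrN.
  have := normr_ge0 (u c1 (F b)); have := normr_ge0 (u c2 (F b)) => *.
  by rewrite ler_norml; apply/andP; split; lra.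
(* [n] exceeds [B]. At [xi n] the [n]-th term is at least [2 n] and the later terms take away at
   most half of it, so the pairing with [F b] would be at least [n]. *)
pose n := (Num.bound `|B|).
have nB : B < n%:R by apply: le_lt_trans (ler_norm B) _; rewrite archi_boundP.
have xi0 : 0 <= xi n by case/andP: (xiX n).
have [K HK] := hump_pairing hc T1 HF (Du _ xi0) sb cb.
suff : n%:R <= B by rewrite leNgt nB.
apply: (@le_geo _ _ _ (K * 3^-1 ^+ n.+1) 3^-1) => // j.
have := HK (n.+1 + j)%N; rewrite -/(v (xi n) _) -Sfsum exprD => hk.
have := HB _ (xiX n); have := tail n j; have := low n; have := big n.
set m := `|v _ _|; set W := u _ _ in hk *; set S1 := Sf n.+1 _; set S2 := Sf _ _ in hk *.
move=> m1 m2 m3 m4.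
have m5 : 3^-1 ^+ n * m <= 2 * `|S2|.
  have : `|S1| <= `|S2| + `|S2 - S1|.
    have -> : S1 = S2 - (S2 - S1) by ring.
    apply: le_trans (ler_normB _ _) _; rewrite subKr; lra.
  have : 0 <= m * 3^-1 ^+ (n + j) by rewrite mulr_ge0 ?normr_ge0 ?exprn_ge0.
  move: m2 m3; rewrite mulrA mulrBr (mulrC m (_ ^+ n)).
  set e1 := _ * m; set e2 := m * _; lra.
have m6 : 2 * n%:R <= 3^-1 ^+ n * m.
  by rewrite exprVn [leRHS]mulrC ler_pdivlMr ?exprn_gt0// mulrC.
have : `|S2| <= `|W| + `|W - S2|.
  have -> : S2 = W - (W - S2) by ring.
  by apply: le_trans (ler_normB _ _) _; rewrite subKr.
move: hk; rewrite mulrA; set e3 := K * _ * _; lra.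
Qed.

End UniformBoundedness.

(** * The equation tested on products *)

Section WeakEquation.
Context {R : realType}.
Implicit Types (f g b alpha beta : R -> R) (r s t x y X : R).

Lemma tensor_continuous alpha beta : continuous alpha -> continuous beta ->
  continuous (fun z : R * R => alpha z.1 * beta z.2).
Proof.
move=> ca cb z; apply: (@continuousM _ _ (fun z : R * R => alpha z.1) (fun z : R * R => beta z.2)).
  by apply: (@continuous_comp _ _ _ fst alpha); [exact: cvg_fst|exact: ca].
by apply: (@continuous_comp _ _ _ snd beta); [exact: cvg_snd|exact: cb].
Qed.

(** Extension to negative [x] by the boundary value, since the integration lemmas ask for continuity
    on the whole line. *)
Lemma continuous_max0 f : {within `[0, +oo[, continuous f} ->
  continuous (fun x => f (Num.max 0 x)).
Proof.
move=> cf x; have x0 : `[0, +oo[%classic (Num.max 0 x).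
  by rewrite /= in_itv/= andbT le_max lexx.
move=> V /(cf (Num.max 0 x)) HV'.
have {HV'}HV : within `[0, +oo[ (nbhs (Num.max 0 x)) (f @^-1` V).
  by rewrite nbhs_subspace_in.
rewrite /within /= in HV.
have lm : lip1 (fun x : R => Num.max 0 x).
  move=> T; exists 1 => y z _ _; rewrite mul1r /Num.max.
  have := ler_norm (y - z); have := ler_norm (z - y); rewrite (distrC z).
  have := normr_ge0 (y - z).
  by case: ifPn; case: ifPn; rewrite -?leNgt => *; rewrite ler_norml; apply/andP; split; lra.
apply: (@filterS _ (nbhs x) _ _ [set z | V (f (Num.max 0 z))] _ (@lip1_continuous _ _ lm x _ HV)).
move=> z /=; apply.
by rewrite in_itv/= andbT le_max lexx.
Qed.

Lemma tensor_class_C2d n alpha beta : smooth alpha -> smooth beta ->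
  class_C2d n (fun x t => alpha x * beta t).
Proof.
elim: n alpha beta => [|n IH] alpha beta sa sb; have ca := smooth_continuous sa;
  have cb := smooth_continuous sb; first by split=> //; exact: tensor_continuous.
have dx t : der (fun y => alpha y * beta t) (fun y => (alpha^`())%classic y * beta t).
  by apply: der_ext (derM (smooth_der sa) (der_cst (beta t))) _ => y; rewrite mulr0 addr0.
have dt x : der (fun t => alpha x * beta t) (fun t => alpha x * (beta^`())%classic t).
  exact: derZ (smooth_der sb).
split; first exact: tensor_continuous.
split.
- by move=> x t; have [] := dx t x.
- by move=> x t; have [] := dt x t.
- have -> : partial_x (fun x t => alpha x * beta t) = fun x t => (alpha^`())%classic x * beta t.
    by apply/funext => x; apply/funext => t; rewrite /partial_x (der_derive1 (dx t)).
  by apply: IH => //; exact: smooth_derive1.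
- have -> : partial_t (fun x t => alpha x * beta t) = fun x t => alpha x * (beta^`())%classic t.
    by apply/funext => x; apply/funext => t; rewrite /partial_t (der_derive1 (dt x)).
  by apply: IH => //; exact: smooth_derive1.
Qed.

Lemma tensor_test_fun2 ra rb alpha beta : smooth alpha -> smooth beta ->
  csupp ra alpha -> csupp rb beta -> test_fun2 (fun x t => alpha x * beta t).
Proof.
move=> sa sb ca cb; split; first by move=> n; exact: tensor_class_C2d.
pose K := [set` `[- ra, ra]] `*` [set` `[- rb, rb]] : set (R * R).
have cK : compact K by apply: compact_setX; exact: segment_compact.
have clK : closed K by apply: compact_closed cK; exact: norm_hausdorff.
apply: (subclosed_compact _ cK); first exact: closed_closure.
rewrite ((closure_id K).1 clK); apply: closure_subset => -[x t] /=.
rewrite mulf_eq0 negb_or => /andP[/eqP ax /eqP bt]; split=> /=; rewrite in_itv/= -ler_norml leNgt;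
  apply/negP => h; [exact: ax (ca _ h)|exact: bt (cb _ h)].
Qed.

Lemma distribution1Z (S : (R -> R) -> R) c f : distribution1 S -> test_fun1 f ->
  S (fun t => c * f t) = c * S f.
Proof.
move=> DS tf; have tz : test_fun1 (fun _ : R => 0 : R).
  apply: (@csupp_test_fun1 _ 0) => //; have := smoothZ 0 (Smooth tf.1); congr smooth.
  by apply/funext => s; rewrite mul0r.
have z0 : S (fun=> 0) = 0.
  have := distribution1_lin (-1) DS tz tz.
  have -> : (fun _ : R => -1 * 0 + 0 : R) = fun=> 0 by apply/funext => s; rewrite mulr0 addr0.
  lra.
rewrite -[RHS]addr0 -z0 -distribution1_lin//; congr S; apply/funext => s.
by rewrite addr0.
Qed.

Lemma Rintegral_itv_supp f X : (forall x, X < x -> f x = 0) ->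
  (\int[@lebesgue_measure R]_(x in `]0, +oo[) f x)%R = itg 0 X f.
Proof.
move=> f0; have e : [set` `]0, X]] = [set` `]0%R, +oo[] `&` [set` `]0, X]] :> set R.
  by apply/seteqP; split => x /=; rewrite !in_itv/= ?andbT; [case/andP => -> ->|case].
rewrite /itg e Rintegral_mkcondr; apply: eq_Rintegral => x.
rewrite inE/= in_itv/= andbT => x0; rewrite /patch; case: ifPn => //.
by rewrite notin_setE/= in_itv/= x0 /= => /negP; rewrite -ltNge => /f0.
Qed.

(** On products [alpha x * b (t - s)] the distributional equation becomes the weak form of
    [v_xx = v_tt + q v] in the variable [x] alone, with [t] as a parameter. *)
Lemma weak_equation q u b t X alpha : causal_solution q u -> 
  (forall x y, ig x y (extend0 q)) ->
  test_fun1 b -> smooth alpha ->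
  (exists a c, [/\ 0 < a, c < X & forall y, (y < a) || (c < y) -> alpha y = 0]) ->
  itg 0 X (fun y => ((alpha^`())^`())%classic y * mollified u b (Num.max 0 y) t)
  = itg 0 X (fun y => alpha y * (mollified u ((b^`())^`())%classic (Num.max 0 y) t
      + extend0 q y * mollified u b (Num.max 0 y) t)).
Proof.
move=> Hu Iq tb sa [a [c [a0 cX supp]]].
have [rb cb] := test_fun1_csupp tb; have sb : smooth b := Smooth tb.1.
have ca : csupp (`|a| + `|c|) alpha.
  move=> y ay; apply: supp; have := ler_norm c; have := ler_norm (- a); rewrite normrN.
  move: ay; rewrite ltr_normr => /orP[] ? ? ?; apply/orP; [right|left];
  have := normr_ge0 a; have := normr_ge0 c; lra.
set b2 := ((b^`())^`())%classic; set a2 := ((alpha^`())^`())%classic.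
have sb1 := smooth_derive1 sb; have sb2 := smooth_derive1 sb1.
have cb1 := csupp_der cb (smooth_der sb); have cb2 := csupp_der cb1 (smooth_der sb1).
pose beta s := b (t - s); pose beta2 s := b2 (t - s).
have sbeta : smooth beta := smooth_refl t sb.
have dbeta : der beta (fun s => - (b^`())%classic (t - s)) := der_refl t (smooth_der sb).
have dbeta' : der (fun s => - (b^`())%classic (t - s)) beta2.
  by apply: der_ext (derN (der_refl t (smooth_der sb1))) _ => s; rewrite opprK.
have tbeta : test_fun1 beta := csupp_test_fun1 sbeta (csupp_refl cb).
have tbeta2 : test_fun1 beta2.
  by apply: csupp_test_fun1 (csupp_refl cb2); exact: smooth_refl.
pose phi x s := alpha x * beta s.
have tphi : test_fun2 phi := tensor_test_fun2 sa sbeta ca (csupp_refl cb).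
have sub : tsupp (fun z : R * R => phi z.1 z.2) `<=` [set z | 0 < z.1].
  have clA : closed [set z : R * R | a <= z.1].
    by apply: (@closed_comp _ _ fst [set x | a <= x]) => [z _|]; [exact: cvg_fst|exact: closed_ge].
  move=> z /(closure_subset (B := [set z : R * R | a <= z.1])) h.
  have : closure [set z : R * R | a <= z.1] z.
    apply: h => -[x s] /=; rewrite mulf_eq0 negb_or leNgt => /andP[/eqP ax _].
    by apply/negP => xa; apply: ax; apply: supp; rewrite xa.
  by rewrite -((closure_id _).1 clA) /=; exact: lt_le_trans.
have ptt : partial_t (partial_t phi) = fun x s => alpha x * beta2 s.
  have -> : partial_t phi = fun x s => alpha x * (- (b^`())%classic (t - s)).
    by apply/funext => x; rewrite /partial_t (der_derive1 (derZ _ dbeta)).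
  by apply/funext => x; rewrite /partial_t (der_derive1 (derZ _ dbeta')).
have pxx : partial_x (partial_x phi) = fun x s => a2 x * beta s.
  have h f s : smooth f -> ((fun y => f y * beta s)^`())%classic = fun y => (f^`())%classic y * beta s.
    move=> sf; apply: der_derive1.
    by apply: der_ext (derM (smooth_der sf) (der_cst (beta s))) _ => y; rewrite mulr0 addr0.
  have -> : partial_x phi = fun x s => (alpha^`())%classic x * beta s.
    by apply/funext => x; apply/funext => s; rewrite /partial_x /phi h.
  by apply/funext => x; apply/funext => s; rewrite /partial_x h//; exact: smooth_derive1.
have := sol_equation Hu tphi sub; rewrite ptt pxx.
have a2supp y : (y < a) || (c < y) -> a2 y = 0.
  have dsupp f : smooth f -> (forall y, (y < a) || (c < y) -> f y = 0) ->
      forall y, (y < a) || (c < y) -> (f^`())%classic y = 0.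
    move=> sf fs z zac; have [_ e] := smooth_der sf z; rewrite -e.
    rewrite -[RHS](@derive_cst _ _ _ 0 z 1); apply: near_eq_derive.
    case/orP: zac => h; near=> w; apply: fs; apply/orP; [left|right].
      have : `|z - w| < a - z by near: w; apply: cvgr_dist_lt; rewrite // subr_gt0.
      by rewrite ltr_norml => /andP[? ?]; lra.
    have : `|z - w| < z - c by near: w; apply: cvgr_dist_lt; rewrite // subr_gt0.
    by rewrite ltr_norml => /andP[? ?]; lra.
  exact: dsupp (smooth_derive1 sa) (dsupp _ sa supp) y.
set F := (fun x => _ - _ + _).
have FE x : 0 < x -> F x = alpha x * mollified u b2 (Num.max 0 x) t
    - a2 x * mollified u b (Num.max 0 x) t
    + extend0 q x * (alpha x * mollified u b (Num.max 0 x) t).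
  move=> x0; have Dx := sol_distribution Hu (ltW x0); rewrite /F /mollified (max_r (ltW x0)).
  by rewrite !distribution1Z.
have -> : (\int[@lebesgue_measure R]_(x in `]0%R, +oo[) F x)%R = itg 0 X F.
  rewrite -[RHS](@itg_eq _ 0 X (fun x => if 0 < x then F x else 0)); last by move=> x /andP[->].
  rewrite -Rintegral_itv_supp.
    by apply: eq_Rintegral => x; rewrite inE/= in_itv/= andbT => ->.
  move=> x Xx; case: ifP => // x0; rewrite FE// a2supp ?supp ?(lt_trans cX Xx) ?orbT//.
  by rewrite !mul0r mulr0 subrr addr0.
have cm f : test_fun1 f -> continuous (fun x => u (Num.max 0 x) f).
  by move=> tf; apply: (@continuous_max0 (fun x => u x f)); exact: sol_continuous Hu _ tf.
have c1 := cm _ tbeta; have c2 := cm _ tbeta2.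
have ca0 := smooth_continuous sa.
have ca2 : continuous a2 by apply: smooth_continuous; do 2!apply: smooth_derive1.
rewrite (@itg_eq _ 0 X F (fun x => alpha x * (mollified u b2 (Num.max 0 x) t
   + extend0 q x * mollified u b (Num.max 0 x) t) - a2 x * mollified u b (Num.max 0 x) t)); last first.
  by move=> x /andP[/FE -> _]; ring.
have i2 : ig 0 X (fun x => a2 x * mollified u b (Num.max 0 x) t).
  by apply: ig_cont; exact: contM.
have i1 : ig 0 X (fun x => alpha x * (mollified u b2 (Num.max 0 x) t
   + extend0 q x * mollified u b (Num.max 0 x) t)).
  have j1 : ig 0 X (fun x => alpha x * mollified u b2 (Num.max 0 x) t).
    by apply: ig_cont; exact: contM.
  have j2 := ig_mul (Iq 0 X) (contM ca0 c1).
  by apply: ig_eq (igD j1 j2) => x _; rewrite /mollified; ring.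
by rewrite itgB// => /eqP; rewrite subr_eq0 => /eqP.
Unshelve. all: by end_near. Qed.

End WeakEquation.

(* A solution of [w_xx = w_tt + q w] on [x0, x1], in finite-difference form:
   [Q] is a primitive of [q], which enters only through increments of [Q], and the
   remainders are of second order with respect to the nondecreasing function [N]. *)
Record wave_solution (R : realType) (N Q : R -> R) (x0 x1 : R) (w wt wtt wx : R -> R -> R)
    : Prop := WaveSolution {
  ws_t : forall x, x0 <= x <= x1 -> der (w x) (wt x) ;
  ws_tt : forall x, x0 <= x <= x1 -> der (wt x) (wtt x) ;
  ws_ctt : forall x, x0 <= x <= x1 -> continuous (wtt x) ;
  ws_cx : forall x, x0 <= x <= x1 -> continuous (wx x) ;
  ws_est : forall T, exists2 K, 0 <= K & forall x y t, x0 <= x -> x <= y -> y <= x1 -> `|t| <= T ->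
    [/\ `|w x t| <= K, `|wx x t| <= K, `|wtt x t| <= K,
        `|w y t - w x t - (y - x) * wx x t| <= K * (y - x) * (N y - N x)
      & `|wx y t - wx x t - (y - x) * wtt x t - (Q y - Q x) * w x t|
          <= K * (y - x) * (N y - N x)] }.

(** * The mollified solution as an evolution in [x] *)

Section MollifiedSolution.
Context {R : realType} (q : R -> R) (u : R -> (R -> R) -> R).
Local Notation p := (extend0 q).
Local Notation v := (mollified u).
Context (hu : causal_solution q u) (ip : forall x y, ig x y p).
Context (N : R -> R) (hN : forall x y, x <= y -> itg x y (fun s => 1 + `|p s|) <= N y - N x).
Implicit Types (b : R -> R) (s t x y T : R).

Let src b t y : R := v ((b^`())^`())%classic y t + p y * v b y t.

Let tf_der b : test_fun1 b -> test_fun1 (b^`())%classic.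
Proof.
move=> tb; have [r cb] := test_fun1_csupp tb; have sb : smooth b := Smooth tb.1.
by apply: csupp_test_fun1 (csupp_der cb (smooth_der sb)); exact: smooth_derive1.
Qed.

Let tf_refl b t : test_fun1 b -> test_fun1 (fun s => b (t - s)).
Proof.
move=> tb; have [r cb] := test_fun1_csupp tb; have sb : smooth b := Smooth tb.1.
by apply: csupp_test_fun1 (csupp_refl cb); exact: smooth_refl.
Qed.

Let v_cont b t : test_fun1 b -> continuous (fun x => v b (Num.max 0 x) t).
Proof.
move=> tb; apply: (@continuous_max0 _ (fun x => v b x t)).
exact: (sol_continuous hu (tf_refl t tb)).
Qed.

Let ig_src b t x y : test_fun1 b -> 0 <= x -> ig x y (src b t).
Proof.
move=> tb x0; have I := igD (ig_cont x y (@v_cont _ t (tf_der (tf_der tb))))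
  (ig_mul (ip x y) (@v_cont _ t tb)).
refine (ig_eq _ I) => s /andP[xs _].
by rewrite /src max_r// ltW// (le_lt_trans x0).
Qed.

Let ig_lin b t c x y : test_fun1 b -> 0 <= x -> ig x y (fun s => (c - s) * src b t s).
Proof.
move=> tb x0; apply: ig_eq (ig_mul (ig_src t y tb x0) (_ : continuous (fun s => c - s))) => [s _|].
  by rewrite mulrC.
apply: contB; first exact: cont_cst.
by move=> s; exact: cvg_id.
Qed.

(** By the weak equation, [v] and the double primitive [G] of the source have the same second
    differences. Their difference is therefore affine in [x], with slope [s]. *)
Let repr b t X : test_fun1 b -> 0 < X -> exists s, forall x, 0 <= x <= X ->
  v b x t = v b 0 t + x * s + itg 0 x (fun y => (x - y) * src b t y).
Proof.
move=> tb X0; pose U y := v b (Num.max 0 y) t; have cU : continuous U by exact: v_cont.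
pose g y := v ((b^`())^`())%classic (Num.max 0 y) t + p y * v b (Num.max 0 y) t.
have gE y : 0 <= y -> g y = src b t y by move=> y0; rewrite /g /src max_r.
have Ig : ig 0 X g.
  by apply: ig_eq (ig_src t X tb (lexx 0)) => y /andP[/ltW/gE].
have W : forall alpha beta : R -> R, smooth alpha ->
    (exists2 f, der alpha f & der f beta) ->
    (exists a c, [/\ 0 < a, c < X & forall y, (y < a) || (c < y) -> alpha y = 0]) ->
    itg 0 X (fun y => beta y * U y) = itg 0 X (fun y => alpha y * g y).
  move=> alpha beta sa [f df dbeta] supp; have := weak_equation t hu ip tb sa supp.
  by rewrite (der_derive1 df) (der_derive1 dbeta).
pose G x := itg 0 X (fun y => pos_part (x - y) * g y).
have cpp c : continuous (fun y => pos_part (c - y)) by exact: cont_refl pos_part_continuous.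
have igp c : ig 0 X (fun y => pos_part (c - y) * g y).
  by apply: ig_eq (ig_mul Ig (cpp c)) => y _; rewrite mulrC.
have pp1 c c' : `|pos_part c - pos_part c'| <= `|c - c'|.
  rewrite /pos_part /Num.max.
  have := ler_norm (c - c'); have := ler_norm (c' - c); rewrite (distrC c').
  have := normr_ge0 (c - c').
  by case: ifPn; case: ifPn; rewrite -?leNgt => *; rewrite ler_norml; apply/andP; split; lra.
have cG : continuous G.
  have lG : lip1 G.
    move=> T; exists (itg 0 X (fun y => `|g y|)) => x y _ _; rewrite /G -itgB//.
    rewrite mulrC -itgZ; last exact: ig_abs.
    apply: itg_bound; [by apply: igZ; exact: ig_abs|exact: igB|] => s _.
    rewrite -mulrBl normrM ler_wpM2r//.
    have -> : x - y = x - s - (y - s) by ring.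
    exact: pp1.
  exact: lip1_continuous lG.
have GE x : 0 <= x <= X -> G x = itg 0 x (fun y => (x - y) * src b t y).
  move=> /andP[x0 xX]; rewrite /G (@itg_split _ 0 X x)//.
  rewrite [X in _ + X](@itg_eq _ x X _ (fun=> 0)) ?itg0 ?addr0; last first.
    by move=> y /andP[xy _]; rewrite /pos_part max_r ?mul0r//; lra.
  apply: itg_eq => y /andP[y0 yx]; rewrite gE ?ltW// /pos_part max_l//; lra.
have H x k : 0 <= k -> 0 < x - k -> x + k < X ->
    U (x + k) - G (x + k) - 2 * (U x - G x) + (U (x - k) - G (x - k)) = 0.
  move=> k0 xk xX; have := weak_second_diff cU Ig W k0 xk xX.
  have -> : itg 0 X (fun y => tent x k y * g y) = G (x + k) - 2 * G x + G (x - k).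
    rewrite /G -itgZ// -itgB//; last exact: igZ.
    rewrite -itgD//; last by apply: igB => //; exact: igZ.
    by congr itg; apply/funext => y; rewrite /tent; ring.
  by move=> e; lra.
have := midpoint_affine (contB cU cG) X0 H => /= A.
exists ((U X - G X - (U 0 - G 0)) / X) => x xX; have /= := A x xX.
have G0 : G 0 = 0.
  by rewrite GE ?lexx ?ltW// itg_empty.
rewrite -GE// G0 subr0 /U (max_r (lexx 0)) max_r; last by case/andP: xX.
by move=> e; lra.
Qed.

(** The derivative in [x] dictated by [repr]: the first summand is the slope [s], recovered from the
    value at [x = X], and the second is the primitive of the source. *)
Definition mollified_x X b x t : R :=
  (v b X t - v b 0 t - itg 0 X (fun y => (X - y) * src b t y)) / X + itg 0 x (src b t).

Context (X : R) (X0 : 0 < X).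
Local Notation vx := (mollified_x X).

Let incr b t x y : test_fun1 b -> 0 <= x -> x <= y -> y <= X ->
  v b y t - v b x t - (y - x) * vx b x t = itg x y (fun s => (y - s) * src b t s).
Proof.
move=> tb x0 xy yX; have [s Hs] := repr t tb X0.
have y0 := le_trans x0 xy; have xX := le_trans xy yX.
have sE : s = (v b X t - v b 0 t - itg 0 X (fun y => (X - y) * src b t y)) / X.
  by rewrite (Hs X) ?lexx ?ltW//; field; rewrite gt_eqF.
rewrite (Hs y) ?y0// (Hs x) ?x0// /mollified_x -sE.
rewrite (@itg_split _ 0 y x)//; last exact: ig_lin.
have -> : itg 0 x (fun z => (y - z) * src b t z) =
    itg 0 x (fun z => (x - z) * src b t z) + (y - x) * itg 0 x (src b t).
  rewrite -itgZ; last exact: ig_src.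
  rewrite -itgD; [|exact: ig_lin|by apply: igZ; exact: ig_src].
  by congr itg; apply/funext => z; ring.
by ring.
Qed.

Let vx_incr b t x y : test_fun1 b -> 0 <= x -> x <= y ->
  vx b y t - vx b x t = itg x y (src b t).
Proof.
move=> tb x0 xy; rewrite /mollified_x (@itg_split _ 0 y x)//; first ring.
exact: ig_src.
Qed.

Let bounded b T : test_fun1 b -> exists2 M, 0 <= M & forall x t, 0 <= x <= X -> `|t| <= T ->
  `|v b x t| <= M.
Proof.
move=> tb; have [r cb] := test_fun1_csupp tb; have sb : smooth b := Smooth tb.1.
have [M M0 HM] := mollified_bounded (ltW X0) (normr_ge0 T) (sol_distribution hu)
  (@sol_continuous _ _ _ hu) sb cb.
exists M => // x t xX tT; apply: HM => //; exact: le_trans tT (ler_norm _).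
Qed.

Let ig1p x y : ig x y (fun s => 1 + `|p s|).
Proof. by apply: igD; [apply: ig_cont; exact: cont_cst|exact: ig_abs]. Qed.

Let N_ge x y : x <= y -> 0 <= N y - N x.
Proof. by move=> xy; apply: le_trans (hN xy); apply: itg_ge0 => s _; exact: addr_ge0. Qed.

(* Every increment below is the integral of a function dominated by [1 + |p|]. *)
Let itg_dom f x y K : ig x y f -> 0 <= K -> x <= y ->
  (forall s, x < s <= y -> `|f s| <= K * (1 + `|p s|)) -> `|itg x y f| <= K * (N y - N x).
Proof.
move=> If K0 xy H; apply: (@le_trans _ _ (itg x y (fun s => K * (1 + `|p s|)))).
  by apply: itg_bound => //; exact: igZ.
by rewrite itgZ// ler_wpM2l// hN.
Qed.

Let src_bound b T : test_fun1 b -> exists2 M, 0 <= M & forall x t, 0 <= x <= X -> `|t| <= T ->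
  `|src b t x| <= M * (1 + `|p x|).
Proof.
move=> tb; have [M M0 HM] := bounded T tb; have [M2 M20 HM2] := bounded T (tf_der (tf_der tb)).
exists (M + M2); first exact: addr_ge0.
move=> x t xX tT; apply: (le_trans (ler_normD _ _)); rewrite normrM.
have := HM x t xX tT; have := HM2 x t xX tT; have := normr_ge0 (p x) => p0 h2 h1.
have : `|p x| * `|v b x t| <= `|p x| * M by rewrite ler_wpM2l.
have : 0 <= `|p x| * M2 by rewrite mulr_ge0.
move: (`|p x|) (`|v b x t|) h1 h2 => P V; lra.
Qed.

Let vx_bound b T : test_fun1 b -> exists2 M, 0 <= M & forall x t, 0 <= x <= X -> `|t| <= T ->
  `|vx b x t| <= M.
Proof.
move=> tb; have [M M0 HM] := bounded T tb; have [M2 M20 HM2] := src_bound T tb.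
pose D := N X - N 0; have D0 : 0 <= D by apply: N_ge; exact: ltW.
exists ((2 * M + X * M2 * D) / X + M2 * D).
  by rewrite addr_ge0 ?divr_ge0 ?addr_ge0 ?mulr_ge0 ?(ltW X0).
move=> x t xX tT; apply: (le_trans (ler_normD _ _)); apply: lerD.
  rewrite normrM [X in _ * X]ger0_norm ?invr_ge0 ?(ltW X0)//.
  rewrite ler_wpM2r ?invr_ge0 ?(ltW X0)//.
  have XX : 0 <= X <= X by rewrite lexx andbT ltW.
  have OX : 0 <= (0 : R) <= X by rewrite lexx ltW.
  have := HM X t XX tT; have := HM 0 t OX tT.
  have : `|itg 0 X (fun y => (X - y) * src b t y)| <= X * M2 * D.
    apply: itg_dom; [exact: ig_lin|by rewrite mulr_ge0// ltW|exact: ltW|] => s /andP[s0 sX].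
    rewrite normrM -mulrA; apply: ler_pM => //; last by apply: HM2; rewrite ?(ltW s0).
    by rewrite ger0_norm ?subr_ge0//; lra.
  have := ler_normB (v b X t - v b 0 t) (itg 0 X (fun y => (X - y) * src b t y)).
  have := ler_normB (v b X t) (v b 0 t); lra.
case/andP: xX => x0 xX.
apply: (@le_trans _ _ (M2 * (N x - N 0))).
  apply: itg_dom => //; first exact: ig_src.
  by move=> s /andP[s0 sx]; apply: HM2 => //; rewrite (ltW s0) (le_trans sx).
by rewrite ler_wpM2l// /D; have := N_ge xX; lra.
Qed.

Let v_lip b T : test_fun1 b -> exists2 L, 0 <= L & forall x y t, 0 <= x -> x <= y -> y <= X ->
  `|t| <= T -> `|v b y t - v b x t| <= L * (y - x).
Proof.
move=> tb; have [M M0 HM] := vx_bound T tb; have [M2 M20 HM2] := src_bound T tb.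
pose D := N X - N 0; have D0 : 0 <= D by apply: N_ge; exact: ltW.
exists (M + M2 * D); first by rewrite addr_ge0// mulr_ge0.
move=> x y t x0 xy yX tT; have xX : 0 <= x <= X by rewrite x0 (le_trans xy).
have -> : v b y t - v b x t = (y - x) * vx b x t + itg x y (fun s => (y - s) * src b t s).
  by rewrite -incr//; ring.
apply: (le_trans (ler_normD _ _)); rewrite [leRHS]mulrDl; apply: lerD.
  by rewrite normrM mulrC (@ger0_norm _ (y - x)) ?subr_ge0// ler_wpM2r ?subr_ge0// HM.
apply: (@le_trans _ _ ((M2 * (y - x)) * (N y - N x))).
  apply: itg_dom => //; [exact: ig_lin|by rewrite mulr_ge0// subr_ge0|] => s /andP[xs sy].
  rewrite normrM mulrAC mulrC; apply: ler_pM => //.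
    by apply: HM2 => //; rewrite (le_trans x0 (ltW xs)) (le_trans sy).
  by rewrite ger0_norm ?subr_ge0//; lra.
rewrite [in leRHS]mulrAC ler_wpM2l ?mulr_ge0 ?subr_ge0//.
by have := N_ge x0; have := N_ge yX; rewrite /D; lra.
Qed.

(** Increments in [x] are integrals of the source over [[x, y]]. Bounds on compact sets and
    Lipschitz bounds in [x] for [v] and [v_tt] make their remainders of second order. *)
Lemma mollified_wave_solution b : test_fun1 b ->
  wave_solution N (fun x => itg 0 x p) 0 X
    (v b) (v (b^`())%classic) (v ((b^`())^`())%classic) (vx b).
Proof.
move=> tb; have tb1 := tf_der tb; have tb2 := tf_der tb1.
have vder f x : test_fun1 f -> 0 <= x -> der (v f x) (v (f^`())%classic x).
  move=> tf x0; have [r cf] := test_fun1_csupp tf.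
  exact: (mollified_der (sol_distribution hu x0) (Smooth tf.1) cf).
split.
- by move=> x /andP[x0 _]; exact: vder.
- by move=> x /andP[x0 _]; exact: vder.
- by move=> x /andP[x0 _]; exact: der_continuous (vder _ _ tb2 x0).
- move=> x /andP[x0 xX].
  have c1 y : 0 <= y -> continuous (v b y) by move=> y0; exact: der_continuous (vder _ _ tb y0).
  have key y c : 0 <= y -> y <= X -> continuous (fun t => itg 0 y (fun s => (c - s) * src b t s))
      /\ continuous (fun t => itg 0 y (src b t)).
    move=> y0 yX; suff H (f : R -> R) : continuous f ->
        lip1 (fun t => itg 0 y (fun s => f s * src b t s)).
      split.
        apply: lip1_continuous; apply: H; apply: contB; first exact: cont_cst.
        by move=> s; exact: cvg_id.
      have -> : (fun t => itg 0 y (src b t)) = fun t => itg 0 y (fun s => 1 * src b t s).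
        by apply/funext => t; apply: itg_eq => s _; rewrite mul1r.
      by apply: lip1_continuous; apply: H; exact: cont_cst.
    (* Lipschitz constants in time for [v] and [v_tt] are bounds for [u] mollified with [b'] and
       with [b''']. *)
    move=> cf T; have [M M0 HM] := bounded `|T| tb1; have [M2 M20 HM2] := bounded `|T| (tf_der tb2).
    have [A A0 HA] := continuous_bounded X cf.
    have igf t : ig 0 y (fun s => f s * src b t s).
      by apply: ig_eq (ig_mul (ig_src t y tb (lexx 0)) cf) => s _; rewrite mulrC.
    exists (A * (M + M2) * (N y - N 0)) => t t' tT t'T.
    rewrite -itgB// mulrAC; apply: itg_dom => //; first exact: igB.
      by rewrite !mulr_ge0// addr_ge0.
    move=> s /andP[s0 sy]; have sX : 0 <= s <= X by rewrite (ltW s0) (le_trans sy).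
    have lip f' M' : test_fun1 f' -> (forall x t, 0 <= x <= X -> `|t| <= `|T| ->
        `|v (f'^`())%classic x t| <= M') -> `|v f' s t - v f' s t'| <= M' * `|t - t'|.
      move=> tf' HM'; apply: (@der_lip_ball _ _ _ _ `|T| _ _ (vder _ s tf' (ltW s0))).
      - by move=> z zT; apply: HM'.
      - exact: le_trans t'T (ler_norm _).
      - exact: le_trans tT (ler_norm _).
    have h1 := lip _ _ tb HM; have h2 := lip _ _ tb2 HM2.
    rewrite -mulrBr normrM -!mulrA; apply: ler_pM => //.
      by apply: HA; rewrite ger0_norm ?(ltW s0)// (le_trans sy).
    have sub (k a1 a2 b1 b2 : R) : a1 + k * b1 - (a2 + k * b2) = (a1 - a2) + k * (b1 - b2) by ring.
    rewrite /src sub.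
    apply: (le_trans (ler_normD _ _)); rewrite normrM.
    have : `|p s| * `|v b s t - v b s t'| <= `|p s| * (M * `|t - t'|) by rewrite ler_wpM2l.
    have : 0 <= M * `|t - t'| by rewrite mulr_ge0.
    have : 0 <= M2 * `|t - t'| * `|p s| by rewrite !mulr_ge0.
    move: h2; move: (`|p s|) (`|t - t'|) (`|v b s t - v b s t'|) (`|_ - _|) => P D V W; lra.
  have [c2 _] := key X X (ltW X0) (lexx _); have [_ c3] := key x X x0 xX.
  apply: contD => //; apply: contM; last exact: cont_cst.
  by apply: contB => //; apply: contB; apply: c1 => //; exact: ltW.
move=> T; have [M M0 HM] := bounded T tb; have [M2 M20 HM2] := bounded T tb2.
have [A A0 HA] := vx_bound T tb; have [B B0 HB] := src_bound T tb.
have [L L0 HL] := v_lip T tb; have [L2 L20 HL2] := v_lip T tb2.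
exists (M + M2 + A + B + (L + L2)); first by rewrite !addr_ge0.
move=> x y t x0 xy yX tT; have xX : 0 <= x <= X by rewrite x0 (le_trans xy).
have yx0 : 0 <= (y - x) * (N y - N x) by rewrite mulr_ge0 ?N_ge// subr_ge0.
have sX s : x < s <= y -> 0 <= s <= X.
  by move=> /andP[xs sy]; rewrite (le_trans x0 (ltW xs)) (le_trans sy).
split.
- by apply: le_trans (HM x t xX tT) _; lra.
- by apply: le_trans (HA x t xX tT) _; lra.
- by apply: le_trans (HM2 x t xX tT) _; lra.
- rewrite incr//; apply: (@le_trans _ _ (B * (y - x) * (N y - N x))); last first.
    by rewrite -!mulrA ler_wpM2r//; lra.
  apply: itg_dom => //; [exact: ig_lin|by rewrite mulr_ge0// subr_ge0|] => s xsy.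
  rewrite normrM mulrAC mulrC; apply: ler_pM => //; first by apply: HB => //; exact: sX.
  by case/andP: xsy => xs sy; rewrite ger0_norm ?subr_ge0//; lra.
- rewrite vx_incr//.
  have -> : itg 0 y p - itg 0 x p = itg x y p by rewrite (@itg_split _ 0 y x)//; ring.
  have -> : itg x y (src b t) - (y - x) * v ((b^`())^`())%classic x t - itg x y p * v b x t
     = itg x y (fun s => src b t s - v ((b^`())^`())%classic x t - v b x t * p s).
    have ic : ig x y (fun=> v ((b^`())^`())%classic x t) by apply: ig_cont; exact: cont_cst.
    have isr := ig_src t y tb x0.
    rewrite itgB//; [|exact: igB|exact: igZ]; rewrite itgB// itgZ//.
    rewrite (itg_cont xy (@cont_cst _ (v ((b^`())^`())%classic x t))).
    rewrite (@oint_FTC _ (fun s => v ((b^`())^`())%classic x t * s + 0) _ x y (der_affine _ _)).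
    by ring.
  (* The integrand is [v_tt s - v_tt x + p s * (v s - v x)], of size [(y - x) * (1 + |p s|)] by the
     Lipschitz bounds in [x]. *)
  apply: (@le_trans _ _ ((L + L2) * (y - x) * (N y - N x))); last first.
    by rewrite -!mulrA ler_wpM2r//; lra.
  apply: itg_dom => //.
  + by apply: igB; [apply: igB; [exact: ig_src|apply: ig_cont; exact: cont_cst]|exact: igZ].
  + by rewrite mulr_ge0 ?subr_ge0// addr_ge0.
  move=> s xsy; case/andP: (xsy) => xs sy; have sX' := le_trans sy yX.
  have h1 := HL x s t x0 (ltW xs) sX' tT; have h2 := HL2 x s t x0 (ltW xs) sX' tT.
  have h3 : L * (s - x) <= L * (y - x) by rewrite ler_wpM2l//; lra.
  have h4 : L2 * (s - x) <= L2 * (y - x) by rewrite ler_wpM2l//; lra.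
  have -> : src b t s - v ((b^`())^`())%classic x t - v b x t * p s
     = (v ((b^`())^`())%classic s t - v ((b^`())^`())%classic x t) + p s * (v b s t - v b x t).
    by rewrite /src; ring.
  apply: (le_trans (ler_normD _ _)); rewrite normrM.
  have h5 := ler_wpM2l (normr_ge0 (p s)) (le_trans h1 h3).
  have h6 : 0 <= L * (y - x) by rewrite mulr_ge0// subr_ge0.
  have h7 : 0 <= `|p s| * (L2 * (y - x)) by rewrite !mulr_ge0// subr_ge0.
  have -> : (L + L2) * (y - x) * (1 + `|p s|) = L * (y - x) + `|p s| * (L * (y - x))
    + L2 * (y - x) + `|p s| * (L2 * (y - x)) by ring.
  have := le_trans h2 h4; move: h5 h6 h7.
  by move=> *; lra.
Qed.

End MollifiedSolution.

(** * Green's identity *)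

Section Green.
Context {R : realType}.
Implicit Types (N Q : R -> R) (w z : R -> R -> R) (s t x y T K : R).

Lemma ler_norm_mul (a b A B : R) : `|a| <= A -> `|b| <= B -> `|a * b| <= A * B.
Proof. by move=> *; rewrite normrM; apply: ler_pM. Qed.

(** A discrete product rule for [wx z - w zx] over a step [k]. Four remainders times bounded factors
    contribute [4 K^2] to the constant, and two terms with an increment of [wx] or [zx] contribute
    [2 K^2 (2 + X)]. *)
Lemma green_pointwise (k n X K w wx wtt w' wx' z zx ztt z' zx' dw dz : R) :
  0 <= k -> k <= X -> k <= n -> `|dw| <= n -> `|dz| <= n -> 0 <= K ->
  [/\ `|w| <= K, `|wx| <= K & `|wtt| <= K] -> [/\ `|z| <= K, `|zx| <= K & `|ztt| <= K] ->
  `|wx'| <= K -> `|zx'| <= K ->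
  `|w' - w - k * wx| <= K * k * n -> `|wx' - wx - k * wtt - dw * w| <= K * k * n ->
  `|z' - z - k * zx| <= K * k * n -> `|zx' - zx - k * ztt - dz * z| <= K * k * n ->
  `|wx' * z' - w' * zx' - (wx * z - w * zx) - k * (wtt * z - w * ztt) - (dw - dz) * (w * z)|
    <= K ^+ 2 * (8 + 2 * X) * k * n.
Proof.
move=> k0 kX kn dwn dzn K0 [w0 wx0 wtt0] [z0 zx0 ztt0] wx'0 zx'0 e1 e2 e3 e4.
have n0 : 0 <= n := le_trans k0 kn.
have X0 : 0 <= X := le_trans k0 kX.
have d1 (a a' att da b : R) : `|att| <= K -> `|b| <= K -> `|da| <= n ->
    `|a' - a - k * att - da * b| <= K * k * n -> `|a' - a| <= n * K * (2 + X).
  move=> h1 h2 h3 h4.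
  have -> : a' - a = (a' - a - k * att - da * b) + k * att + da * b by ring.
  apply: (le_trans (ler_normD _ _)); apply: (le_trans (lerD (ler_normD _ _) (lexx _))).
  have -> : n * K * (2 + X) = K * X * n + n * K + n * K by ring.
  apply: lerD; last exact: ler_norm_mul.
  apply: lerD; first by apply: (le_trans h4); rewrite ler_wpM2r// ler_wpM2l.
  by apply: ler_norm_mul => //; rewrite ger0_norm.
have dwx := d1 _ _ _ _ _ wtt0 w0 dwn e2; have dzx := d1 _ _ _ _ _ ztt0 z0 dzn e4.
have -> : wx' * z' - w' * zx' - (wx * z - w * zx) - k * (wtt * z - w * ztt) - (dw - dz) * (w * z)
  = (wx' - wx - k * wtt - dw * w) * z - w * (zx' - zx - k * ztt - dz * z)
    + wx' * (z' - z - k * zx) - zx' * (w' - w - k * wx)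
    + k * ((wx' - wx) * zx) - k * ((zx' - zx) * wx) by ring.
have -> : K ^+ 2 * (8 + 2 * X) * k * n = K * k * n * K + K * (K * k * n) + K * (K * k * n)
   + K * (K * k * n) + k * (n * K * (2 + X) * K) + k * (n * K * (2 + X) * K) by ring.
have kk : `|k| <= k by rewrite ger0_norm.
apply: (le_trans (ler_normB _ _)); apply: lerD; last by do 2!apply: ler_norm_mul => //.
apply: (le_trans (ler_normD _ _)); apply: lerD; last by do 2!apply: ler_norm_mul => //.
apply: (le_trans (ler_normB _ _)); apply: lerD; last exact: ler_norm_mul.
apply: (le_trans (ler_normD _ _)); apply: lerD; last exact: ler_norm_mul.
by apply: (le_trans (ler_normB _ _)); apply: lerD; exact: ler_norm_mul.
Qed.

Section GreenIdentity.
Context (N Qw Qz : R -> R) (x0 x1 a c : R) (w wt wtt wx z zt ztt zx : R -> R -> R).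
Context (Hw : wave_solution N Qw x0 x1 w wt wtt wx) (Hz : wave_solution N Qz x0 x1 z zt ztt zx).
Context (x01 : x0 <= x1) (ac : a <= c).
Context (hN : forall x y, x0 <= x -> x <= y -> y <= x1 ->
  [/\ y - x <= N y - N x, `|Qw y - Qw x| <= N y - N x & `|Qz y - Qz x| <= N y - N x]).
Context (hbd : forall x, x0 <= x <= x1 ->
  wt x c * z x c - w x c * zt x c - (wt x a * z x a - w x a * zt x a) = 0).

(** The Wronskian with respect to [x], integrated over the time window; [om] is the factor of the
    difference of the potentials in its variation. *)
Let W x := oint (fun t => wx x t * z x t - w x t * zx x t) a c.
Let om x := oint (fun t => w x t * z x t) a c.

Let cw x : x0 <= x <= x1 -> continuous (w x).
Proof. by move=> xX; exact: der_continuous (ws_t Hw xX). Qed.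
Let cz x : x0 <= x <= x1 -> continuous (z x).
Proof. by move=> xX; exact: der_continuous (ws_t Hz xX). Qed.

Let cW x : x0 <= x <= x1 -> continuous (fun t => wx x t * z x t - w x t * zx x t).
Proof.
move=> xX; apply: contB; apply: contM; [exact: ws_cx Hw _ xX|exact: cz|exact: cw|exact: ws_cx Hz _ xX].
Qed.

Let com x : x0 <= x <= x1 -> continuous (fun t => w x t * z x t).
Proof. by move=> xX; apply: contM; [exact: cw|exact: cz]. Qed.

Let ibp x : x0 <= x <= x1 ->
  continuous (fun t => wtt x t * z x t - w x t * ztt x t) /\
  oint (fun t => wtt x t * z x t - w x t * ztt x t) a c = 0.
Proof.
move=> xX; split.
  apply: contB; apply: contM; [exact: ws_ctt Hw _ xX|exact: cz|exact: cw|exact: ws_ctt Hz _ xX].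
rewrite (@oint_FTC _ (fun t => wt x t * z x t - w x t * zt x t)); first exact: hbd.
apply: der_ext (derB (derM (ws_tt Hw xX) (ws_t Hz xX)) (derM (ws_t Hw xX) (ws_tt Hz xX))) _ => t.
by ring.
Qed.

Let bounds : exists2 K, 0 <= K & forall x y t, x0 <= x -> x <= y -> y <= x1 -> a <= t <= c ->
  [/\ [/\ `|w x t| <= K, `|wx x t| <= K & `|wtt x t| <= K],
      [/\ `|z x t| <= K, `|zx x t| <= K & `|ztt x t| <= K],
      `|w y t - w x t - (y - x) * wx x t| <= K * (y - x) * (N y - N x) /\
      `|wx y t - wx x t - (y - x) * wtt x t - (Qw y - Qw x) * w x t|
          <= K * (y - x) * (N y - N x)
    & `|z y t - z x t - (y - x) * zx x t| <= K * (y - x) * (N y - N x) /\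
      `|zx y t - zx x t - (y - x) * ztt x t - (Qz y - Qz x) * z x t|
          <= K * (y - x) * (N y - N x)].
Proof.
have [K1 K10 H1] := ws_est Hw (`|a| + `|c|); have [K2 K20 H2] := ws_est Hz (`|a| + `|c|).
exists (K1 + K2); first exact: addr_ge0.
move=> x y t x0x xy yx1 /andP[at_ tc].
have tT : `|t| <= `|a| + `|c|.
  have := ler_norm c; have := ler_norm (- a); rewrite normrN.
  have := normr_ge0 a; have := normr_ge0 c => *.
  by rewrite ler_norml; apply/andP; split; lra.
have [h1 h2 h3 h4 h5] := H1 x y t x0x xy yx1 tT.
have [g1 g2 g3 g4 g5] := H2 x y t x0x xy yx1 tT.
have [dN _ _] := hN x0x xy yx1.
have e (K K' : R) : K <= K' -> K * (y - x) * (N y - N x) <= K' * (y - x) * (N y - N x).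
  have yx : 0 <= y - x by rewrite subr_ge0.
  by move=> KK; rewrite ler_wpM2r ?(le_trans yx)// ler_wpM2r.
have k1 : K1 <= K1 + K2 by rewrite lerDl.
have k2 : K2 <= K1 + K2 by rewrite lerDr.
by split; split; first [exact: le_trans k1|exact: le_trans k2|exact: le_trans (e _ _ k1)
  |exact: le_trans (e _ _ k2)].
Qed.

(** The term with [wtt] and [ztt] is a time derivative, removed by the boundary condition on the
    window. To first order there remains the difference of the increments of the potentials times
    [om]. *)
Let increments : exists C, forall x y, x0 <= x -> x <= y -> y <= x1 ->
  `|W y - W x - (Qw y - Qw x - (Qz y - Qz x)) * om x| <= C * (y - x) * (N y - N x).
Proof.
have [K K0 HK] := bounds; exists (K ^+ 2 * (8 + 2 * (x1 - x0)) * (c - a)) => x y x0x xy yx1.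
have xX : x0 <= x <= x1 by rewrite x0x (le_trans xy).
have yX : x0 <= y <= x1 by rewrite yx1 (le_trans x0x).
have [cI I0] := ibp xX; have [dN dQw dQz] := hN x0x xy yx1.
have cc (k : R) : continuous (fun _ : R => k) by exact: cont_cst.
have -> : W y - W x - (Qw y - Qw x - (Qz y - Qz x)) * om x
  = oint (fun t => wx y t * z y t - w y t * zx y t - (wx x t * z x t - w x t * zx x t)
      - (y - x) * (wtt x t * z x t - w x t * ztt x t)
      - (Qw y - Qw x - (Qz y - Qz x)) * (w x t * z x t)) a c.
  have cWx := cW xX; have cWy := cW yX; have comx := com xX.
  rewrite ointB; [|by apply: contB; [exact: contB|exact: contM]|exact: contM].
  rewrite ointB; [|exact: contB|exact: contM].
  by rewrite ointB// !ointZ// I0 mulr0 subr0.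
have -> : K ^+ 2 * (8 + 2 * (x1 - x0)) * (c - a) * (y - x) * (N y - N x)
  = K ^+ 2 * (8 + 2 * (x1 - x0)) * (y - x) * (N y - N x) * (c - a) by ring.
apply: oint_abs_le => //.
  have cWx := cW xX; have cWy := cW yX; have comx := com xX.
  by apply: contB; [apply: contB; [exact: contB|exact: contM]|exact: contM].
move=> t tac; have [h1 h2 [h3 h4] [h5 h6]] := HK x y t x0x xy yx1 tac.
case/andP: yX => x0y _.
have [[_ g1 _] [_ g2 _] _ _] := HK y y t x0y (lexx y) yx1 tac.
by apply: green_pointwise => //; lra.
Qed.

(** Equal increments of [Qw] and [Qz] leave only a remainder of second order, to which [quad_const]
    applies. *)
Lemma green_const : (forall x y, x0 <= x -> x <= y -> y <= x1 -> Qw y - Qw x = Qz y - Qz x) ->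
  W x1 = W x0.
Proof.
move=> HQ; have [C HC] := increments.
apply: (@quad_const _ W (fun x => C * N x)) => // x y x0x xy yx1.
have := HC x y x0x xy yx1; rewrite HQ// subrr mul0r subr0.
by have -> : (y - x) * (C * N y - C * N x) = C * (y - x) * (N y - N x) by ring.
Qed.

(** [om] is controlled on [[x0, x1]] only; composed with the projection onto that interval it
    becomes continuous on the line. *)
Let clamp x := Num.max x0 (Num.min x1 x).

Let clampX x : x0 <= clamp x <= x1.
Proof. by rewrite /clamp le_max lexx ge_max x01 ge_min lexx. Qed.

Let clamp_id x : x0 <= x <= x1 -> clamp x = x.
Proof. by move=> /andP[? ?]; rewrite /clamp min_r// max_r. Qed.

Let clamp_lip x y : `|clamp x - clamp y| <= `|x - y|.
Proof.
rewrite /clamp /Num.max /Num.min.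
have := ler_norm (x - y); have := ler_norm (y - x); rewrite (distrC y).
have := normr_ge0 (x - y).
by case: ifPn; case: ifPn; case: ifPn; case: ifPn; rewrite -?leNgt => *;
  rewrite ler_norml; apply/andP; split; lra.
Qed.

Let om_lip : exists2 L, 0 <= L & forall x y, x0 <= x -> x <= y -> y <= x1 ->
  `|om y - om x| <= L * (y - x).
Proof.
have [K K0 HK] := bounds; pose D := N x1 - N x0.
have D0 : 0 <= D.
  by have [dN _ _] := hN (lexx x0) x01 (lexx x1); apply: le_trans dN; rewrite subr_ge0.
pose M := K + K * D; have M0 : 0 <= M by rewrite addr_ge0// mulr_ge0.
exists ((M * K + K * M) * (c - a)); first by rewrite mulr_ge0 ?subr_ge0// addr_ge0 ?mulr_ge0.
move=> x y x0x xy yx1; have xX : x0 <= x <= x1 by rewrite x0x (le_trans xy).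
have yX : x0 <= y <= x1 by rewrite yx1 (le_trans x0x).
have x0y := le_trans x0x xy.
rewrite -ointB; [|exact: com|exact: com]; rewrite mulrAC; apply: oint_abs_le => //.
  by apply: contB; exact: com.
move=> t tac; have [[h1 h2 _] [g1 g2 _] [h3 _] [g3 _]] := HK x y t x0x xy yx1 tac.
have [[h1' _ _] [g1' _ _] _ _] := HK y y t x0y (lexx y) yx1 tac.
have yx0 : 0 <= y - x by rewrite subr_ge0.
have ND : N y - N x <= D.
  have [d1 _ _] := hN (lexx x0) x0x (le_trans xy yx1); have [d2 _ _] := hN x0y yx1 (lexx x1).
  by rewrite /D; lra.
have d (f f' fx : R) : `|fx| <= K -> `|f' - f - (y - x) * fx| <= K * (y - x) * (N y - N x) ->
    `|f' - f| <= M * (y - x).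
  move=> k1 k2; have -> : f' - f = (y - x) * fx + (f' - f - (y - x) * fx) by ring.
  have -> : M * (y - x) = (y - x) * K + K * (y - x) * D by rewrite /M; ring.
  apply: (le_trans (ler_normD _ _)); apply: lerD.
    by apply: ler_norm_mul => //; rewrite ger0_norm.
  by apply: (le_trans k2); rewrite ler_wpM2l// mulr_ge0.
have -> : w y t * z y t - w x t * z x t = (w y t - w x t) * z y t + w x t * (z y t - z x t) by ring.
have -> : (M * K + K * M) * (y - x) = M * (y - x) * K + K * (M * (y - x)) by ring.
apply: (le_trans (ler_normD _ _)); apply: lerD; apply: ler_norm_mul => //.
  exact: d h2 h3.
exact: d g2 g3.
Qed.

Let om_clamp_cont : continuous (fun x => om (clamp x)).
Proof.
have [L L0 HL] := om_lip.
suff l : lip1 (fun x => om (clamp x)) by exact: lip1_continuous.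
move=> T; exists L => x y _ _; apply: (@le_trans _ _ (L * `|clamp x - clamp y|)); last first.
  by rewrite ler_wpM2l// clamp_lip.
have := clampX x; have := clampX y; move: (clamp x) (clamp y) => {x y} x y /andP[y0 y1] /andP[x0' x1'].
have [xy|/ltW xy] := leP x y.
  by rewrite distrC (distrC x) (@ger0_norm _ (y - x)) ?subr_ge0//; exact: HL.
by rewrite (@ger0_norm _ (x - y)) ?subr_ge0//; exact: HL.
Qed.

Lemma green_integrable (r : R -> R) : (forall x y, ig x y r) ->
  forall x y, x0 <= x -> y <= x1 -> ig x y (fun s => r s * om s).
Proof.
move=> Ir x y x0x yx1; apply: ig_eq (ig_mul (Ir x y) om_clamp_cont) => s /andP[xs sy].
by rewrite clamp_id// (le_trans x0x (ltW xs)) (le_trans sy).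
Qed.

(** Freezing [om] at the left end of a step costs [L (y - x)] times the integral of [|r|], again of
    second order. Hence the Lebesgue integral of [r * om] accounts for the whole variation of
    [W]. *)
Lemma green_source (r : R -> R) : (forall x y, ig x y r) ->
  (forall x y, x0 <= x -> x <= y -> y <= x1 -> Qw y - Qw x - (Qz y - Qz x) = itg x y r) ->
  (forall x y, x0 <= x -> x <= y -> y <= x1 -> itg x y (fun s => `|r s|) <= N y - N x) ->
  W x1 - W x0 = itg x0 x1 (fun x => r x * om x).
Proof.
move=> Ir HQ HrN; have [C HC] := increments; have [L L0 HL] := om_lip.
have iom := green_integrable Ir.
pose D x := W x - itg x0 x (fun x => r x * om x).
suff : D x1 = D x0 by rewrite /D (@itg_empty _ x0 x0)// subr0; lra.
apply: (@quad_const _ D (fun x => (C + L) * N x)) => // x y x0x xy yx1.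
have -> : (y - x) * ((C + L) * N y - (C + L) * N x)
  = C * (y - x) * (N y - N x) + L * (y - x) * (N y - N x) by ring.
have -> : D y - D x = (W y - W x - (Qw y - Qw x - (Qz y - Qz x)) * om x)
    - itg x y (fun s => r s * om s - om x * r s).
  rewrite /D (@itg_split _ x0 y x)//; last exact: iom.
  by rewrite itgB ?itgZ// ?HQ//; [ring|exact: iom|exact: igZ].
apply: (le_trans (ler_normB _ _)); apply: lerD; first exact: HC.
apply: (@le_trans _ _ (itg x y (fun s => L * (y - x) * `|r s|))); last first.
  by rewrite itgZ ?ler_wpM2l ?HrN ?mulr_ge0 ?subr_ge0//; exact: ig_abs.
apply: itg_bound; [by apply: igZ; exact: ig_abs|by apply: igB; [exact: iom|exact: igZ]|].
move=> s /andP[xs sy]; rewrite (mulrC (r s)) -mulrBl.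
apply: ler_norm_mul => //; apply: (le_trans (HL x s x0x (ltW xs) (le_trans sy yx1))).
by rewrite ler_wpM2l//; lra.
Qed.

End GreenIdentity.
End Green.

(** * Regular solutions of the sideways wave equation *)

Section RegularSolution.
Context {R : realType} (p : R -> R) (ip : forall x y, ig x y p).
Implicit Types (g w gam c : R -> R -> R) (x y s t M L : R) (n : nat).

Definition blip L w : Prop := forall s s' t t', 0 <= s <= 1 -> 0 <= s' <= 1 ->
  `|w s t| <= L /\ `|w s t - w s' t'| <= L * (`|s - s'| + `|t - t'|).

(** Duhamel's formula: half the integral of [p w] over the characteristic triangle with vertex
    [(x, t)] and base on [x = 0]. It inverts [w_xx - w_tt] under zero Cauchy data at [x = 0]. *)
Definition volterra w x t : R :=
  2^-1 * itg 0 x (fun s => p s * oint (w s) (t - x + s) (t + x - s)).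

Lemma oint_abs (f : R -> R) M a b : continuous f -> (forall t, `|f t| <= M) ->
  `|oint f a b| <= M * `|b - a|.
Proof.
move=> cf fM; apply: (@oint_abs_ball _ _ _ (`|a| + `|b|)) => //; first by rewrite lerDl.
by rewrite lerDr.
Qed.

Lemma ig_mul_lip (f : R -> R) L a b :
  (forall s s', 0 <= s <= 1 -> 0 <= s' <= 1 -> `|f s - f s'| <= L * `|s - s'|) ->
  0 <= a -> b <= 1 -> ig a b (fun s => p s * f s).
Proof.
move=> Hf a0 b1; pose cl (x : R) := Num.max 0 (Num.min 1 x).
have cl01 x : 0 <= cl x <= 1 by rewrite /cl le_max lexx ge_max ler01 ge_min lexx.
have cl_id x : 0 <= x <= 1 -> cl x = x by move=> /andP[? ?]; rewrite /cl min_r// max_r.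
have cl_lip x y : `|cl x - cl y| <= `|x - y|.
  rewrite /cl /Num.max /Num.min.
  have := ler_norm (x - y); have := ler_norm (y - x); rewrite (distrC y).
  have := normr_ge0 (x - y).
  by case: ifPn; case: ifPn; case: ifPn; case: ifPn; rewrite -?leNgt => *;
    rewrite ler_norml; apply/andP; split; lra.
have cf : continuous (fun x => f (cl x)).
  suff l : lip1 (fun x => f (cl x)) by exact: lip1_continuous.
  move=> T; exists `|L| => x y _ _; apply: (le_trans (Hf _ _ (cl01 x) (cl01 y))).
  by apply: (le_trans (ler_wpM2r _ (ler_norm L))) => //; rewrite ler_wpM2l.
apply: ig_eq (ig_mul (ip a b) cf) => s /andP[as_ sb].
by rewrite cl_id// (le_trans a0 (ltW as_)) (le_trans sb).
Qed.

Lemma blip_continuous L w s : blip L w -> 0 <= s <= 1 -> continuous (w s).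
Proof.
move=> H s01; suff l : lip1 (w s) by exact: lip1_continuous.
move=> T; exists L => t t' _ _; have [_] := H s s t t' s01 s01.
by rewrite subrr normr0 add0r.
Qed.

Lemma blip_ge0 L w : blip L w -> 0 <= L.
Proof.
move=> H; have z : 0 <= (0 : R) <= 1 by rewrite lexx ler01.
by have [h _] := H 0 0 0 0 z z; exact: le_trans h.
Qed.

Lemma blip_weaken L L' w : L <= L' -> blip L w -> blip L' w.
Proof.
move=> LL H s s' t t' s1 s2; have [h1 h2] := H s s' t t' s1 s2.
by split; [exact: le_trans LL|apply: (le_trans h2); rewrite ler_wpM2r ?addr_ge0].
Qed.

Lemma blip_lin a L L' w w' : blip L w -> blip L' w' ->
  blip (`|a| * L + L') (fun s t => a * w s t + w' s t).
Proof.
move=> H H' s s' t t' s1 s2; have [h1 h2] := H s s' t t' s1 s2.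
have [h1' h2'] := H' s s' t t' s1 s2; split.
  by apply: (le_trans (ler_normD _ _)); apply: lerD => //; exact: ler_norm_mul.
have -> : a * w s t + w' s t - (a * w s' t' + w' s' t') =
  a * (w s t - w s' t') + (w' s t - w' s' t') by ring.
rewrite mulrDl -mulrA; apply: (le_trans (ler_normD _ _)); apply: lerD => //.
exact: ler_norm_mul.
Qed.

Let Q1 := itg 0 1 (fun s => `|p s|).

Let Q1_ge0 : 0 <= Q1. Proof. exact: itg_ge0. Qed.

(** An exponential rate in [x]. Twice the mass of [p] is what halving a weighted bound takes, and
    the added 1 keeps the rate positive. *)
Definition growth : R := 2 * itg 0 1 (fun s => `|p s|) + 1.

Let growth_gt0 : 0 < growth.
Proof. by rewrite /growth -/Q1 ltr_wpDl// mulr_ge0. Qed.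

Let itg_abs_le x y : 0 <= x -> x <= y -> y <= 1 -> itg x y (fun s => `|p s|) <= Q1.
Proof.
move=> x0 xy y1; have ia a b : ig a b (fun s => `|p s|) by exact: ig_abs.
have pos a b : 0 <= itg a b (fun s => `|p s|) by exact: itg_ge0.
rewrite /Q1 (@itg_split _ 0 1 x)//; last exact: le_trans xy y1.
rewrite (@itg_split _ x 1 y)//.
by have := pos 0 x; have := pos y 1; lra.
Qed.

Section Kernel.
Context (L : R) (w : R -> R -> R) (Hw : blip L w).

Let inner x t s := oint (w s) (t - x + s) (t + x - s).

Let bw s t : 0 <= s <= 1 -> `|w s t| <= L.
Proof. by move=> s01; have [] := Hw t t s01 s01. Qed.

Let ointw_lip M s a b a' b' : 0 <= s <= 1 -> (forall t, `|w s t| <= M) ->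
  `|oint (w s) a b - oint (w s) a' b'| <= M * (`|a - a'| + `|b - b'|).
Proof.
move=> s01 HM; have cw := blip_continuous Hw s01.
have -> : oint (w s) a b - oint (w s) a' b' = oint (w s) a a' + oint (w s) b' b.
  by rewrite -(oint_chasles (w s) a a' b) -(oint_chasles (w s) a' b' b); ring.
rewrite mulrDr; apply: (le_trans (ler_normD _ _)); apply: lerD.
  by rewrite distrC; exact: oint_abs.
exact: oint_abs.
Qed.

Let inner_lip x t s s' : 0 <= x <= 1 -> 0 <= s <= 1 -> 0 <= s' <= 1 ->
  `|inner x t s - inner x t s'| <= 4 * L * `|s - s'|.
Proof.
move=> x01 s01 s01'; have L0 := blip_ge0 Hw.
have cw := blip_continuous Hw s01; have cw' := blip_continuous Hw s01'.
have -> : inner x t s - inner x t s' =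
   (oint (w s) (t - x + s) (t + x - s) - oint (w s) (t - x + s') (t + x - s'))
   + oint (fun u => w s u - w s' u) (t - x + s') (t + x - s').
  by rewrite ointB// /inner; ring.
have -> : 4 * L * `|s - s'| = L * (`|s - s'| + `|s - s'|) + L * `|s - s'| * 2 by ring.
apply: (le_trans (ler_normD _ _)); apply: lerD.
  apply: (le_trans (ointw_lip _ _ _ _ s01 (fun u => bw u s01))).
  have -> : t - x + s - (t - x + s') = s - s' by ring.
  have -> : t + x - s - (t + x - s') = s' - s by ring.
  by rewrite (distrC s').
have cd := contB cw cw'.
apply: (le_trans (oint_abs _ _ cd (M := L * `|s - s'|) _)).
  by move=> u; have [_] := Hw u u s01 s01'; rewrite subrr normr0 addr0.
rewrite ler_wpM2l ?mulr_ge0//.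
have -> : t + x - s' - (t - x + s') = (x - s') + (x - s') by ring.
move: x01 s01' => /andP[? ?] /andP[? ?].
by rewrite ler_norml; apply/andP; split; lra.
Qed.

Let ig_inner x t a b : 0 <= x <= 1 -> 0 <= a -> b <= 1 -> ig a b (fun s => p s * inner x t s).
Proof. by move=> x01 a0 b1; apply: (@ig_mul_lip _ (4 * L)) => // s s' *; exact: inner_lip. Qed.

(* The weight is chosen so that one step of the iteration halves the constant; [D] is
   any region containing the dependence triangles of its points. *)
Lemma volterra_bound (D : R -> R -> Prop) M :
  (forall x t s y, D x t -> 0 <= s -> s <= x -> `|y - t| <= x - s -> D s y) -> 0 <= M ->
  (forall s t, 0 <= s <= 1 -> D s t -> `|w s t| <= M * expR (growth * s)) ->
  forall x t, 0 <= x <= 1 -> D x t -> `|volterra w x t| <= M / 2 * expR (growth * x).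
Proof.
move=> HD M0 HM x t x01 Dxt; have /andP[x0 x1] := x01.
rewrite /volterra normrM ger0_norm ?invr_ge0//.
have -> : M / 2 * expR (growth * x) = 2^-1 * (M * expR (growth * x)) by ring.
rewrite ler_wpM2l ?invr_ge0//.
apply: (@le_trans _ _ (itg 0 x (fun s => (2 * M * expR (growth * x) / growth) * `|p s|))).
  apply: itg_bound; [by apply: igZ; exact: ig_abs|exact: ig_inner|] => s /andP[s0 sx].
  have s01 : 0 <= s <= 1 by rewrite (ltW s0) (le_trans sx).
  rewrite mulrC; apply: ler_norm_mul => //.
  have cw := blip_continuous Hw s01.
  have le1 : t - x + s <= t + x - s by lra.
  apply: (le_trans (oint_abs_le cw (M := M * expR (growth * s)) le1 _)).
    move=> u /andP[u1 u2]; apply: HM => //; apply: HD Dxt (ltW s0) sx _.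
    by rewrite ler_norml; apply/andP; split; lra.
  have -> : growth * x = growth * s + growth * (x - s) by ring.
  rewrite expRD.
  (* The length [2 (x - s)] of the time interval is paid for by the growth of the weight from [s] to
     [x]. *)
  have h : growth * (x - s) <= expR (growth * (x - s)).
    by apply: le_trans (expR_ge1Dx _); rewrite lerDr.
  have -> : M * expR (growth * s) * (t + x - s - (t - x + s))
    = 2 * M * expR (growth * s) * (growth * (x - s)) / growth.
    by field; rewrite gt_eqF.
  rewrite [in leRHS]mulrA ler_wpM2r ?invr_ge0 ?(ltW growth_gt0)// ler_wpM2l//.
  by rewrite !mulr_ge0 ?expR_ge0.
rewrite itgZ; last exact: ig_abs.
apply: (@le_trans _ _ (2 * M * expR (growth * x) / growth * Q1)).
  by rewrite ler_wpM2l ?itg_abs_le// divr_ge0 ?(ltW growth_gt0)// !mulr_ge0 ?expR_ge0.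
rewrite mulrAC ler_pdivrMr//.
have : 0 <= M * expR (growth * x) by rewrite mulr_ge0 ?expR_ge0.
have -> : 2 * M * expR (growth * x) * Q1 = 2 * Q1 * (M * expR (growth * x)) by ring.
by move: (M * expR (growth * x)) => A A0; rewrite /growth -/Q1; lra.
Qed.

Lemma volterra_integrable x t a b : 0 <= x <= 1 -> 0 <= a -> b <= 1 ->
  ig a b (fun s => p s * oint (w s) (t - x + s) (t + x - s)).
Proof. exact: ig_inner. Qed.

(** Only the supremum of [w] enters the new constant: the Lipschitz continuity of the image comes
    from the limits of integration. One constant is thus valid along the whole iteration. *)
Lemma volterra_blip M : (forall s t, 0 <= s <= 1 -> `|w s t| <= M) ->
  blip (2 * M * Q1 + M * Q1) (volterra w).
Proof.
move=> HM; have L0 : 0 <= M.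
  by apply: le_trans (HM 0 0 _); rewrite ?lexx ?ler01.
have ia a b : ig a b (fun s => `|p s|) by exact: ig_abs.
have half (X A : R) : `|X| <= 2 * A -> `|2^-1 * X| <= A.
  by move=> h; rewrite normrM ger0_norm ?invr_ge0// ler_pdivrMl.
have bnd f A a b : 0 <= A -> 0 <= a -> a <= b -> b <= 1 -> ig a b (fun s => p s * f s) ->
    (forall s, a < s <= b -> `|f s| <= A) -> `|itg a b (fun s => p s * f s)| <= A * Q1.
  move=> M0 a0 ab b1 If fM; apply: (@le_trans _ _ (A * itg a b (fun s => `|p s|))).
    rewrite -itgZ//; apply: itg_bound => //; first exact: igZ.
    by move=> s sab; rewrite mulrC; apply: ler_norm_mul => //; exact: fM.
  by rewrite ler_wpM2l// itg_abs_le.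
have LQ : 0 <= M * Q1 by rewrite mulr_ge0.
have tlip x t t' : 0 <= x <= 1 -> `|volterra w x t - volterra w x t'| <= M * Q1 * `|t - t'|.
  move=> x01; have /andP[x0 x1] := x01.
  rewrite /volterra -mulrBr; apply: half.
  rewrite -itgB; [|exact: ig_inner..].
  rewrite (@itg_eq _ 0 x _ (fun s => p s * (inner x t s - inner x t' s))); last first.
    by move=> s _; rewrite /inner; ring.
  have -> : 2 * (M * Q1 * `|t - t'|) = M * (`|t - t'| + `|t - t'|) * Q1 by ring.
  apply: bnd => //; first by rewrite mulr_ge0// addr_ge0.
    apply: ig_eq (igB (ig_inner t x01 (lexx 0) x1) (ig_inner t' x01 (lexx 0) x1)) => s _.
    by rewrite /inner; ring.
  move=> s /andP[s0 sx]; have s01 : 0 <= s <= 1 by rewrite (ltW s0) (le_trans sx).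
  apply: (le_trans (ointw_lip _ _ _ _ s01 (HM s ^~ s01))).
  have -> : t - x + s - (t' - x + s) = t - t' by ring.
  by have -> : t + x - s - (t' + x - s) = t - t' by ring.
have xlip x y t : 0 <= x -> x <= y -> y <= 1 ->
    `|volterra w y t - volterra w x t| <= 2 * M * Q1 * (y - x).
  move=> x0 xy y1; have x01 : 0 <= x <= 1 by rewrite x0 (le_trans xy).
  have y01 : 0 <= y <= 1 by rewrite y1 (le_trans x0).
  have /andP[_ x1] := x01.
  rewrite /volterra -mulrBr; apply: half; rewrite (@itg_split _ 0 y x)//; last exact: ig_inner.
  rewrite addrAC -itgB; [|exact: ig_inner..].
  rewrite (@itg_eq _ 0 x _ (fun s => p s * (inner y t s - inner x t s))); last first.
    by move=> s _; rewrite /inner; ring.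
  have -> : 2 * (2 * M * Q1 * (y - x)) = M * ((y - x) + (y - x)) * Q1 + M * ((y - x) + (y - x)) * Q1.
    by ring.
  have LL : 0 <= M * ((y - x) + (y - x)) by rewrite mulr_ge0//; lra.
  apply: (le_trans (ler_normD _ _)); apply: lerD; apply: bnd => //.
  - apply: ig_eq (igB (ig_inner t y01 (lexx 0) x1) (ig_inner t x01 (lexx 0) x1)) => s _.
    by rewrite /inner; ring.
  - move=> s /andP[s0 sx]; have s01 : 0 <= s <= 1 by rewrite (ltW s0) (le_trans sx).
    apply: (le_trans (ointw_lip _ _ _ _ s01 (HM s ^~ s01))).
    have -> : t - y + s - (t - x + s) = - (y - x) by ring.
    have -> : t + y - s - (t + x - s) = y - x by ring.
    by rewrite normrN ger0_norm ?subr_ge0.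
  - exact: ig_inner.
  - move=> s /andP[xs sy]; have s01 : 0 <= s <= 1 by rewrite (le_trans x0 (ltW xs)) (le_trans sy).
    have cw := blip_continuous Hw s01.
    apply: (le_trans (oint_abs _ _ cw (HM s ^~ s01))); rewrite ler_wpM2l//.
    by rewrite ler_norml; apply/andP; split; lra.
move=> s s' t t' s01 s01'; split.
  have /andP[s0 s1] := s01.
  have := xlip 0 s t (lexx 0) s0 s1; rewrite {2}/volterra itg_empty// mulr0 !subr0.
  move/le_trans; apply; rewrite (@le_trans _ _ (2 * M * Q1))//; last by rewrite lerDl.
  by rewrite ler_piMr// -mulrA mulr_ge0.
have -> : volterra w s t - volterra w s' t' =
  (volterra w s t - volterra w s' t) + (volterra w s' t - volterra w s' t') by ring.
apply: (le_trans (ler_normD _ _)).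
have h1 : `|volterra w s t - volterra w s' t| <= 2 * M * Q1 * `|s - s'|.
  have /andP[s0 s1] := s01; have /andP[s0' s1'] := s01'.
  have [ss|/ltW ss] := leP s s'.
    by rewrite distrC (distrC s) (@ger0_norm _ (s' - s)) ?subr_ge0//; exact: xlip.
  by rewrite (@ger0_norm _ (s - s')) ?subr_ge0//; exact: xlip.
have := tlip s' t t' s01'.
have h2 : 0 <= 2 * M * Q1 * `|t - t'| by rewrite -!mulrA !mulr_ge0.
have h3 : 0 <= M * Q1 * `|s - s'| by rewrite -!mulrA !mulr_ge0.
have -> : (2 * M * Q1 + M * Q1) * (`|s - s'| + `|t - t'|) = 2 * M * Q1 * `|s - s'|
  + M * Q1 * `|s - s'| + 2 * M * Q1 * `|t - t'| + M * Q1 * `|t - t'| by ring.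
lra.
Qed.

End Kernel.

End RegularSolution.

(** * Existence, uniqueness and symmetries of regular solutions *)

Section RegularSolutionExistence.
Context {R : realType} (p : R -> R) (ip : forall x y, ig x y p).
Implicit Types (g w : R -> R -> R) (gam c : R -> R) (x y s t M L F a h r : R) (n : nat).
Local Notation volt := (volterra p).
Local Notation kap := (growth p).

Lemma volterra_lin a L L' w w' x t : blip L w -> blip L' w' -> 0 <= x <= 1 ->
  volt (fun s u => a * w s u + w' s u) x t = a * volt w x t + volt w' x t.
Proof.
move=> Hw Hw' x01; have /andP[x0 x1] := x01.
have i1 := volterra_integrable ip Hw t x01 (lexx 0) x1.
have i2 := volterra_integrable ip Hw' t x01 (lexx 0) x1.
rewrite /volterra mulrCA -mulrDr; congr (_ * _); rewrite -itgZ// -itgD//; last exact: igZ.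
apply: itg_eq => s /andP[s0 sx].
have s01 : 0 <= s <= 1 by rewrite (ltW s0) (le_trans sx).
have cw := blip_continuous Hw s01; have cw' := blip_continuous Hw' s01.
rewrite ointD ?ointZ//; first ring.
by apply: contM => //; exact: cont_cst.
Qed.

Definition hereditary (D : R -> R -> Prop) : Prop :=
  forall x t s y, D x t -> 0 <= s -> s <= x -> `|y - t| <= x - s -> D s y.

Let expk_ge1 x : 0 <= x -> 1 <= expR (kap * x).
Proof.
move=> x0; apply: le_trans (expR_ge1Dx _); rewrite lerDl mulr_ge0//.
by rewrite addr_ge0// mulr_ge0// itg_ge0.
Qed.

(** The halving estimate is iterated from the crude bound [L]; [2 F] is the fixed point of
    [M -> F + M / 2]. With [F = 0] this yields both uniqueness and finite propagation speed. *)
Lemma volterra_apriori (D : R -> R -> Prop) L F w : hereditary D -> blip L w -> 0 <= F ->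
  (forall x t, 0 <= x <= 1 -> D x t -> `|w x t - volt w x t| <= F * expR (kap * x)) ->
  forall x t, 0 <= x <= 1 -> D x t -> `|w x t| <= 2 * F * expR (kap * x).
Proof.
move=> HD Hw F0 HF; have L0 := blip_ge0 Hw.
have step n : forall x t, 0 <= x <= 1 -> D x t ->
    `|w x t| <= (2 * F + L * 2^-1 ^+ n) * expR (kap * x).
  elim: n => [|n IH] x t x01 Dxt; have /andP[x0 x1] := x01.
    rewrite expr0 mulr1; have [h _] := Hw x x t t x01 x01; apply: (le_trans h).
    apply: (@le_trans _ _ ((2 * F + L) * 1)); first by rewrite mulr1 lerDr mulr_ge0.
    by rewrite ler_wpM2l ?expk_ge1// addr_ge0// mulr_ge0.
  have M0 : 0 <= 2 * F + L * 2^-1 ^+ n.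
    by rewrite addr_ge0 ?mulr_ge0 ?exprn_ge0 ?invr_ge0.
  have h1 := volterra_bound ip Hw HD M0 IH x01 Dxt.
  have -> : w x t = (w x t - volt w x t) + volt w x t by ring.
  apply: (le_trans (ler_normD _ _)); apply: (le_trans (lerD (HF _ _ x01 Dxt) h1)).
  rewrite -mulrDl ler_wpM2r ?expR_ge0// exprS; lra.
move=> x t x01 Dxt; apply: (@le_geo _ _ _ (L * expR (kap * x)) 2^-1); rewrite ?invr_ge0// => n.
have -> : 2 * F * expR (kap * x) + L * expR (kap * x) * 2^-1 ^+ n
  = (2 * F + L * 2^-1 ^+ n) * expR (kap * x) by ring.
exact: step.
Qed.

(** Picard iteration. The common weighted bound [2 G] gives one Lipschitz constant for all iterates
    through [volterra_blip], and it passes to the limit; successive differences are halved. *)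
Lemma volterra_solvable G g : blip G g -> exists w, (exists L, blip L w) /\
  forall x t, 0 <= x <= 1 -> w x t = g x t + volt w x t.
Proof.
move=> Hg; have G0 := blip_ge0 Hg.
pose S := fun n => nat_rect (fun=> R -> R -> R) g (fun n w x t => g x t + volt w x t) n.
have SS n x t : S n.+1 x t = g x t + volt (S n) x t by [].
pose B := 2 * G * expR kap; pose Q1 := itg 0 1 (fun s => `|p s|).
have kap0 : 0 <= kap by rewrite addr_ge0// mulr_ge0// itg_ge0.
have B0 : 0 <= B by rewrite !mulr_ge0 ?expR_ge0.
have Q10 : 0 <= Q1 by exact: itg_ge0.
have expk_le x : 0 <= x <= 1 -> expR (kap * x) <= expR kap.
  by move=> /andP[x0 x1]; rewrite ler_expR ler_piMr.
pose L := G + (2 * B * Q1 + B * Q1).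
have GL : G <= L by rewrite lerDl addr_ge0// !mulr_ge0.
have HT : hereditary (fun _ _ => True) by [].
have HS n : blip L (S n) /\ forall x t, 0 <= x <= 1 -> True -> `|S n x t| <= 2 * G * expR (kap * x).
  elim: n => [|n [bn IH]].
    split; first exact: blip_weaken GL Hg.
    move=> x t x01 _; have [h _] := Hg x x t t x01 x01; apply: (le_trans h).
    have /andP[x0 x1] := x01.
    have := ler_wpM2l G0 (expk_ge1 x0); rewrite mulr1 -mulrA; lra.
  have bS : forall s t, 0 <= s <= 1 -> `|S n s t| <= B.
    move=> s t s01; apply: (le_trans (IH s t s01 I)); rewrite ler_wpM2l ?expk_le//.
    exact: mulr_ge0.
  split.
    have := blip_lin 1 Hg (volterra_blip ip bn bS); rewrite normr1 mul1r -/Q1 -/L.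
    by congr blip; apply/funext => x; apply/funext => t; rewrite SS mul1r.
  move=> x t x01 _; rewrite SS; have [h _] := Hg x x t t x01 x01.
  have /andP[x0 x1] := x01.
  apply: (le_trans (ler_normD _ _)).
  have := volterra_bound ip bn HT (mulr_ge0 (ler0n _ 2) G0) IH x01 I (t := t).
  have := ler_wpM2l G0 (expk_ge1 x0); rewrite mulr1.
  have -> : 2 * G / 2 = G by field.
  have -> : 2 * G * expR (kap * x) = G * expR (kap * x) + G * expR (kap * x) by ring.
  by move=> ? ?; apply: lerD => //; apply: le_trans h _.
have bS n : blip L (S n) by have [] := HS n.
have diff n : forall x t, 0 <= x <= 1 -> True ->
    `|S n.+1 x t - S n x t| <= G * 2^-1 ^+ n * expR (kap * x).
  elim: n => [|n IH] x t x01 _; have /andP[x0 x1] := x01.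
    rewrite SS addrAC subrr add0r expr0 mulr1.
    have := volterra_bound ip Hg HT G0 _ x01 I (t := t); move/(_ _)/le_trans; apply.
      move=> s u s01 _; have [h _] := Hg s s u u s01 s01; apply: (le_trans h).
      have /andP[s0 _] := s01.
      by have := ler_wpM2l G0 (expk_ge1 s0); rewrite mulr1.
    by rewrite ler_wpM2r ?expR_ge0//; lra.
  have bd : blip (`|-1| * L + L) (fun s u => -1 * S n s u + S n.+1 s u) by exact: blip_lin.
  have -> : S n.+2 x t - S n.+1 x t = volt (fun s u => -1 * S n s u + S n.+1 s u) x t.
    by rewrite (@volterra_lin _ _ _ _ _ x t (bS n) (bS n.+1) x01) (SS n.+1) (SS n); ring.
  have M0 : 0 <= G * 2^-1 ^+ n by rewrite mulr_ge0 ?exprn_ge0 ?invr_ge0.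
  have := volterra_bound ip bd HT M0 _ x01 I (t := t); move/(_ _)/le_trans; apply.
    by move=> s u s01 _; have := IH s u s01 I; rewrite mulN1r addrC.
  by rewrite exprS ler_wpM2r ?expR_ge0//; lra.
have t0 : (0 : R) <= 2^-1 by rewrite invr_ge0.
have t1 : (2^-1 : R) < 1 by rewrite invf_lt1// ltr1n.
have lim (z : R * R) : exists l, 0 <= z.1 <= 1 ->
    forall n, `|l - S n z.1 z.2| <= (G * expR kap) / (1 - 2^-1) * 2^-1 ^+ n.
  case: z => x t /=; have [x01|nx] := pselect (0 <= x <= 1); last by exists 0.
  have [l Hl] : exists l, forall n, `|l - S n x t| <= (G * expR kap) / (1 - 2^-1) * 2^-1 ^+ n.
    apply: (@geo_sum_cvg _ (fun n => S n x t)) => // n.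
    apply: (le_trans (diff n x t x01 I)).
    by rewrite [leRHS]mulrAC ler_wpM2l ?expk_le// mulr_ge0 ?exprn_ge0.
  by exists l.
have [l Hl] := choice lim; pose w x t := l (x, t).
pose C := (G * expR kap) / (1 - 2^-1).
have C0 : 0 <= C by rewrite divr_ge0 ?mulr_ge0 ?expR_ge0// subr_ge0 ltW.
have Hw x t n : 0 <= x <= 1 -> `|w x t - S n x t| <= C * 2^-1 ^+ n.
  by move=> x01; exact: (Hl (x, t)).
have bw : blip L w.
  move=> s s' t t' s01 s01'; split.
    apply: (@le_geo _ _ _ C 2^-1) => // n; have [h _] := bS n s s t t s01 s01.
    have -> : w s t = S n s t + (w s t - S n s t) by ring.
    by apply: (le_trans (ler_normD _ _)); apply: lerD => //; exact: Hw.
  apply: (@le_geo _ _ _ (C + C) 2^-1) => // n; have [_ h] := bS n s s' t t' s01 s01'.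
  have -> : w s t - w s' t' = S n s t - S n s' t' + ((w s t - S n s t) - (w s' t' - S n s' t')).
    by ring.
  apply: (le_trans (ler_normD _ _)); apply: lerD => //; rewrite mulrDl.
  by apply: (le_trans (ler_normB _ _)); apply: lerD; exact: Hw.
exists w; split; first by exists L.
move=> x t x01; apply/eqP; rewrite -subr_eq0 -normr_le0.
apply: (@le_geo _ _ _ (C + C / 2 * expR (kap * x)) 2^-1) => // n; rewrite add0r.
have -> : w x t - (g x t + volt w x t) = (w x t - S n.+1 x t) - (volt w x t - volt (S n) x t).
  by rewrite SS; ring.
have bd : blip (`|-1| * L + L) (fun s u => -1 * S n s u + w s u) by exact: blip_lin.
have -> : volt w x t - volt (S n) x t = volt (fun s u => -1 * S n s u + w s u) x t.
  by rewrite (@volterra_lin _ _ _ _ _ x t (bS n) bw x01); ring.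
apply: (le_trans (ler_normB _ _)); rewrite mulrDl; apply: lerD.
  by apply: (le_trans (Hw _ _ _ x01)); rewrite exprS; have := mulr_ge0 C0 (exprn_ge0 n t0); lra.
have M0 : 0 <= C * 2^-1 ^+ n by rewrite mulr_ge0 ?exprn_ge0.
have := volterra_bound ip bd HT M0 _ x01 I (t := t); move/(_ _)/le_trans; apply.
  move=> s u s01 _; rewrite mulN1r addrC; apply: (le_trans (Hw _ _ _ s01)).
  by have /andP[s0 _] := s01; rewrite -[leLHS]mulr1 ler_wpM2l ?expk_ge1.
by rewrite le_eqVlt; apply/orP; left; apply/eqP; ring.
Qed.

(** D'Alembert's formula for the potential zero, with value 0 and [x]-derivative [gam] on
    [x = 0]. *)
Definition free_solution gam x t : R := 2^-1 * oint gam (t - x) (t + x).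

Lemma free_solution_primitive c gam x t : der c gam ->
  free_solution gam x t = 2^-1 * (c (t + x) - c (t - x)).
Proof. by move=> /oint_FTC H; rewrite /free_solution H. Qed.

Lemma free_solution_blip gam M : continuous gam -> (forall t, `|gam t| <= M) ->
  blip M (free_solution gam).
Proof.
move=> cg gM s s' t t' /andP[s0 s1] /andP[s0' s1'].
have M0 : 0 <= M by apply: le_trans (gM 0).
have half (X A : R) : `|X| <= 2 * A -> `|2^-1 * X| <= A.
  by move=> h; rewrite normrM ger0_norm ?invr_ge0// ler_pdivrMl.
split.
  apply: half; apply: (le_trans (oint_abs _ _ cg gM)); rewrite mulrC ler_wpM2r//.
  by rewrite ler_norml; apply/andP; split; lra.
rewrite /free_solution -mulrBr; apply: half.
have -> : oint gam (t - s) (t + s) - oint gam (t' - s') (t' + s')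
   = oint gam (t - s) (t' - s') + oint gam (t' + s') (t + s).
  rewrite -(oint_chasles gam (t - s) (t' - s') (t + s)).
  by rewrite -(oint_chasles gam (t' - s') (t' + s') (t + s)); ring.
have e A B : `|oint gam A B| <= M * `|B - A| by exact: oint_abs.
have tri1 : `|t' - s' - (t - s)| <= `|s - s'| + `|t - t'|.
  have -> : t' - s' - (t - s) = (s - s') - (t - t') by ring.
  exact: ler_normB.
have tri2 : `|t + s - (t' + s')| <= `|s - s'| + `|t - t'|.
  have -> : t + s - (t' + s') = (s - s') + (t - t') by ring.
  exact: ler_normD.
have := ler_wpM2l M0 tri1; have := ler_wpM2l M0 tri2.
have := e (t - s) (t' - s'); have := e (t' + s') (t + s).
have := ler_normD (oint gam (t - s) (t' - s')) (oint gam (t' + s') (t + s)).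
lra.
Qed.

(** The solution with value 0 and [x]-derivative [gam] on [x = 0], in integral form; the zero
    function is a default for data without such a solution. *)
Definition regular gam : R -> R -> R :=
  if pselect (exists w, (exists L, blip L w) /\ forall x t, 0 <= x <= 1 ->
    w x t = free_solution gam x t + volt w x t) is left e then projT1 (cid e) else fun=> fun=> 0.

Lemma regularP gam : bsmooth gam -> (exists L, blip L (regular gam)) /\
  forall x t, 0 <= x <= 1 -> regular gam x t = free_solution gam x t + volt (regular gam) x t.
Proof.
move=> bg; rewrite /regular; case: pselect => [e|]; first by case: cid.
have [M _ HM] := bsmooth_bound bg; case.
exact: volterra_solvable (free_solution_blip (smooth_continuous (bsmooth_smooth bg)) HM).
Qed.

Let hT : hereditary (fun _ _ => True). Proof. by []. Qed.

Lemma regular_unique gam L w : bsmooth gam -> blip L w ->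
  (forall x t, 0 <= x <= 1 -> w x t = free_solution gam x t + volt w x t) ->
  forall x t, 0 <= x <= 1 -> w x t = regular gam x t.
Proof.
move=> bg bw Hw x t x01; have [[L' br] Hr] := regularP bg.
have bd := blip_lin (-1) bw br.
have H y u : 0 <= y <= 1 -> True ->
    `|-1 * w y u + regular gam y u - volt (fun s u => -1 * w s u + regular gam s u) y u|
    <= 0 * expR (kap * y).
  move=> y01 _; rewrite (@volterra_lin _ _ _ _ _ y u bw br y01) mul0r normr_le0; apply/eqP.
  by rewrite {1}(Hw _ _ y01) {1}(Hr _ _ y01); ring.
have := volterra_apriori hT bd (lexx 0) H x01 I (t := t).
by rewrite mulr0 mul0r normr_le0 => /eqP; lra.
Qed.

Lemma free_solution_lin a gam gam' x t : continuous gam -> continuous gam' ->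
  free_solution (fun t => a * gam t + gam' t) x t
  = a * free_solution gam x t + free_solution gam' x t.
Proof.
move=> cg cg'; rewrite /free_solution ointD ?ointZ//; first ring.
by apply: contM => //; exact: cont_cst.
Qed.

Lemma regular_lin a gam gam' x t : bsmooth gam -> bsmooth gam' -> 0 <= x <= 1 ->
  regular (fun t => a * gam t + gam' t) x t = a * regular gam x t + regular gam' x t.
Proof.
move=> bg bg' x01; have [[L bl] H] := regularP bg; have [[L' bl'] H'] := regularP bg'.
apply/esym; apply: (regular_unique (bsmoothZD a bg bg') (blip_lin a bl bl')) => // y u y01.
rewrite (@volterra_lin _ _ _ _ _ y u bl bl' y01) free_solution_lin.
- by rewrite {1}(H _ _ y01) {1}(H' _ _ y01); ring.
- exact: smooth_continuous (bsmooth_smooth bg).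
- exact: smooth_continuous (bsmooth_smooth bg').
Qed.

Lemma regular_shift h gam x t : bsmooth gam -> 0 <= x <= 1 ->
  regular (fun t => gam (t + h)) x t = regular gam x (t + h).
Proof.
move=> bg x01; have [[L bl] H] := regularP bg.
have cg := smooth_continuous (bsmooth_smooth bg).
apply/esym; apply: (@regular_unique _ L (fun x t => regular gam x (t + h)) (bsmooth_shift h bg)) => //.
  move=> s s' u u' s01 s01'; have [h1 h2] := bl s s' (u + h) (u' + h) s01 s01'; split=> //.
  by move: h2; have -> : u + h - (u' + h) = u - u' by ring.
move=> y u y01; rewrite {1}(H _ _ y01); congr (_ + _).
  by rewrite /free_solution oint_shift//; congr (_ * oint _ _ _); ring.
congr (_ * _); apply: itg_eq => s /andP[s0 sy]; congr (_ * _).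
have s01 : 0 <= s <= 1 by case/andP: y01 => _ y1; rewrite (ltW s0) (le_trans sy).
rewrite (@oint_shift _ (regular gam s)); last exact: blip_continuous bl s01.
by congr oint; ring.
Qed.

(* Uniqueness turns the reflection symmetry of the integral equation into parity. *)
Lemma regular_odd gam x t : bsmooth gam -> (forall t, gam (- t) = - gam t) -> 0 <= x <= 1 ->
  regular gam x (- t) = - regular gam x t.
Proof.
move=> bg og x01; have [[L bl] H] := regularP bg.
have cg := smooth_continuous (bsmooth_smooth bg).
suff : - regular gam x (0 - t) = regular gam x t by rewrite sub0r => <-; rewrite opprK.
apply: (@regular_unique _ L (fun x t => - regular gam x (0 - t)) bg) => //.
  move=> s s' u u' s01 s01'; have [h1 h2] := bl s s' (0 - u) (0 - u') s01 s01'.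
  rewrite normrN; split=> //; rewrite -opprD normrN; move: h2.
  by have -> : `|0 - u - (0 - u')| = `|u - u'| by rewrite distrC; congr `|_|; ring.
move=> y u y01; rewrite {1}(H _ _ y01) opprD; congr (_ + _).
  rewrite /free_solution -mulrN -ointN//.
  have -> : (fun t => - gam t) = fun t => gam (0 - t) by apply/funext => v; rewrite sub0r og.
  by rewrite oint_refl//; congr (_ * oint _ _ _); ring.
rewrite /volterra -mulrN; congr (_ * _).
have /andP[y0 y1] := y01.
rewrite -mulN1r -itgZ; last exact: (volterra_integrable ip bl).
apply: itg_eq => s /andP[s0 sy].
have s01 : 0 <= s <= 1 by rewrite (ltW s0) (le_trans sy).
have cr := blip_continuous bl s01.
rewrite ointN; last exact: cont_refl.
rewrite mulrCA mulN1r; congr (_ * - _); rewrite oint_refl//.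
by congr oint; ring.
Qed.

Lemma regular_bound gam M x t : bsmooth gam -> (forall t, `|gam t| <= M) -> 0 <= x <= 1 ->
  `|regular gam x t| <= 2 * expR kap * M.
Proof.
move=> bg gM x01; have [[L bl] H] := regularP bg.
have cg := smooth_continuous (bsmooth_smooth bg).
have M0 : 0 <= M by apply: le_trans (gM 0).
have F y u : 0 <= y <= 1 -> True -> `|regular gam y u - volt (regular gam) y u| <= M * expR (kap * y).
  move=> y01 _; rewrite {1}(H _ _ y01) addrK; have /andP[y0 _] := y01.
  have [h _] := free_solution_blip cg gM u u y01 y01; apply: (le_trans h).
  by rewrite -[leLHS]mulr1 ler_wpM2l ?expk_ge1.
apply: (le_trans (volterra_apriori hT bl M0 F x01 I)); have /andP[x0 x1] := x01.
have -> : 2 * expR kap * M = 2 * M * expR kap by ring.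
rewrite ler_wpM2l ?mulr_ge0// ler_expR ler_piMr//.
by rewrite addr_ge0// mulr_ge0// itg_ge0.
Qed.

(** The region [x + r < |t|] contains the dependence triangles of its points and the free solution
    vanishes on it, so the a priori estimate applies with [F = 0]. *)
Lemma regular_supp gam r x t : bsmooth gam -> csupp r gam -> 0 <= x <= 1 -> x + r < `|t| ->
  regular gam x t = 0.
Proof.
move=> bg sg x01 xt; have [[L bl] H] := regularP bg.
have cg := smooth_continuous (bsmooth_smooth bg).
pose D (y u : R) : Prop := y + r < `|u|.
have hD : hereditary D.
  move=> y u s v yu s0 sy vu; rewrite /D in yu *.
  have := ler_normD (u - v) v; rewrite subrK distrC; lra.
have F y u : 0 <= y <= 1 -> D y u -> `|regular gam y u - volt (regular gam) y u| <= 0 * expR (kap * y).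
  move=> y01 yu; rewrite {1}(H _ _ y01) addrK mul0r normr_le0; apply/eqP.
  have /andP[y0 _] := y01; rewrite /free_solution oint_eq0 ?mulr0//; first lra.
  move=> v /andP[v1 v2]; apply: sg; move: yu; rewrite /D => yu.
  have : `|u - v| <= y by rewrite ler_norml; apply/andP; split; lra.
  have := ler_normD (u - v) v; rewrite subrK; lra.
have := volterra_apriori hD bl (lexx 0) F x01 xt.
by rewrite mulr0 mul0r normr_le0 => /eqP.
Qed.

(** By linearity and invariance under translations in time, the first-order remainder of the
    solution is the solution whose datum is the Taylor remainder of [gam]. *)
Lemma regular_der gam x : bsmooth gam -> 0 <= x <= 1 ->
  der (regular gam x) (regular (gam^`())%classic x).
Proof.
move=> bg x01 t; have [M M0 HM] := bsmooth_taylor bg; have bg1 := bsmooth_derive1 bg.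
apply: (@is_derive_quad _ _ _ _ (2 * expR kap * M)) => h _.
pose f s := (- h) * (gam^`())%classic s + (-1 * gam s + gam (s + h)).
have bf1 : bsmooth (fun s => -1 * gam s + gam (s + h)).
  by apply: bsmoothZD => //; exact: bsmooth_shift.
have bf : bsmooth f by exact: bsmoothZD.
have -> : regular gam x (t + h) - regular gam x t - h * regular (gam^`())%classic x t
   = regular f x t.
  rewrite /f regular_lin// regular_lin//; last exact: bsmooth_shift.
  by rewrite regular_shift//; ring.
rewrite -mulrA; apply: regular_bound => // s.
by have := HM s h; congr (`|_| <= _); rewrite /f; ring.
Qed.

(* The difference between the regular solution and the free one is controlled by the
   L^1 norm of [c], not by [c'] nor by the maximum of [c]. *)
Lemma regular_free_diff c r x t : smooth c -> csupp r c -> 0 <= r -> (forall t, 0 <= c t) ->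
  0 <= x <= 1 ->
  `|regular (c^`())%classic x t - free_solution (c^`())%classic x t|
    <= 2 * expR kap * (oint c (- r) r * kap).
Proof.
move=> sc cc r0 c0 x01; have bc := csupp_bsmooth sc cc; have bg := bsmooth_derive1 bc.
have cont_c := smooth_continuous sc.
set gam := (c^`())%classic; have cg : continuous gam := smooth_continuous (bsmooth_smooth bg).
have [[L bl] H] := regularP bg; have [M _ HM] := bsmooth_bound bg.
have bfree := free_solution_blip cg HM.
have bd := blip_lin (-1) bfree bl; set w := (fun s u => _) in bd.
set I1 := oint c (- r) r; have I0 : 0 <= I1 by apply: oint_ge0; [|lra|].
have int_c a b : `|oint c a b| <= I1.
  wlog ab : a b / a <= b.
    move=> W; have [|/ltW] := leP a b; first exact: W.
    by rewrite oint_sym normrN; exact: W.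
  rewrite ger0_norm; last by apply: oint_ge0.
  have -> : I1 = oint c (Num.min a (- r)) (Num.max b r).
    apply/esym; apply: oint_supp => //; [by rewrite ge_min lexx orbT|lra|by rewrite le_max lexx orbT| |].
      by move=> u ur; apply: cc; rewrite ltr_normr; apply/orP; right; lra.
    by move=> u ur; apply: cc; rewrite ltr_normr; apply/orP; left.
  have c1 : Num.min a (- r) <= a by rewrite ge_min lexx.
  have c2 : b <= Num.max b r by rewrite le_max lexx.
  rewrite -(oint_chasles c _ a (Num.max b r)) -(oint_chasles c a b (Num.max b r)).
  by have := oint_ge0 cont_c c1 (fun t _ => c0 t); have := oint_ge0 cont_c c2 (fun t _ => c0 t); lra.
have kap0 : 0 <= kap by rewrite addr_ge0// mulr_ge0// itg_ge0.
(* The difference [w] satisfies [w - volt w = volt free]. Integrating the free solution in time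
   replaces [c] by its primitive, and any integral of [c] over an interval is at most [I1] in
   absolute value. *)
have F y u : 0 <= y <= 1 -> True -> `|w y u - volt w y u| <= (I1 * kap) * expR (kap * y).
  move=> y01 _; have /andP[y0 y1] := y01.
  rewrite (@volterra_lin _ _ _ _ _ y u bfree bl y01) /w {1}(H _ _ y01).
  have -> : -1 * free_solution gam y u + (free_solution gam y u + volt (regular gam) y u)
    - (-1 * volt (free_solution gam) y u + volt (regular gam) y u) = volt (free_solution gam) y u.
    by ring.
  apply: (@le_trans _ _ (I1 * kap)); last first.
    by rewrite -[leLHS]mulr1 ler_wpM2l ?expk_ge1// mulr_ge0.
  rewrite /volterra normrM ger0_norm ?invr_ge0// ler_pdivrMl//.
  have ia a b : ig a b (fun s => `|p s|) by exact: ig_abs.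
  have pos a b : 0 <= itg a b (fun s => `|p s|) by exact: itg_ge0.
  apply: (@le_trans _ _ (itg 0 y (fun s => I1 * `|p s|))).
    apply: itg_bound; [exact: igZ|exact: (volterra_integrable ip bfree u y01 (lexx 0) y1)|].
    move=> s /andP[s0 sy]; rewrite mulrC; apply: ler_norm_mul => //.
    rewrite (@oint_FTC _ (fun v => 2^-1 * (oint c 0 (v + s) - oint c 0 (v - s)))); last first.
      have dd := oint_der 0 cont_c.
      apply: der_ext (derZ 2^-1 (derB (der_shift s dd) (der_shift (- s) dd))) _ => v.
      by rewrite (@free_solution_primitive c)//; exact: smooth_der.
    have e a b : oint c 0 b - oint c 0 a = oint c a b by rewrite -(oint_chasles c 0 a b); ring.
    rewrite -mulrBr !e normrM ger0_norm ?invr_ge0// ler_pdivrMl//.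
    apply: (le_trans (ler_normB _ _)).
    have := int_c (u + y - s - s) (u + y - s + s); have := int_c (u - y + s - s) (u - y + s + s).
    lra.
  rewrite itgZ// /growth (@itg_split _ 0 1 y)//.
  have := mulr_ge0 I0 (pos y 1); have := mulr_ge0 I0 (pos 0 y).
  by move: (itg 0 y _) (itg y 1 _) => A B; lra.
have := volterra_apriori hT bd (mulr_ge0 I0 kap0) F x01 I (t := t).
have -> : w x t = regular gam x t - free_solution gam x t by rewrite /w; ring.
move/le_trans; apply; have /andP[x0 x1] := x01.
have -> : 2 * expR kap * (I1 * kap) = 2 * (I1 * kap) * expR kap by ring.
by rewrite ler_wpM2l ?mulr_ge0// ler_expR ler_piMr.
Qed.

End RegularSolutionExistence.

(** * Regular solutions as evolutions in [x] *)

Section RegularWave.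
Context {R : realType} (p : R -> R) (ip : forall x y, ig x y p).
Context (N : R -> R) (hN : forall x y, x <= y -> itg x y (fun s => 1 + `|p s|) <= N y - N x).
Implicit Types (w : R -> R -> R) (gam c : R -> R) (x y s t e M L C : R).

Let Q1 := itg 0 1 (fun s => `|p s|).
Let Q1_ge0 : 0 <= Q1. Proof. exact: itg_ge0. Qed.
Let ia x y : ig x y (fun s => `|p s|). Proof. exact: ig_abs. Qed.

Lemma itg_1_abs x y : x <= y -> itg x y (fun s => 1 + `|p s|) = (y - x) + itg x y (fun s => `|p s|).
Proof.
move=> xy; rewrite itgD//; last by apply: ig_cont; exact: cont_cst.
rewrite (itg_cont xy (@cont_cst _ 1)) (@oint_FTC _ (fun s => 1 * s + 0) _ x y (der_affine _ _)).
by congr (_ + _); ring.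
Qed.

Lemma N_incr x y : x <= y ->
  y - x <= N y - N x /\ itg x y (fun s => `|p s|) <= N y - N x.
Proof.
move=> xy; have := hN xy; rewrite itg_1_abs// => h.
have h1 : 0 <= itg x y (fun s => `|p s|) by exact: itg_ge0.
by split; move: xy; rewrite -subr_ge0; lra.
Qed.

Lemma N_primitive x y : 0 <= x -> x <= y -> `|itg 0 y p - itg 0 x p| <= N y - N x.
Proof.
move=> x0 xy; have [_] := N_incr xy; apply: le_trans.
rewrite (@itg_split _ 0 y x)// addrAC subrr add0r; exact: itg_norm.
Qed.

(** With [e = 1] or [e = -1], the integral of [p w] along one of the two characteristics through
    [(x, t)]. *)
Let J e w x t := itg 0 x (fun s => p s * w s (t + e * (x - s))).

Let ig_char e w L x t a b : blip L w -> `|e| <= 1 -> 0 <= a -> b <= 1 ->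
  ig a b (fun s => p s * w s (t + e * (x - s))).
Proof.
move=> bw e1 a0 b1; apply: (@ig_mul_lip _ _ ip _ (L * 2)) => // s s' s01 s01'.
have [_ h] := bw s s' (t + e * (x - s)) (t + e * (x - s')) s01 s01'; apply: (le_trans h).
rewrite -mulrA ler_wpM2l ?(blip_ge0 bw)//.
have -> : t + e * (x - s) - (t + e * (x - s')) = e * (s' - s) by ring.
rewrite normrM (distrC s').
have : `|e| * `|s - s'| <= 1 * `|s - s'| by rewrite ler_wpM2r.
by lra.
Qed.

Let itg_p_bound (f : R -> R) M x y : 0 <= M -> x <= y -> ig x y (fun s => p s * f s) ->
  (forall s, x < s <= y -> `|f s| <= M) ->
  `|itg x y (fun s => p s * f s)| <= M * itg x y (fun s => `|p s|).
Proof.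
move=> M0 xy If fM; rewrite -itgZ//; apply: itg_bound => //; first exact: igZ.
by move=> s sxy; rewrite mulrC; apply: ler_norm_mul => //; exact: fM.
Qed.

Let itg_p1 x y : 0 <= x -> x <= y -> y <= 1 -> itg x y (fun s => `|p s|) <= Q1.
Proof.
move=> x0 xy y1; have pos a b : 0 <= itg a b (fun s => `|p s|) by exact: itg_ge0.
rewrite /Q1 (@itg_split _ 0 1 x)//; last exact: le_trans xy y1.
rewrite (@itg_split _ x 1 y)//.
by have := pos 0 x; have := pos y 1; lra.
Qed.

(** Over [[0, x]] Taylor's formula is used at each point of the characteristic. The contribution of
    [[x, y]] is kept as it is, since values and derivatives combine it with different signs. *)
Let J_incr e w w' L L' C x y t : `|e| <= 1 -> blip L w -> blip L' w' -> 0 <= C ->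
  (forall s u d, 0 <= s <= 1 -> `|w s (u + d) - w s u - d * w' s u| <= C * d ^+ 2) ->
  0 <= x -> x <= y -> y <= 1 ->
  `|J e w y t - J e w x t - e * (y - x) * J e w' x t - itg x y (fun s => p s * w s (t + e * (y - s)))|
    <= C * (y - x) ^+ 2 * Q1.
Proof.
move=> e1 bw bw' C0 tay x0 xy y1; have x1 : x <= 1 := le_trans xy y1.
have i1 := ig_char y t bw e1 (lexx 0) x1; have i2 := ig_char x t bw e1 (lexx 0) x1.
have i3 := ig_char x t bw' e1 (lexx 0) x1.
rewrite /J (@itg_split _ 0 y x)//; last exact: ig_char bw e1 (lexx 0) y1.
set Z := itg x y _.
have -> : itg 0 x (fun s => p s * w s (t + e * (y - s))) + Z
   - itg 0 x (fun s => p s * w s (t + e * (x - s)))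
   - e * (y - x) * itg 0 x (fun s => p s * w' s (t + e * (x - s))) - Z
  = itg 0 x (fun s => p s * (w s (t + e * (y - s)) - w s (t + e * (x - s))
      - e * (y - x) * w' s (t + e * (x - s)))).
  have -> : itg 0 x (fun s => p s * (w s (t + e * (y - s)) - w s (t + e * (x - s))
      - e * (y - x) * w' s (t + e * (x - s))))
   = itg 0 x (fun s => (p s * w s (t + e * (y - s)) - p s * w s (t + e * (x - s)))
      - e * (y - x) * (p s * w' s (t + e * (x - s)))).
    by apply: itg_eq => s _; ring.
  by rewrite itgB ?itgB ?itgZ//; [ring|exact: igB|exact: igZ].
apply: (le_trans (itg_p_bound (M := C * (y - x) ^+ 2) _ x0 _ _)).
- by rewrite mulr_ge0// sqr_ge0.
- have := igB (igB i1 i2) (igZ (e * (y - x)) i3).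
  by apply: ig_eq => s _; ring.
- move=> s /andP[s0 sx]; have s01 : 0 <= s <= 1 by rewrite (ltW s0) (le_trans sx).
  have := tay s (t + e * (x - s)) (e * (y - x)) s01.
  have -> : t + e * (x - s) + e * (y - x) = t + e * (y - s) by ring.
  move/le_trans; apply; rewrite ler_wpM2l// exprMn ler_piMl ?sqr_ge0//.
  by rewrite -real_normK ?num_real// expr_le1.
- by rewrite ler_wpM2l ?itg_p1// mulr_ge0// sqr_ge0.
Qed.

(** The formal [x]-derivative of the integral equation: differentiating the limits of the inner
    integrals leaves integrals along the two characteristics. *)
Definition regular_x gam x t : R :=
  2^-1 * (gam (t + x) + gam (t - x))
  + 2^-1 * (J 1 (regular p gam) x t + J (-1) (regular p gam) x t).

(** For the datum [c'] the inner time integrals are explicit, [regular p c] being a primitive of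
    [regular p c'] in time. Only characteristic integrals remain, to which [J_incr] applies. *)
Let regular_formula c x t : bsmooth c -> 0 <= x <= 1 ->
  regular p (c^`())%classic x t = 2^-1 * (c (t + x) - c (t - x))
  + 2^-1 * (J 1 (regular p c) x t - J (-1) (regular p c) x t).
Proof.
move=> bc x01; have [_ H] := regularP ip (bsmooth_derive1 bc); have /andP[x0 x1] := x01.
have [[L bl] _] := regularP ip bc.
have n1 : `|1 : R| <= 1 by rewrite normr1.
have n2 : `|-1 : R| <= 1 by rewrite normrN normr1.
have i1 := ig_char x t bl n1 (lexx 0) x1; have i2 := ig_char x t bl n2 (lexx 0) x1.
rewrite H// (free_solution_primitive _ _ (bsmooth_der bc)); congr (_ + _ * _).
rewrite /J -itgB//; apply: itg_eq => s /andP[s0 sx].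
have s01 : 0 <= s <= 1 by rewrite (ltW s0) (le_trans sx).
rewrite (oint_FTC _ _ (regular_der ip bc s01)).
have -> : t - x + s = t + -1 * (x - s) by ring.
have -> : t + x - s = t + 1 * (x - s) by ring.
by rewrite [LHS]mulrBr.
Qed.

Let regular_taylor gam : bsmooth gam -> exists2 C, 0 <= C & forall s u d, 0 <= s <= 1 ->
  `|regular p gam s (u + d) - regular p gam s u - d * regular p (gam^`())%classic s u| <= C * d ^+ 2.
Proof.
move=> bg; have bg1 := bsmooth_derive1 bg; have bg2 := bsmooth_derive1 bg1.
have [M M0 HM] := bsmooth_bound bg2.
exists (2 * expR (growth p) * M); first by rewrite !mulr_ge0 ?expR_ge0.
move=> s u d s01.
have := @taylor1 _ _ _ _ (2 * expR (growth p) * M) (`|u| + `|d|) u (u + d)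
  (regular_der ip bg s01) (regular_der ip bg1 s01).
rewrite (addrAC u) subrr add0r; apply; [|by rewrite lerDl|exact: ler_normD].
by move=> t _; exact: regular_bound.
Qed.

Lemma regular_x_lip1 gam x : bsmooth gam -> 0 <= x <= 1 -> lip1 (regular_x gam x).
Proof.
move=> bg x01; have [[L1 bl1] _] := regularP ip bg; have L10 := blip_ge0 bl1.
have [Lg Lg0 HLg] := bsmooth_lip bg; have /andP[x0 x1] := x01.
have n1 : `|1 : R| <= 1 by rewrite normr1.
have n2 : `|-1 : R| <= 1 by rewrite normrN normr1.
have Jlip e t t' : `|e| <= 1 ->
    `|J e (regular p gam) x t - J e (regular p gam) x t'| <= L1 * `|t - t'| * Q1.
  move=> e1; rewrite /J -itgB; [|exact: ig_char bl1 e1 (lexx 0) x1..].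
  rewrite (@itg_eq _ 0 x _ (fun s => p s * (regular p gam s (t + e * (x - s))
     - regular p gam s (t' + e * (x - s))))); last by move=> s _; ring.
  apply: (le_trans (itg_p_bound (M := L1 * `|t - t'|) _ x0 _ _)).
  - by rewrite mulr_ge0.
  - have := igB (ig_char x t bl1 e1 (lexx 0) x1) (ig_char x t' bl1 e1 (lexx 0) x1).
    by apply: ig_eq => s _; ring.
  - move=> s /andP[s0 sx]; have s01 : 0 <= s <= 1 by rewrite (ltW s0) (le_trans sx).
    have [_] := bl1 s s (t + e * (x - s)) (t' + e * (x - s)) s01 s01.
    rewrite subrr normr0 add0r.
    by have -> : t + e * (x - s) - (t' + e * (x - s)) = t - t' by ring.
  - by rewrite ler_wpM2l ?mulr_ge0// itg_p1.
move=> T; exists (Lg + L1 * Q1) => t t' _ _.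
have -> : regular_x gam x t - regular_x gam x t' =
  2^-1 * ((gam (t + x) - gam (t' + x)) + (gam (t - x) - gam (t' - x))
   + (J 1 (regular p gam) x t - J 1 (regular p gam) x t')
   + (J (-1) (regular p gam) x t - J (-1) (regular p gam) x t')) by rewrite /regular_x; ring.
rewrite normrM ger0_norm ?invr_ge0// ler_pdivrMl//.
have -> : 2 * ((Lg + L1 * Q1) * `|t - t'|) = Lg * `|t - t'| + Lg * `|t - t'|
  + L1 * `|t - t'| * Q1 + L1 * `|t - t'| * Q1 by ring.
apply: (le_trans (ler_normD _ _)); apply: lerD; last exact: Jlip.
apply: (le_trans (ler_normD _ _)); apply: lerD; last exact: Jlip.
apply: (le_trans (ler_normD _ _)); apply: lerD; apply: (le_trans (HLg _ _)).
  by have -> : t + x - (t' + x) = t - t' by ring.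
by have -> : t - x - (t' - x) = t - t' by ring.
Qed.

Lemma regular_x_0 gam t : regular_x gam 0 t = gam t.
Proof.
rewrite /regular_x /J !(@itg_empty _ 0 0)// addr0 subr0 addr0 mulr0 addr0.
by field.
Qed.

Lemma regular_0 gam t : bsmooth gam -> regular p gam 0 t = 0.
Proof.
move=> bg; have [_ H] := regularP ip bg.
rewrite H ?lexx ?ler01// /free_solution subr0 addr0 ointxx mulr0 add0r.
by rewrite /volterra itg_empty ?mulr0.
Qed.

Lemma regular_x_supp gam r x t : bsmooth gam -> csupp r gam -> 0 <= x <= 1 -> x + r < `|t| ->
  regular_x gam x t = 0.
Proof.
move=> bg sg x01 xt; have /andP[x0 x1] := x01.
have far y : `|y| <= x -> r < `|t + y|.
  by move=> yx; have := ler_normB (t + y) y; rewrite addrK; lra.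
have J0 e : `|e| = 1 -> J e (regular p gam) x t = 0.
  move=> e1; rewrite /J (@itg_eq _ 0 x _ (fun=> 0)) ?itg0// => s /andP[s0 sx].
  have s01 : 0 <= s <= 1 by rewrite (ltW s0) (le_trans sx).
  rewrite (regular_supp ip bg sg s01) ?mulr0//.
  have := ler_normB (t + e * (x - s)) (e * (x - s)); rewrite addrK normrM e1 mul1r.
  by rewrite (@ger0_norm _ (x - s)); lra.
rewrite /regular_x !J0 ?normrN ?normr1// !sg; first by rewrite !addr0 !mulr0 addr0.
- by apply: far; rewrite normrN ger0_norm.
- by apply: far; rewrite ger0_norm.
Qed.

Lemma regular_x_odd gam x t : bsmooth gam -> (forall t, gam (- t) = - gam t) -> 0 <= x <= 1 ->
  regular_x gam x (- t) = - regular_x gam x t.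
Proof.
move=> bg og x01; have /andP[x0 x1] := x01.
have [[L bl] _] := regularP ip bg.
have J1 e : `|e| <= 1 -> J e (regular p gam) x (- t) = - J (- e) (regular p gam) x t.
  move=> e1; rewrite /J -[RHS]mulN1r -itgZ; last by apply: ig_char bl _ (lexx 0) x1; rewrite normrN.
  apply: itg_eq => s /andP[s0 sx].
  have s01 : 0 <= s <= 1 by rewrite (ltW s0) (le_trans sx).
  have -> : - t + e * (x - s) = - (t + - e * (x - s)) by ring.
  by rewrite (regular_odd ip _ bg og s01); ring.
rewrite /regular_x !J1 ?opprK ?normrN ?normr1//.
have -> : - t + x = - (t - x) by ring.
have -> : - t - x = - (t + x) by ring.
by rewrite !og; ring.
Qed.

Lemma regular_wave_solution c : bsmooth c -> forall gam gam1 : R -> R,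
  gam = (c^`())%classic -> gam1 = (gam^`())%classic ->
  wave_solution N (fun x => itg 0 x p) 0 1 (regular p gam) (regular p gam1)
    (regular p (gam1^`())%classic) (regular_x gam).
Proof.
move=> bc gam gam1 e eg; have bg : bsmooth gam by rewrite e; exact: bsmooth_derive1.
have bg1 : bsmooth gam1 by rewrite eg; exact: bsmooth_derive1.
have bg2 := bsmooth_derive1 bg1.
have dc : der c gam by rewrite e; exact: bsmooth_der.
have n1 : `|1 : R| <= 1 by rewrite normr1.
have n2 : `|-1 : R| <= 1 by rewrite normrN normr1.
have [[L0 bl0] _] := regularP ip bc; have [[L1 bl1] _] := regularP ip bg.
have [[L2 bl2] _] := regularP ip bg1; have [[L3 bl3] _] := regularP ip bg2.
have L10 := blip_ge0 bl1; have L30 := blip_ge0 bl3.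
have bb L w s t : blip L w -> 0 <= s <= 1 -> `|w s t| <= L by move=> h s01; have [] := h s s t t s01 s01.
have [C0 C00 tay0] := regular_taylor bc; have [C1 C10 tay1] := regular_taylor bg.
rewrite -e in tay0; rewrite -eg in tay1.
have [M0 M00 tc] := bsmooth_taylor bc; rewrite -e in tc.
have [M1 M10 tg] := bsmooth_taylor bg; rewrite -eg in tg.
have [G G0 HG] := bsmooth_bound bg; have [Lg Lg0 HLg] := bsmooth_lip bg.
have half (X A : R) : `|X| <= 2 * A -> `|2^-1 * X| <= A.
  by move=> h; rewrite normrM ger0_norm ?invr_ge0// ler_pdivrMl.
have Jb eps x t : `|eps| <= 1 -> 0 <= x <= 1 -> `|J eps (regular p gam) x t| <= L1 * Q1.
  move=> e1 /andP[x0 x1]; apply: (le_trans (itg_p_bound L10 x0 (ig_char x t bl1 e1 (lexx 0) x1) _)).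
    by move=> s /andP[s0 sx]; apply: (bb _ _ _ _ bl1); rewrite (ltW s0) (le_trans sx).
  by rewrite ler_wpM2l// itg_p1.
split.
- by move=> x x01; rewrite eg; exact: regular_der.
- by move=> x x01; exact: regular_der.
- by move=> x x01; exact: blip_continuous bl3 x01.
- by move=> x x01; apply: lip1_continuous; exact: regular_x_lip1.
move=> T; exists (L1 + (G + L1 * Q1) + L3 + (M0 + C0 * Q1 + L1) + (M1 + C1 * Q1 + L1)).
  by rewrite !addr_ge0 ?mulr_ge0.
move=> x y t x0 xy y1 tT; have x01 : 0 <= x <= 1 by rewrite x0 (le_trans xy).
have y01 : 0 <= y <= 1 by rewrite y1 (le_trans x0).
have k0 : 0 <= y - x by rewrite subr_ge0.
have [d1 d2] := N_incr xy; have n0 : 0 <= N y - N x := le_trans k0 d1.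
have q1 := mulr_ge0 L10 Q1_ge0; have q2 := mulr_ge0 C00 Q1_ge0; have q3 := mulr_ge0 C10 Q1_ge0.
have kn : (y - x) ^+ 2 <= (y - x) * (N y - N x) by rewrite expr2 ler_wpM2l.
have kn0 : 0 <= (y - x) * (N y - N x) by rewrite mulr_ge0.
split.
- by apply: (le_trans (bb _ _ _ _ bl1 x01)); lra.
- apply: (@le_trans _ _ (G + L1 * Q1)); last lra.
  have -> : regular_x gam x t = 2^-1 * (gam (t + x) + gam (t - x)
     + (J 1 (regular p gam) x t + J (-1) (regular p gam) x t)) by rewrite /regular_x; ring.
  apply: half; have -> : 2 * (G + L1 * Q1) = (G + G) + (L1 * Q1 + L1 * Q1) by ring.
  apply: (le_trans (ler_normD _ _)); apply: lerD; apply: (le_trans (ler_normD _ _)); apply: lerD => //;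
    exact: Jb.
- by apply: (le_trans (bb _ _ _ _ bl3 x01)); lra.
- apply: (@le_trans _ _ ((M0 + C0 * Q1 + L1) * ((y - x) * (N y - N x)))); last first.
    by rewrite -mulrA ler_wpM2r//; lra.
  have F x' : 0 <= x' <= 1 -> regular p gam x' t = 2^-1 * (c (t + x') - c (t - x'))
     + 2^-1 * (J 1 (regular p c) x' t - J (-1) (regular p c) x' t).
    by move=> x'01; rewrite e regular_formula.
  have h1 := J_incr t n1 bl0 bl1 C00 tay0 x0 xy y1.
  have h2 := J_incr t n2 bl0 bl1 C00 tay0 x0 xy y1.
  set S1 := itg x y _ in h1; set S2 := itg x y _ in h2.
  (* For the value, the contributions of [[x, y]] are subtracted and cancel up to the distance
     [2 (y - s)] between the two characteristics. *)
  have h3 : `|S1 - S2| <= 2 * L1 * (y - x) * (N y - N x).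
    have i1 := ig_char y t bl0 n1 x0 y1; have i2 := ig_char y t bl0 n2 x0 y1.
    rewrite /S1 /S2 -itgB//.
    rewrite (@itg_eq _ x y _ (fun s => p s * (regular p c s (t + 1 * (y - s))
     - regular p c s (t + -1 * (y - s))))); last by move=> s _; ring.
    apply: (le_trans (itg_p_bound (M := 2 * L1 * (y - x)) _ xy _ _)).
    + by rewrite !mulr_ge0.
    + by have := igB i1 i2; apply: ig_eq => s _; ring.
    + move=> s /andP[xs sy]; have s01 : 0 <= s <= 1 by rewrite (le_trans x0 (ltW xs)) (le_trans sy).
      have := der_lip_ball (regular_der ip bc s01) (M := L1)
        (T := `|t + -1 * (y - s)| + `|t + 1 * (y - s)|) (x := t + -1 * (y - s)) (y := t + 1 * (y - s)).
      rewrite -e lerDl lerDr !normr_ge0 => /(_ (fun u _ => bb _ _ _ _ bl1 s01) isT isT).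
      move/le_trans; apply; have -> : 2 * L1 * (y - x) = L1 * (2 * (y - x)) by ring.
      rewrite ler_wpM2l//.
      have -> : t + 1 * (y - s) - (t + -1 * (y - s)) = 2 * (y - s) by ring.
      by rewrite ger0_norm ?mulr_ge0 ?subr_ge0// ler_wpM2l// lerB// ltW.
    + by rewrite ler_wpM2l// !mulr_ge0.
  have h4 : `|c (t + y) - c (t + x) - (y - x) * gam (t + x)| <= M0 * (y - x) ^+ 2.
    by have := tc (t + x) (y - x); have -> : t + x + (y - x) = t + y by ring.
  have h5 : `|c (t - y) - c (t - x) - (x - y) * gam (t - x)| <= M0 * (y - x) ^+ 2.
    have := tc (t - x) (x - y); have -> : t - x + (x - y) = t - y by ring.
    by have -> : (x - y) ^+ 2 = (y - x) ^+ 2 by ring.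
  rewrite !F// /regular_x.
  set A1 := J 1 (regular p c) y t in h1 *; set A2 := J 1 (regular p c) x t in h1 *.
  set A3 := J 1 (regular p gam) x t in h1 *.
  set B1 := J (-1) (regular p c) y t in h2 *; set B2 := J (-1) (regular p c) x t in h2 *.
  set B3 := J (-1) (regular p gam) x t in h2 *.
  have -> : 2^-1 * (c (t + y) - c (t - y)) + 2^-1 * (A1 - B1)
    - (2^-1 * (c (t + x) - c (t - x)) + 2^-1 * (A2 - B2))
    - (y - x) * (2^-1 * (gam (t + x) + gam (t - x)) + 2^-1 * (A3 + B3))
   = 2^-1 * ((c (t + y) - c (t + x) - (y - x) * gam (t + x))
      - (c (t - y) - c (t - x) - (x - y) * gam (t - x))
      + (A1 - A2 - 1 * (y - x) * A3 - S1) - (B1 - B2 - -1 * (y - x) * B3 - S2) + (S1 - S2)) by ring.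
  apply: half.
  apply: (@le_trans _ _ (M0 * (y - x) ^+ 2 + M0 * (y - x) ^+ 2 + C0 * (y - x) ^+ 2 * Q1
     + C0 * (y - x) ^+ 2 * Q1 + 2 * L1 * (y - x) * (N y - N x))).
    apply: (le_trans (ler_normD _ _)); apply: lerD => //.
    apply: (le_trans (ler_normB _ _)); apply: lerD => //.
    apply: (le_trans (ler_normD _ _)); apply: lerD => //.
    by apply: (le_trans (ler_normB _ _)); apply: lerD.
  have := ler_wpM2l M00 kn; have := ler_wpM2l q2 kn.
  rewrite -(mulrA (2 * L1)); move: ((y - x) ^+ 2) ((y - x) * (N y - N x)) => A B; lra.
- apply: (@le_trans _ _ ((M1 + C1 * Q1 + L1) * ((y - x) * (N y - N x)))); last first.
    by rewrite -mulrA ler_wpM2r//; lra.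
  have F := regular_formula t bg1 x01.
  have h1 := J_incr t n1 bl1 bl2 C10 tay1 x0 xy y1.
  have h2 := J_incr t n2 bl1 bl2 C10 tay1 x0 xy y1.
  set S1 := itg x y _ in h1; set S2 := itg x y _ in h2.
  set P := itg 0 y p - itg 0 x p; set w0 := regular p gam x t.
  (* For the derivative they are added, and to first order they give [2 (Q y - Q x) w]: this is
     where the potential enters. *)
  have h3 : `|S1 + S2 - 2 * P * w0| <= 2 * L1 * (y - x) * (N y - N x).
    have i1 := ig_char y t bl1 n1 x0 y1; have i2 := ig_char y t bl1 n2 x0 y1.
    have -> : P = itg x y p by rewrite /P (@itg_split _ 0 y x)//; ring.
    have -> : S1 + S2 - 2 * itg x y p * w0 = S1 + S2 - itg x y (fun s => 2 * w0 * p s).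
      by rewrite itgZ//; ring.
    rewrite /S1 /S2 -itgD// -itgB//; [|exact: igD|exact: igZ].
    rewrite (@itg_eq _ x y _ (fun s => p s * ((regular p gam s (t + 1 * (y - s)) - w0)
     + (regular p gam s (t + -1 * (y - s)) - w0)))); last by move=> s _; ring.
    apply: (le_trans (itg_p_bound (M := 2 * L1 * (y - x)) _ xy _ _)).
    + by rewrite !mulr_ge0.
    + by have := igB (igD i1 i2) (igZ (2 * w0) (ip x y)); apply: ig_eq => s _; ring.
    + move=> s /andP[xs sy]; have s01 : 0 <= s <= 1 by rewrite (le_trans x0 (ltW xs)) (le_trans sy).
      have ys0 : 0 <= y - s by rewrite subr_ge0.
      have sx0 : 0 <= s - x by rewrite subr_ge0 ltW.
      have H eps : `|eps| <= 1 -> `|regular p gam s (t + eps * (y - s)) - w0| <= L1 * (y - x).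
        move=> e1; have [_ h] := bl1 s x (t + eps * (y - s)) t s01 x01; apply: (le_trans h).
        have le1 : `|eps| * (y - s) <= y - s by rewrite ler_piMl.
        have -> : t + eps * (y - s) - t = eps * (y - s) by ring.
        rewrite ler_wpM2l// (ger0_norm sx0) normrM (ger0_norm ys0).
        have -> : y - x = (s - x) + (y - s) by ring.
        by rewrite lerD2l.
      apply: (le_trans (ler_normD _ _)).
      have -> : 2 * L1 * (y - x) = L1 * (y - x) + L1 * (y - x) by ring.
      exact: lerD (H _ n1) (H _ n2).
    + by rewrite ler_wpM2l// !mulr_ge0.
  have h4 : `|gam (t + y) - gam (t + x) - (y - x) * gam1 (t + x)| <= M1 * (y - x) ^+ 2.
    by have := tg (t + x) (y - x); have -> : t + x + (y - x) = t + y by ring.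
  have h5 : `|gam (t - y) - gam (t - x) - (x - y) * gam1 (t - x)| <= M1 * (y - x) ^+ 2.
    have := tg (t - x) (x - y); have -> : t - x + (x - y) = t - y by ring.
    by have -> : (x - y) ^+ 2 = (y - x) ^+ 2 by ring.
  rewrite F /regular_x.
  set A1 := J 1 (regular p gam) y t in h1 *; set A2 := J 1 (regular p gam) x t in h1 *.
  set A3 := J 1 (regular p gam1) x t in h1 *.
  set B1 := J (-1) (regular p gam) y t in h2 *; set B2 := J (-1) (regular p gam) x t in h2 *.
  set B3 := J (-1) (regular p gam1) x t in h2 *.

  have -> : 2^-1 * (gam (t + y) + gam (t - y)) + 2^-1 * (A1 + B1)
    - (2^-1 * (gam (t + x) + gam (t - x)) + 2^-1 * (A2 + B2))
    - (y - x) * (2^-1 * (gam1 (t + x) - gam1 (t - x)) + 2^-1 * (A3 - B3)) - P * w0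
   = 2^-1 * ((gam (t + y) - gam (t + x) - (y - x) * gam1 (t + x))
      + (gam (t - y) - gam (t - x) - (x - y) * gam1 (t - x))
      + (A1 - A2 - 1 * (y - x) * A3 - S1) + (B1 - B2 - -1 * (y - x) * B3 - S2)
      + (S1 + S2 - 2 * P * w0)) by field.
  apply: half.
  apply: (@le_trans _ _ (M1 * (y - x) ^+ 2 + M1 * (y - x) ^+ 2 + C1 * (y - x) ^+ 2 * Q1
     + C1 * (y - x) ^+ 2 * Q1 + 2 * L1 * (y - x) * (N y - N x))).
    apply: (le_trans (ler_normD _ _)); apply: lerD => //.
    apply: (le_trans (ler_normD _ _)); apply: lerD => //.
    apply: (le_trans (ler_normD _ _)); apply: lerD => //.
    by apply: (le_trans (ler_normD _ _)); apply: lerD.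
  have := ler_wpM2l M10 kn; have := ler_wpM2l q3 kn.
  rewrite -(mulrA (2 * L1)); move: ((y - x) ^+ 2) ((y - x) * (N y - N x)) => A B; lra.
Qed.

End RegularWave.

(** * Outgoing condition and finite propagation speed *)

Section WaveSolutions.
Context {R : realType}.
Implicit Types (N Q eta : R -> R) (s t x y T d : R).

Lemma wave_solution_sub N Q x0 x1 y0 y1 (w wt wtt wx : R -> R -> R) : x0 <= y0 -> y1 <= x1 ->
  wave_solution N Q x0 x1 w wt wtt wx -> wave_solution N Q y0 y1 w wt wtt wx.
Proof.
move=> h0 h1 [w1 w2 w3 w4 w5]; have sub x : y0 <= x <= y1 -> x0 <= x <= x1.
  by move=> /andP[? ?]; apply/andP; split; lra.
split; [by move=> x /sub; exact: w1|by move=> x /sub; exact: w2|by move=> x /sub; exact: w3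
  |by move=> x /sub; exact: w4|].
move=> T; have [K K0 H] := w5 T; exists K => // x y t *; apply: H => //; lra.
Qed.

Lemma wave_solution_refl N Q x0 x1 s (w wt wtt wx : R -> R -> R) :
  wave_solution N Q x0 x1 w wt wtt wx ->
  wave_solution N Q x0 x1 (fun x t => w x (s - t)) (fun x t => - wt x (s - t))
    (fun x t => wtt x (s - t)) (fun x t => wx x (s - t)).
Proof.
move=> [w1 w2 w3 w4 w5]; split.
- by move=> x /w1/(der_refl s).
- move=> x /w2/(der_refl s)/derN H; apply: der_ext H _ => t; exact: opprK.
- by move=> x /w3; exact: cont_refl.
- by move=> x /w4; exact: cont_refl.
- move=> T; have [K K0 H] := w5 (`|s| + T); exists K => // x y t h1 h2 h3 tT.
  by apply: H => //; apply: (le_trans (ler_normB _ _)); rewrite lerD2l.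
Qed.

(** A solution wherever the potential vanishes, which is expressed by [Q] being constant on the
    strip: this covers the free equation as well as the region beyond the support of [q]. *)
Lemma travelling_wave N Q x0 x1 eta (e d : R) : bsmooth eta -> e = 1 \/ e = -1 -> 0 <= x0 ->
  (forall x y, x0 <= x -> x <= y -> y <= x1 -> Q y = Q x /\ y - x <= N y - N x) ->
  forall eta1 : R -> R, eta1 = (eta^`())%classic ->
  wave_solution N Q x0 x1 (fun x t => eta (t + (e * x + d))) (fun x t => eta1 (t + (e * x + d)))
    (fun x t => (eta1^`())%classic (t + (e * x + d))) (fun x t => e * eta1 (t + (e * x + d))).
Proof.
move=> be e1 x00 HQ eta1 e1E; have be1 : bsmooth eta1 by rewrite e1E; exact: bsmooth_derive1.
have be2 := bsmooth_derive1 be1.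
have c1 := smooth_continuous (bsmooth_smooth be1); have c2 := smooth_continuous (bsmooth_smooth be2).
have de : der eta eta1 by rewrite e1E; exact: bsmooth_der.
split.
- by move=> x _; exact: der_shift.
- by move=> x _; apply: der_shift; exact: bsmooth_der.
- by move=> x _; exact: cont_shift.
- by move=> x _; apply: contM; [exact: cont_cst|exact: cont_shift].
have [A A0 HA] := bsmooth_bound be; have [A1 A10 HA1] := bsmooth_bound be1.
have [A2 A20 HA2] := bsmooth_bound be2.
have [M M0 HM] := bsmooth_taylor be; rewrite -e1E in HM; have [M1 M10 HM1] := bsmooth_taylor be1.
have en : `|e| = 1 by case: e1 => ->; rewrite ?normrN normr1.
have ee : e * e = 1 by case: e1 => ->; rewrite ?mulrNN mulr1.
move=> T; exists (A + A1 + A2 + M + M1); first by rewrite !addr_ge0.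
move=> x y t x0x xy yx1 _; have [-> nN] := HQ x y x0x xy yx1.
have k0 : 0 <= y - x by rewrite subr_ge0.
have kn : (y - x) ^+ 2 <= (y - x) * (N y - N x) by rewrite expr2 ler_wpM2l.
have shift : t + (e * y + d) = t + (e * x + d) + e * (y - x) by ring.
have sq : (e * (y - x)) ^+ 2 = (y - x) ^+ 2 by rewrite exprMn expr2 ee mul1r.
set r := t + (e * x + d) in shift *.
have fin (B : R) : 0 <= B -> B <= A + A1 + A2 + M + M1 ->
    B * (y - x) ^+ 2 <= (A + A1 + A2 + M + M1) * (y - x) * (N y - N x).
  move=> B0 BK; rewrite -mulrA; apply: ler_pM => //; exact: sqr_ge0.
split.
- by apply: (le_trans (HA _)); lra.
- by rewrite normrM en mul1r; apply: (le_trans (HA1 _)); lra.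
- by apply: (le_trans (HA2 _)); lra.
- have := HM r (e * (y - x)); rewrite -shift sq.
  have -> : e * (y - x) * eta1 r = (y - x) * (e * eta1 r) by ring.
  by move=> h; apply: (le_trans h); apply: fin => //; lra.
- have := HM1 r (e * (y - x)); rewrite -shift sq subrr mul0r subr0.
  set D := (eta1^`())%classic r; move=> h.
  have -> : e * eta1 (t + (e * y + d)) - e * eta1 r - (y - x) * D
     = e * (eta1 (t + (e * y + d)) - eta1 r - e * (y - x) * D) + (e * e - 1) * ((y - x) * D) by ring.
  rewrite ee subrr mul0r addr0 normrM en mul1r.
  by apply: (le_trans h); apply: fin => //; lra.
Qed.

End WaveSolutions.

(** * Causality and the outgoing condition at [x = 1] *)

Section OneMeasurement.
Context {R : realType} (q : R -> R) (u : R -> (R -> R) -> R).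
Local Notation p := (extend0 q).
Local Notation v := (mollified u).
Context (hu : causal_solution q u) (ip : forall x y, ig x y p).
Context (N : R -> R) (hN : forall x y, x <= y -> itg x y (fun s => 1 + `|p s|) <= N y - N x).
Implicit Types (b eta : R -> R) (s t x y T eps : R).

Let Q x := itg 0 x p.

Lemma mollified_boundary b t : test_fun1 b -> v b 0 t = b t.
Proof.
move=> tb; have [r cb] := test_fun1_csupp tb; have sb : smooth b := Smooth tb.1.
have tbt : test_fun1 (fun s => b (t - s)).
  by apply: csupp_test_fun1 (csupp_refl cb); exact: smooth_refl.
by rewrite /mollified (sol_boundary hu tbt)// subr0.
Qed.

Lemma mollified_causal b eps x t : smooth b -> csupp eps b -> 0 <= x -> t < - eps -> v b x t = 0.
Proof.
move=> sb cb x0 te; apply: (sol_causal hu x0 (csupp_test_fun1 (smooth_refl t sb) (csupp_refl cb))).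
have cl : closed [set s : R | s <= t + eps] by exact: closed_le.
move=> s /(@closure_subset _ _ [set s : R | s <= t + eps]) h.
have : closure [set s : R | s <= t + eps] s.
  apply: h => z /= /eqP bz; rewrite leNgt; apply/negP => zt; apply: bz; apply: cb.
  by rewrite ltr_normr; apply/orP; right; lra.
by rewrite -((closure_id _).1 cl) /= in_itv/=; lra.
Qed.

Lemma mollified_x_causal X b eps x t : smooth b -> csupp eps b -> 0 <= x -> 0 < X -> t < - eps ->
  mollified_x q u X b x t = 0.
Proof.
move=> sb cb x0 X0 te; rewrite /mollified_x.
have sb1 := smooth_derive1 sb; have sb2 := smooth_derive1 sb1.
have cb2 := csupp_der (csupp_der cb (smooth_der sb)) (smooth_der sb1).
rewrite (mollified_causal sb cb (ltW X0) te) (mollified_causal sb cb (lexx 0) te).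
rewrite (@itg_eq _ 0 X _ (fun=> 0)) => [|s /andP[/ltW s0 _]]; last first.
  by rewrite (mollified_causal sb2 cb2 s0 te) (mollified_causal sb cb s0 te) !mulr0 addr0 mulr0.
rewrite (@itg_eq _ 0 x _ (fun=> 0)) => [|s /andP[/ltW s0 _]]; last first.
  by rewrite (mollified_causal sb2 cb2 s0 te) (mollified_causal sb cb s0 te) !mulr0 addr0.
by rewrite !itg0 !subrr mul0r addr0.
Qed.

Lemma primitive_const x y : 1 <= x -> x <= y -> Q y = Q x.
Proof.
move=> x1 xy; rewrite /Q (@itg_split _ 0 y x)//; last by lra.
rewrite [X in _ + X](@itg_eq _ x y _ (fun=> 0)) ?itg0 ?addr0// => s /andP[xs _].
by rewrite /extend0 ifN// negb_and -!ltNge; apply/orP; right; lra.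
Qed.

Lemma N_bounds x0 x1 : 0 <= x0 -> forall x y, x0 <= x -> x <= y -> y <= x1 ->
  [/\ y - x <= N y - N x, `|Q y - Q x| <= N y - N x & `|Q y - Q x| <= N y - N x].
Proof.
move=> x00 x y x0x xy _; have [h1 _] := N_incr ip hN xy.
by have h2 := N_primitive ip hN (le_trans x00 x0x) xy; split.
Qed.

(* For [x >= 1] the solution is outgoing; weakly, [v_x + v_t = 0] at [x = 1]. *)
Lemma outgoing b eps eta r : smooth b -> csupp eps b -> 0 <= eps -> 0 <= r ->
  smooth eta -> csupp r eta -> forall eta1 : R -> R, eta1 = (eta^`())%classic ->
  let X := r + eps + 2 in forall T, X + r + eps + 1 <= T ->
  oint (fun t => mollified_x q u X b 1 t * eta t - v b 1 t * eta1 t) (- T) T = 0.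
Proof.
move=> sb cb eps0 r0 seta ceta eta1 e1 X T XT.
have X1 : 1 <= X by rewrite /X; lra.
have X0 : 0 < X by lra.
have tb := csupp_test_fun1 sb cb.
have sb1 := smooth_derive1 sb; have cb1 := csupp_der cb (smooth_der sb).
have ceta1 : csupp r eta1 by rewrite e1; exact: csupp_der ceta (smooth_der seta).
have Hv := wave_solution_sub ler01 (lexx X) (mollified_wave_solution hu ip hN X0 tb).
have HQ x y : 1 <= x -> x <= y -> y <= X -> Q y = Q x /\ y - x <= N y - N x.
  by move=> x1 xy _; split; [exact: primitive_const|have [] := N_incr ip hN xy].
have Hz := travelling_wave (-1) (csupp_bsmooth seta ceta) (or_introl erefl) ler01 HQ e1.
have TT : - T <= T by lra.
have out x t : 1 <= x -> x <= X -> (t = T \/ t = - T) -> r < `|t + (1 * x + -1)|.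
  by move=> x1 xX [] ->; rewrite ltr_normr; apply/orP; [left|right]; lra.
have bd x : 1 <= x <= X -> v (b^`())%classic x T * eta (T + (1 * x + -1))
    - v b x T * eta1 (T + (1 * x + -1)) - (v (b^`())%classic x (- T) * eta (- T + (1 * x + -1))
    - v b x (- T) * eta1 (- T + (1 * x + -1))) = 0.
  move=> /andP[x1 xX].
  have o1 := out x T x1 xX (or_introl erefl); have o2 := out x (- T) x1 xX (or_intror erefl).
  by rewrite (ceta _ o1) (ceta _ o2) (ceta1 _ o1) (ceta1 _ o2) !mulr0 !subrr.
have := green_const Hv Hz X1 TT (N_bounds ler01) bd (fun _ _ _ _ _ => erefl).
have -> : (fun t => mollified_x q u X b 1 t * eta (t + (1 * 1 + -1)) - v b 1 t * (1 * eta1 (t + (1 * 1 + -1))))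
   = fun t => mollified_x q u X b 1 t * eta t - v b 1 t * eta1 t.
  by apply/funext => t; rewrite !mul1r subrr addr0.
move=> <-; rewrite (_ : (fun t => _) = fun=> 0) ?oint0//; apply/funext => t.
have [te|te] := ltP t (- eps).
  have XX : 0 <= X := ltW X0.
  by rewrite (mollified_x_causal sb cb XX X0 te) (mollified_causal sb cb XX te) !mul0r subrr.
rewrite ceta ?ceta1 ?mulr0 ?subrr//; rewrite ltr_normr; apply/orP; left; rewrite /X; lra.
Qed.

End OneMeasurement.

(** * Finite propagation speed *)

Section FiniteSpeed.
Context {R : realType} (q : R -> R) (u : R -> (R -> R) -> R).
Local Notation p := (extend0 q).
Local Notation v := (mollified u).
Context (hu : causal_solution q u) (ip : forall x y, ig x y p).
Context (N : R -> R) (hN : forall x y, x <= y -> itg x y (fun s => 1 + `|p s|) <= N y - N x).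
Context (b : R -> R) (eps : R) (sb : smooth b) (cb : csupp eps b) (eps0 : 0 <= eps) (eps1 : eps <= 1).
Implicit Types (s t x y : R).

Let tb : test_fun1 b. Proof. exact: csupp_test_fun1 sb cb. Qed.
(** The time window starts before the mollified source acts and ends after the waves used below,
    which are centred at times at most 1. *)
Let a : R := - eps - 1.
Let c : R := 4.
Let ac : a <= c. Proof. by have e0 := eps0; rewrite /a /c; lra. Qed.

Let X2 : (0 : R) < 2. Proof. by []. Qed.
Let Hv := mollified_wave_solution hu ip hN X2 tb.

Let cv x : 0 <= x -> continuous (v b x).
Proof. by move=> x0; exact: mollified_continuous (sol_distribution hu x0) sb cb. Qed.

Let ip_abs x y : ig x y (fun s => `|p s|). Proof. exact: ig_abs. Qed.

Section Averages.
Context (d : R) (d0 : 0 < d) (d1 : d <= 1).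
Let rho := bump d.
Let G := oint rho (- d).
Let srho : smooth rho. Proof. exact: bump_smooth. Qed.
Let crho : continuous rho. Proof. exact: smooth_continuous srho. Qed.
Let cs : csupp d rho. Proof. exact: bump_csupp. Qed.
Let bG : bsmooth G. Proof. exact: bsmooth_primitive. Qed.
Let dG : der G rho. Proof. exact: oint_der. Qed.
Let cG : continuous G. Proof. exact: der_continuous dG. Qed.

Let G0 s : s <= - d -> G s = 0.
Proof.
move=> sd; rewrite /G oint_sym oint_eq0 ?oppr0// => t /andP[_ td].
by apply: cs; rewrite ltr_normr; apply/orP; right; lra.
Qed.

(** Convolutions of [v] in time with a bump and with its primitive, a smoothed Heaviside step; [Y]
    is the primitive of [avg] in [s] that vanishes for early [s]. *)
Let avg x s := oint (fun t => v b x t * rho (s - t)) a c.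
Let Y x s := oint (fun t => v b x t * G (s - t)) a c.

Let vbound : exists2 M, 0 <= M & forall x t, 0 <= x <= 2 -> a <= t <= c -> `|v b x t| <= M.
Proof.
have [K K0 HK] := ws_est Hv (eps + 5); exists K => // x t /andP[x0 x2] /andP[ta tc].
have tT : `|t| <= eps + 5.
  have e0 := eps0.
  by move: ta tc; rewrite /a /c => *; rewrite ler_norml; apply/andP; split; lra.
by have [h _ _ _ _] := HK x x t x0 (lexx x) x2 tT.
Qed.

Let Y_der x : 0 <= x <= 2 -> der (Y x) (avg x).
Proof.
move=> x02 s; have /andP[x0 _] := x02; have [M M0 HM] := vbound.
have [B B0 HB] := bsmooth_taylor bG.
apply: (@is_derive_quad _ _ _ _ (M * B * (c - a))) => h _.
have c1 z : continuous (fun t => v b x t * G (z - t)).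
  by apply: contM; [exact: cv|exact: cont_refl].
have c2 : continuous (fun t => v b x t * rho (s - t)).
  by apply: contM; [exact: cv|exact: cont_refl].
have c3 : continuous (fun t => h * (v b x t * rho (s - t))).
  by apply: contM => //; exact: cont_cst.
rewrite /Y /avg -ointZ// -!ointB//; last exact: contB.
have -> : M * B * (c - a) * h ^+ 2 = M * (B * h ^+ 2) * (c - a) by ring.
apply: oint_abs_le => //; first by apply: contB => //; exact: contB.
move=> t tac; have := HB (s - t) h; rewrite (der_derive1 dG).
have -> : s - t + h = s + h - t by ring.
move=> h1; have := ler_norm_mul (HM x t x02 tac) h1.
by congr (`|_| <= _); ring.
Qed.

Let early x s : 0 <= x -> s <= - eps - 2 * d -> avg x s = 0 /\ Y x s = 0.
Proof.
move=> x0 se; have e0 := eps0; have e1' := eps1. have d0' := d0; have d1' := d1.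
have z t : v b x t * G (s - t) = 0 /\ v b x t * rho (s - t) = 0.
  have [te|te] := ltP t (- eps).
    by rewrite (mollified_causal hu sb cb x0 te) !mul0r.
  rewrite G0; last lra.
  rewrite cs ?mulr0//; rewrite ltr_normr; apply/orP; right; lra.
rewrite /avg /Y; split.
  by rewrite (_ : (fun t => _) = fun=> 0) ?oint0//; apply/funext => t; have [] := z t.
by rewrite (_ : (fun t => _) = fun=> 0) ?oint0//; apply/funext => t; have [] := z t.
Qed.

Let Q x := itg 0 x p.

(* Green's identity against the two waves [G (s - t -+ (x0 - x))], whose kink along
   [x = x0] produces the average at [x0]. *)
Let representation x0 s : x0 <= 1 -> 0 < s + eps + 2 * d -> s + eps + 2 * d <= x0 ->
  [/\ - 2 * avg x0 s = itg (x0 - (s + eps + 2 * d)) x0 (fun x => p x * Y x (s - x0 + x))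
     + itg x0 (x0 + (s + eps + 2 * d)) (fun x => p x * Y x (s + x0 - x)),
    ig (x0 - (s + eps + 2 * d)) x0 (fun x => p x * Y x (s - x0 + x))
    & ig x0 (x0 + (s + eps + 2 * d)) (fun x => p x * Y x (s + x0 - x))].
Proof.
set L := s + eps + 2 * d => x01 L0 Lx0; have e0 := eps0; have e1' := eps1. have d0' := d0; have d1' := d1.
have refG : bsmooth (fun t => G (- t)).
  by have := bsmooth_refl 0 bG; congr bsmooth; apply/funext => t; rewrite sub0r.
have dr : der (fun t => G (- t)) (fun t => - rho t).
  have := der_refl 0 dG; rewrite (_ : (fun t => G (0 - t)) = fun t => G (- t)).
    by move/der_ext; apply => t; rewrite sub0r /rho bump_even.
  by apply/funext => t; rewrite sub0r.
have e1 := esym (der_derive1 dr).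
have HQ0 y0 y1 : forall x y, y0 <= x -> x <= y -> y <= y1 -> (fun=> 0 : R) y = (fun=> 0) x /\ y - x <= N y - N x.
  by move=> x y _ xy _; split=> //; have [] := N_incr ip hN xy.
have hNN y0 y1 : 0 <= y0 -> forall x y, y0 <= x -> x <= y -> y <= y1 ->
    [/\ y - x <= N y - N x, `|Q y - Q x| <= N y - N x & `|0 - 0 : R| <= N y - N x].
  move=> y00 x y y0x xy yy1; have [h1 h2 _] := N_bounds ip hN y00 y0x xy yy1.
  by split=> //; rewrite subrr normr0; apply: le_trans h1; rewrite subr_ge0.
have HQp x y : 0 <= x -> x <= y -> Q y - Q x - (0 - 0) = itg x y p.
  by move=> x0' xy; rewrite /Q (@itg_split _ 0 y x)//; ring.
have Hp x y : x <= y -> itg x y (fun s => `|p s|) <= N y - N x.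
  by move=> xy; have [] := N_incr ip hN xy.
have late z : z <= 1 -> G (z - c) = 0 /\ rho (c - z) = 0.
  move=> z1; split; first by apply: G0; rewrite /c; lra.
  by apply: cs; rewrite ltr_normr; apply/orP; left; rewrite /c; lra.
have va x : 0 <= x -> v b x a = 0 /\ v (b^`())%classic x a = 0.
  move=> x0'; have ae : a < - eps by rewrite /a; lra.
  split; first exact: (mollified_causal hu sb cb).
  exact: (mollified_causal hu (smooth_derive1 sb) (csupp_der cb (smooth_der sb))).
have l0 : 0 <= x0 - L by lra.
have ll : x0 - L <= x0 by lra.
have rr : x0 <= x0 + L by lra.
have r2 : x0 + L <= 2 by lra.
have x00 : 0 <= x0 by lra.
have x02 : x0 <= 2 by lra.
have s1 : s <= 1 by move: Lx0; rewrite /L; lra.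
have HvL := wave_solution_sub l0 x02 Hv.
have HvR := wave_solution_sub x00 r2 Hv.
have HzL := travelling_wave (x0 - s) refG (or_intror erefl) l0 (HQ0 (x0 - L) x0) e1.
have HzR := travelling_wave (- x0 - s) refG (or_introl erefl) x00 (HQ0 x0 (x0 + L)) e1.
have argL x t : - (t + (-1 * x + (x0 - s))) = s - x0 + x - t by ring.
have argR x t : - (t + (1 * x + (- x0 - s))) = s + x0 - x - t by ring.
have bdL x : x0 - L <= x <= x0 -> v (b^`())%classic x c * G (- (c + (-1 * x + (x0 - s))))
    - v b x c * - rho (c + (-1 * x + (x0 - s))) - (v (b^`())%classic x a * G (- (a + (-1 * x + (x0 - s))))
    - v b x a * - rho (a + (-1 * x + (x0 - s)))) = 0.
  move=> /andP[xl xr]; have [-> ->] := va x (le_trans l0 xl).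
  have [g1 g2] := late (s - x0 + x) ltac:(lra).
  rewrite argL g1; have -> : c + (-1 * x + (x0 - s)) = c - (s - x0 + x) by ring.
  by rewrite g2; ring.
have bdR x : x0 <= x <= x0 + L -> v (b^`())%classic x c * G (- (c + (1 * x + (- x0 - s))))
    - v b x c * - rho (c + (1 * x + (- x0 - s))) - (v (b^`())%classic x a * G (- (a + (1 * x + (- x0 - s))))
    - v b x a * - rho (a + (1 * x + (- x0 - s)))) = 0.
  move=> /andP[xl xr]; have [-> ->] := va x (le_trans x00 xl).
  have [g1 g2] := late (s + x0 - x) ltac:(lra).
  rewrite argR g1; have -> : c + (1 * x + (- x0 - s)) = c - (s + x0 - x) by ring.
  by rewrite g2; ring.
have GL := green_source HvL HzL ll ac (hNN _ _ l0) bdL ip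
  (fun x y h1 h2 _ => HQp x y (le_trans l0 h1) h2) (fun x y _ h2 _ => Hp x y h2).
have GR := green_source HvR HzR rr ac (hNN _ _ x00) bdR ip
  (fun x y h1 h2 _ => HQp x y (le_trans x00 h1) h2) (fun x y _ h2 _ => Hp x y h2).
have IL := green_integrable HvL HzL ll ac (hNN _ _ l0) ip (lexx _) (lexx _).
have IR := green_integrable HvR HzR rr ac (hNN _ _ x00) ip (lexx _) (lexx _).
have -> : (fun x => p x * Y x (s - x0 + x)) =
    fun x => p x * oint (fun t => v b x t * G (- (t + (-1 * x + (x0 - s))))) a c.
  by apply/funext => x; congr (_ * oint _ _ _); apply/funext => t; rewrite argL.
have -> : (fun x => p x * Y x (s + x0 - x)) =
    fun x => p x * oint (fun t => v b x t * G (- (t + (1 * x + (- x0 - s))))) a c.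
  by apply/funext => x; congr (_ * oint _ _ _); apply/funext => t; rewrite argR.
split; [|exact: IL|exact: IR].
rewrite -GL -GR.
(* On the outer sides [x0 - L] and [x0 + L] both waves read [G (z - t)] with [z = - eps - 2 d]. They
   are supported in [t <= - eps - d], where [v] vanishes. *)
have zero (x z : R) (e : R) : 0 <= x -> z = - eps - 2 * d -> oint (fun t => mollified_x q u 2 b x t * G (z - t)
    - v b x t * (e * - rho (t - z))) a c = 0.
  move=> x0' zE; rewrite (_ : (fun t => _) = fun=> 0) ?oint0//; apply/funext => t.
  have [te|te] := ltP t (- eps).
    by rewrite (mollified_x_causal hu sb cb x0' X2 te) (mollified_causal hu sb cb x0' te) !mul0r subrr.
  have te' : 0 <= t + eps by rewrite -lerBlDr sub0r.
  have zt : z - t <= - d.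
    have -> : z - t = - d - (t + eps + d) by rewrite zE; ring.
    by rewrite gerBl addr_ge0// ltW.
  have tz : d < `|t - z|.
    apply: lt_le_trans (ler_norm _); have -> : t - z = d + (t + eps + d) by rewrite zE; ring.
    by rewrite ltrDl ltr_wpDl.
  by rewrite (G0 zt) (cs tz) oppr0 !mulr0 subrr.
have -> : oint (fun t => mollified_x q u 2 b (x0 - L) t * G (- (t + (-1 * (x0 - L) + (x0 - s))))
   - v b (x0 - L) t * (-1 * - rho (t + (-1 * (x0 - L) + (x0 - s))))) a c = 0.
  rewrite -[RHS](zero (x0 - L) (- eps - 2 * d) (-1))//; congr oint; apply/funext => t.
  by rewrite argL; congr (_ * G _ - _ * (_ * - rho _)); rewrite /L; ring.
have -> : oint (fun t => mollified_x q u 2 b (x0 + L) t * G (- (t + (1 * (x0 + L) + (- x0 - s))))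
   - v b (x0 + L) t * (1 * - rho (t + (1 * (x0 + L) + (- x0 - s))))) a c = 0.
  rewrite -[RHS](zero (x0 + L) (- eps - 2 * d) 1)//; last exact: le_trans x00 rr.
  congr oint; apply/funext => t.
  by rewrite argR; congr (_ * G _ - _ * (_ * - rho _)); rewrite /L; ring.
rewrite subr0 sub0r.
have cvx := ws_cx HvL (x := x0); have cvx' : continuous (mollified_x q u 2 b x0).
  by apply: cvx; rewrite ll lexx.
have cvx0 := cv x00.
have cG' z : continuous (fun t => G (- (t + z))).
  have -> : (fun t => G (- (t + z))) = fun t => G (- z - t).
    by apply/funext => t; congr G; ring.
  exact: cont_refl.
have crho' z e : continuous (fun t => e * - rho (t + z)).
  by apply: contM; [exact: cont_cst|apply: contN; exact: cont_shift].
(* On the common side [x0] the terms with the derivative of [v] cancel, while the opposite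
   directions of the two waves make the averages add up to the factor [-2]. *)
rewrite -ointB.
- rewrite /avg -ointZ; last by apply: contM => //; exact: cont_refl.
  congr oint; apply/funext => t; rewrite argL argR.
  have -> : t + (-1 * x0 + (x0 - s)) = - (s - t) by ring.
  have -> : t + (1 * x0 + (- x0 - s)) = - (s - t) by ring.
  have -> : s - x0 + x0 - t = s - t by ring.
  have -> : s + x0 - x0 - t = s - t by ring.
  by rewrite /rho bump_even; ring.
- by apply: contB; apply: contM.
- by apply: contB; apply: contM.
Qed.

Let Q2 := itg 0 2 (fun x => `|p x|).
Let kap := Q2 + 1.
Let E s := expR (kap * (s + eps + 2 * d)).

Let Q2_ge0 : 0 <= Q2. Proof. exact: itg_ge0. Qed.
Let kap_gt0 : 0 < kap. Proof. by rewrite ltr_wpDl. Qed.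

Let E_le s s' : s <= s' -> E s <= E s'.
Proof. by move=> ss; rewrite ler_expR ler_wpM2l ?(ltW kap_gt0)//; lra. Qed.

(** [M / kap * E] is a primitive of [M * E] and is nonnegative at the time [- eps - 2 d], where [Y]
    is zero; comparing derivatives gives the bound at later times. *)
Let Y_bound M x : 0 <= M -> 0 <= x <= 1 ->
  (forall s, s + eps + 2 * d <= x -> `|avg x s| <= M * E s) ->
  forall s, s + eps + 2 * d <= x -> `|Y x s| <= M / kap * E s.
Proof.
have e0 := eps0; have e1' := eps1; have d0' := d0; have d1' := d1.
move=> M0 /andP[x0 x1] HM s sx; have ME r : 0 <= M / kap * E r.
  by rewrite mulr_ge0 ?expR_ge0// divr_ge0// ltW.
have [s1|s1] := leP s (- eps - 2 * d).
  by have [_ ->] := early x0 s1; rewrite normr0.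
have x02 : 0 <= x <= 2 by apply/andP; split; lra.
have [_ Y1] := early x0 (lexx (- eps - 2 * d)).
have dE : der (fun r => M / kap * E r) (fun r => M * E r).
  have de : der (fun r => kap * (r + eps + 2 * d)) (fun=> kap).
    have := der_affine kap (kap * (eps + 2 * d)); congr der.
    by apply/funext => r; ring.
  have dexp : der (@expR R) (@expR R) by move=> r; exact: is_derive_expR.
  apply: der_ext (derZ (M / kap) (der_comp dexp de)) _ => r.
  by rewrite /E; field; rewrite gt_eqF.
have dY := Y_der x02.
have Hr r : - eps - 2 * d <= r <= s -> `|avg x r| <= M * E r.
  by move=> /andP[_ rs]; apply: HM; lra.
rewrite ler_norml; apply/andP; split.
  have := der_nondecr (derD dE dY) (ltW s1); rewrite Y1 addr0 => /(_ _)/(le_trans (ME _)) h.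
  have : 0 <= M / kap * E s + Y x s; last lra.
  by apply: h => r /Hr; rewrite ler_norml => /andP[? _]; lra.
have := der_nondecr (derB dE dY) (ltW s1); rewrite Y1 subr0 => /(_ _)/(le_trans (ME _)) h.
have : 0 <= M / kap * E s - Y x s; last lra.
by apply: h => r /Hr; rewrite ler_norml => /andP[_ ?]; lra.
Qed.

(** The characteristics in the representation stay in the region [s + eps + 2 d <= x], and beyond
    [x = 1] the potential vanishes. So [2 |avg|] is at most [M E] times [Q2 / kap], a ratio below
    1. *)
Let halve M : 0 <= M ->
  (forall x s, 0 <= x <= 1 -> s + eps + 2 * d <= x -> `|avg x s| <= M * E s) ->
  forall x s, 0 <= x <= 1 -> s + eps + 2 * d <= x -> `|avg x s| <= M / 2 * E s.
Proof.
have e0 := eps0; have e1' := eps1; have d0' := d0; have d1' := d1.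
move=> M0 HM x s /andP[x0 x1] sx.
have ME r : 0 <= M / kap * E r.
  by rewrite mulr_ge0 ?expR_ge0// divr_ge0// ltW.
have [s1|s1] := leP (s + eps + 2 * d) 0.
  have [|-> _] := @early x s x0; first lra.
  by rewrite normr0 mulr_ge0 ?expR_ge0// divr_ge0.
have [rep IL IR] := representation x1 s1 sx; move: rep IL IR.
set L := s + eps + 2 * d => rep IL IR.
have Lx : L <= x by [].
have L0 : 0 < L by [].
have sL : s + eps + 2 * d = L by [].
have YB y r : 0 <= y <= 1 -> r + eps + 2 * d <= y -> r <= s -> `|Y y r| <= M / kap * E s.
  move=> y01 ry rs; apply: (@le_trans _ _ (M / kap * E r)).
    by apply: Y_bound => // z; exact: HM.
  by rewrite ler_wpM2l ?E_le// divr_ge0// ltW.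
have bl : `|itg (x - L) x (fun y => p y * Y y (s - x + y))|
    <= itg (x - L) x (fun y => (M / kap * E s) * `|p y|).
  apply: itg_bound => //; first exact: igZ.
  move=> y /andP[yl yx]; rewrite mulrC; apply: ler_norm_mul => //.
  apply: YB; [by apply/andP; split; lra|lra|lra].
have br : `|itg x (x + L) (fun y => p y * Y y (s + x - y))|
    <= itg x (x + L) (fun y => (M / kap * E s) * `|p y|).
  apply: itg_bound => //; first exact: igZ.
  move=> y /andP[xy yl]; have [y1|y1] := leP y 1; last first.
    by rewrite /extend0 ifN ?mul0r ?normr0 ?mulr0// negb_and -!ltNge y1 orbT.
  rewrite mulrC; apply: ler_norm_mul => //.
  apply: YB; [by apply/andP; split; lra|lra|lra].
have tot : itg (x - L) x (fun y => `|p y|) + itg x (x + L) (fun y => `|p y|) <= Q2.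
  have pos y z : 0 <= itg y z (fun y => `|p y|) by exact: itg_ge0.
  rewrite /Q2 (@itg_split _ 0 2 x)//; last lra.
  rewrite (@itg_split _ 0 x (x - L))//; [|lra|lra].
  rewrite (@itg_split _ x 2 (x + L))//; [|lra|lra].
  by have := pos 0 (x - L); have := pos (x + L) 2; lra.
have fin : (M / kap * E s) * Q2 <= M * E s.
  rewrite mulrAC mulrAC -[leRHS]mulr1 -!mulrA; apply: ler_wpM2l => //.
  rewrite mulrCA ler_wpM2l ?expR_ge0// mulrC ler_pdivrMr// mul1r /kap; lra.
have : `|-2 * avg x s| <= M * E s.
  rewrite rep; apply: (le_trans (ler_normD _ _)); apply: (le_trans (lerD bl br)).
  rewrite !itgZ// -mulrDr; apply: le_trans fin; exact: ler_wpM2l.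
rewrite normrM normrN (@ger0_norm _ 2)// => h.
have -> : M / 2 * E s = M * E s / 2 by ring.
by rewrite ler_pdivlMr// mulrC.
Qed.

(** Repeated halving of the crude bound [K]. *)
Let avg_eq0 x s : 0 <= x <= 1 -> s + eps + 2 * d <= x -> avg x s = 0.
Proof.
have e0 := eps0; have e1' := eps1; have d0' := d0; have d1' := d1.
move=> x01 sx; have [M M0 HM] := vbound; have [B B0 HB] := continuous_bounded d crho.
have HB' t : `|rho t| <= B by have [/HB//|/cs ->] := leP `|t| d; rewrite normr0.
pose K := M * B * (c - a); have K0 : 0 <= K by rewrite !mulr_ge0// subr_ge0.
have H n : forall x s, 0 <= x <= 1 -> s + eps + 2 * d <= x -> `|avg x s| <= K * 2^-1 ^+ n * E s.
  elim: n => [|n IH] {x01 sx}x {}s x01 sx; last first.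
    rewrite exprSr mulrA; apply: (@halve (K * 2^-1 ^+ n)) => //.
    by rewrite mulr_ge0// exprn_ge0// invr_ge0.
  have /andP[x0 x1] := x01; rewrite expr0 mulr1.
  have [s1|s1] := leP s (- eps - 2 * d).
    by have [-> _] := early x0 s1; rewrite normr0 mulr_ge0// expR_ge0.
  apply: (@le_trans _ _ K); last first.
    rewrite -[leLHS]mulr1 ler_wpM2l//; apply: le_trans (expR_ge1Dx _).
    rewrite lerDl mulr_ge0 ?(ltW kap_gt0)//; lra.
  apply: oint_abs_le => //; first by apply: contM; [exact: cv|exact: cont_refl].
  move=> t tac; apply: ler_norm_mul => //; apply: HM => //.
  by apply/andP; split; lra.
apply/eqP; rewrite -normr_le0; apply: (@le_geo _ _ _ (K * E s) 2^-1); rewrite ?invr_ge0// => n.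
by rewrite add0r mulrAC; exact: H.
Qed.

Lemma bump_average_eq0 x s : 0 <= x <= 1 -> s + eps + 2 * d <= x -> a <= s - d -> s + d <= c ->
  oint (fun t => bump d t * v b x (s - t)) (- d) d = 0.
Proof.
have e0 := eps0; have e1' := eps1; have d0' := d0; have d1' := d1.
move=> x01 sx l r; have := avg_eq0 x01 sx; rewrite /avg => <-; have /andP[x0 _] := x01.
have cf : continuous (fun t => v b x t * rho (s - t)).
  by apply: contM; [exact: cv|exact: cont_refl].
rewrite (@oint_supp _ _ (s - d) (s + d) a c)//; last 3 first.
- lra.
- by move=> t ts; rewrite cs ?mulr0// ltr_normr; apply/orP; left; lra.
- by move=> t ts; rewrite cs ?mulr0// ltr_normr; apply/orP; right; lra.
have := @oint_refl _ (fun t => v b x t * rho (s - t)) s (- d) d cf.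
rewrite opprK => <-; congr oint; apply/funext => t.
by rewrite mulrC; congr (_ * bump d _); ring.
Qed.

End Averages.

Lemma finite_speed x t : 0 <= x <= 1 -> t + eps < x -> v b x t = 0.
Proof.
move=> x01 tx; have /andP[x0 x1] := x01; have e0 := eps0; have e1 := eps1.
have [te|te] := ltP t (- eps); first exact: (mollified_causal hu sb cb).
(* Every radius [d] below [r0] satisfies [t + eps + 2 d <= x], the range in which the averages
   vanish. *)
pose r0 := Num.min 1 ((x - t - eps) / 2).
have r00 : 0 < r0 by rewrite lt_min ltr01; lra.
have r01 : r0 <= 1 by rewrite ge_min lexx.
have r02 : r0 <= (x - t - eps) / 2 by rewrite ge_min lexx orbT.
apply: (bump_oint_eq0 r00 (cv x0)) => r /andP[rp rr].
apply: bump_average_eq0 => //; rewrite ?/a ?/c; lra.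
Qed.

End FiniteSpeed.

(** * The response at [x = 1] *)

Section LipschitzKernels.
Context {R : realType}.
Implicit Types (f g : R -> R) (K : R -> R -> R).

Lemma lip2_fst f : lip1 f -> lip2 (fun x y => f x).
Proof.
move=> H T; have [L HL] := H T; exists `|L| => x y x' y' xT _ x'T _.
apply: (le_trans (HL _ _ xT x'T)); apply: (le_trans (ler_wpM2r _ (ler_norm L))) => //.
by rewrite ler_wpM2l// lerDl.
Qed.

Lemma lip2_sub f : lip1 f -> lip2 (fun x y => f (y - x)).
Proof.
move=> H T; have [L HL] := H (T + T); exists `|L| => x y x' y' xT yT x'T y'T.
have b (z z' : R) : `|z| <= T -> `|z'| <= T -> `|z - z'| <= T + T.
  by move=> *; apply: (le_trans (ler_normB _ _)); exact: lerD.
have h := HL _ _ (b _ _ yT xT) (b _ _ y'T x'T); rewrite /=; apply: le_trans h _.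
apply: (le_trans (ler_wpM2r _ (ler_norm L))) => //; rewrite ler_wpM2l//.
have -> : y - x - (y' - x') = (y - y') - (x - x') by ring.
by apply: (le_trans (ler_normB _ _)); rewrite addrC.
Qed.

Lemma lip2_bounded K T : lip2 K -> exists2 M, 0 <= M & forall x y, `|x| <= T -> `|y| <= T -> `|K x y| <= M.
Proof.
move=> H; have [L HL] := H `|T|; exists (`|K 0 0| + `|L| * (`|T| + `|T|)).
  by rewrite addr_ge0// mulr_ge0// addr_ge0.
move=> x y xT yT; have TT := ler_norm T; have xT' := le_trans xT TT; have yT' := le_trans yT TT.
have -> : K x y = K 0 0 + (K x y - K 0 0) by ring.
apply: (le_trans (ler_normD _ _)); rewrite lerD2l.
apply: (le_trans (HL _ _ _ _ xT' yT' _ _)); rewrite ?normr0// !subr0.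
apply: (le_trans (ler_wpM2r _ (ler_norm L))); first exact: addr_ge0.
by rewrite ler_wpM2l// lerD.
Qed.

Lemma lip2M K K' : lip2 K -> lip2 K' -> lip2 (fun x y => K x y * K' x y).
Proof.
move=> H H' T; have [L HL] := H T; have [L' HL'] := H' T.
have [M M0 HM] := lip2_bounded T H; have [M' M'0 HM'] := lip2_bounded T H'.
exists (L * M' + M * L') => x y x' y' xT yT x'T y'T.
have -> : K x y * K' x y - K x' y' * K' x' y' = (K x y - K x' y') * K' x y + K x' y' * (K' x y - K' x' y').
  by ring.
have -> : (L * M' + M * L') * (`|x - x'| + `|y - y'|) = L * (`|x - x'| + `|y - y'|) * M'
  + M * (L' * (`|x - x'| + `|y - y'|)) by ring.
apply: (le_trans (ler_normD _ _)); apply: lerD; apply: ler_norm_mul.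
- exact: HL.
- exact: HM'.
- exact: HM.
- exact: HL'.
Qed.

Lemma lip1_refl f s : lip1 f -> lip1 (fun t => f (s - t)).
Proof.
move=> H T; have [L HL] := H (`|s| + T); exists L => x y xT yT.
have b (z : R) : `|z| <= T -> `|s - z| <= `|s| + T.
  by move=> zT; apply: (le_trans (ler_normB _ _)); rewrite lerD2l.
apply: (le_trans (HL _ _ (b _ xT) (b _ yT))).
have -> : s - x - (s - y) = y - x by ring.
by rewrite distrC.
Qed.

Lemma lip1D f g : lip1 f -> lip1 g -> lip1 (fun t => f t + g t).
Proof.
move=> H H' T; have [L HL] := H T; have [L' HL'] := H' T; exists (L + L') => x y xT yT.
have -> : f x + g x - (f y + g y) = (f x - f y) + (g x - g y) by ring.
by rewrite mulrDl; apply: (le_trans (ler_normD _ _)); apply: lerD; [exact: HL|exact: HL'].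
Qed.

Lemma lip1N f : lip1 f -> lip1 (fun t => - f t).
Proof.
move=> H T; have [L HL] := H T; exists L => x y xT yT.
by rewrite -opprD normrN; exact: HL.
Qed.

Lemma smooth_lip1 f : smooth f -> lip1 f.
Proof.
move=> sf; apply: (der_lip1 (smooth_der sf)) => T.
by have [M _ HM] := continuous_bounded T (smooth_continuous (smooth_derive1 sf)); exists M.
Qed.

(* Associativity and commutativity of convolution, for one causal and two compactly
   supported factors: [A * F = b * g] and [A * D = 0] give [b * (g * D) = 0]. *)
Lemma convolution_cancel (A F D b g : R -> R) (eps rF rD rb : R) :
  lip1 A -> lip1 F -> lip1 D -> lip1 b -> lip1 g ->
  0 <= eps -> 0 <= rF -> 0 <= rD -> 0 <= rb -> csupp rF F -> csupp rD D -> csupp rb g ->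
  csupp eps b ->
  (forall s T, eps + `|s| + rF <= T ->
    oint (fun t => A t * F (s - t)) (- T) T = oint (fun t => b t * g (s - t)) (- T) T) ->
  (forall s T, eps + `|s| + rD <= T -> oint (fun t => A t * D (s - t)) (- T) T = 0) ->
  forall s, oint (fun t => b t * oint (fun r => g r * D (s - t - r)) (- rb) rb) (- eps) eps = 0.
Proof.
move=> lA lF lD lb lg e0 F0 D0 rb0 sF sD sg sb HF HD s.
have cA := lip1_continuous lA; have cF := lip1_continuous lF; have cD := lip1_continuous lD.
have cb := lip1_continuous lb; have cg := lip1_continuous lg.
(* [A] may be supported on a half line, so windows are fixed: [Z] contains the supports in [z] for
   the times in play after truncation, and [T] is admissible in both hypotheses at every point
   reached. *)
pose Z := `|s| + rD + rF + rb + eps; pose T := eps + Z + rF + rD.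
have s0 := normr_ge0 s.
have Z0 : 0 <= Z by rewrite /Z; lra.
have ZZ : - Z <= Z by lra.
have TT : - T <= T by rewrite /T; lra.
have lDs := lip1_refl s lD.
have K1 : lip2 (fun t z => A t * F (z - t) * D (s - z)).
  by apply: lip2M; [apply: lip2M; [exact: lip2_fst|exact: lip2_sub]|exact: lip2_sym (lip2_fst lDs)].
have K2 : lip2 (fun t z => b t * g (z - t) * D (s - z)).
  by apply: lip2M; [apply: lip2M; [exact: lip2_fst|exact: lip2_sub]|exact: lip2_sym (lip2_fst lDs)].
have K3 : lip2 (fun t r => A t * D (r - t) * F (s - r)).
  by apply: lip2M; [apply: lip2M; [exact: lip2_fst|exact: lip2_sub]|exact: lip2_sym (lip2_fst (lip1_refl s lF))].
(* [I] is the triple convolution of [A], [F] and [D] at [s]. A reflection exchanges [F] and [D], and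
   then [A * D = 0] makes it vanish; integrating in [t] before [z] replaces [A * F] by [b * g]. *)
pose I := oint (fun t => oint (fun z => A t * F (z - t) * D (s - z)) (- Z) Z) (- T) T.
have I0 : I = 0.
  rewrite /I.
  have -> : (fun t => oint (fun z => A t * F (z - t) * D (s - z)) (- Z) Z)
     = fun t => oint (fun r => A t * D (r - t) * F (s - r)) (- T) T.
    apply/funext => t.
    have e1 : oint (fun z => A t * F (z - t) * D (s - z)) (- Z) Z
        = A t * oint (fun z => F (z - t) * D (s - z)) (s - rD) (s + rD).
      rewrite -ointZ; last by apply: contM; [exact: cont_shift|exact: cont_refl].
      have -> : (fun z => A t * (F (z - t) * D (s - z))) = fun z => A t * F (z - t) * D (s - z).
        by apply/funext => z; rewrite mulrA.
      apply: oint_supp; rewrite /Z.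
      - by apply: contM; [apply: contM; [exact: cont_cst|exact: cont_shift]|exact: cont_refl].
      - have := ler_norm (- s); rewrite normrN; lra.
      - lra.
      - have := ler_norm s; lra.
      - by move=> z zs; rewrite sD ?mulr0// ltr_normr; apply/orP; left; lra.
      - by move=> z zs; rewrite sD ?mulr0// ltr_normr; apply/orP; right; lra.
    have e2 : oint (fun r => A t * D (r - t) * F (s - r)) (- T) T
        = A t * oint (fun r => D (r - t) * F (s - r)) (s - rF) (s + rF).
      rewrite -ointZ; last by apply: contM; [exact: cont_shift|exact: cont_refl].
      have -> : (fun z => A t * (D (z - t) * F (s - z))) = fun z => A t * D (z - t) * F (s - z).
        by apply/funext => z; rewrite mulrA.
      apply: oint_supp; rewrite /T /Z.
      - by apply: contM; [apply: contM; [exact: cont_cst|exact: cont_shift]|exact: cont_refl].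
      - have := ler_norm (- s); rewrite normrN; lra.
      - lra.
      - have := ler_norm s; lra.
      - by move=> z zs; rewrite sF ?mulr0// ltr_normr; apply/orP; left; lra.
      - by move=> z zs; rewrite sF ?mulr0// ltr_normr; apply/orP; right; lra.
    rewrite e1 e2; congr (_ * _).
    pose M := `|s| + `|t| + rD + rF.
    have cFD : continuous (fun z => F (z - t) * D (s - z)).
      by apply: contM; [exact: cont_shift|exact: cont_refl].
    have cDF : continuous (fun r => D (r - t) * F (s - r)).
      by apply: contM; [exact: cont_shift|exact: cont_refl].
    have := ler_norm (- s); have := ler_norm s; have := ler_norm t; have := ler_norm (- t).
    rewrite !normrN => h1 h2 h3 h4; have t0 := normr_ge0 t.
    have -> : oint (fun z => F (z - t) * D (s - z)) (s - rD) (s + rD)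
       = oint (fun z => F (z - t) * D (s - z)) (s + t - M) (s + t + M).
      apply/esym; apply: oint_supp => //; rewrite /M; [lra|lra|lra| |].
      - by move=> z zs; rewrite [D _]sD ?mulr0// ltr_normr; apply/orP; left; lra.
      - by move=> z zs; rewrite [D _]sD ?mulr0// ltr_normr; apply/orP; right; lra.
    have -> : oint (fun r => D (r - t) * F (s - r)) (s - rF) (s + rF)
       = oint (fun r => D (r - t) * F (s - r)) (- M) M.
      apply/esym; apply: oint_supp => //; rewrite /M; [lra|lra|lra| |].
      - by move=> z zs; rewrite [F _]sF ?mulr0// ltr_normr; apply/orP; left; lra.
      - by move=> z zs; rewrite [F _]sF ?mulr0// ltr_normr; apply/orP; right; lra.
    have := @oint_refl _ (fun z => F (z - t) * D (s - z)) (s + t) (- M) M cFD.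
    rewrite opprK => <-; congr oint; apply/funext => r.
    by rewrite mulrC; congr (D _ * F _); ring.
  rewrite oint_swap//.
  rewrite (_ : (fun y => _) = fun=> 0) ?oint0//; apply/funext => r.
  have [rs|rs] := leP `|s - r| rF; last first.
    rewrite (_ : (fun t => _) = fun=> 0) ?oint0//; apply/funext => t.
    by rewrite sF// mulr0.
  have -> : (fun t => A t * D (r - t) * F (s - r)) = fun t => F (s - r) * (A t * D (r - t)).
    by apply/funext => t; ring.
  rewrite ointZ; last by apply: contM => //; exact: cont_refl.
  rewrite HD ?mulr0// /T /Z.
  have : `|r| <= `|s| + rF; last lra.
  have -> : r = s - (s - r) by ring.
  by apply: (le_trans (ler_normB _ _)); rewrite lerD2l.
have I1 : I = oint (fun t => oint (fun z => b t * g (z - t) * D (s - z)) (- Z) Z) (- T) T.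
  rewrite /I oint_swap// [RHS]oint_swap//; congr oint; apply/funext => z.
  have [sz|sz] := leP `|s - z| rD; last first.
    by congr oint; apply/funext => t; rewrite sD// !mulr0.
  have -> : (fun t => A t * F (z - t) * D (s - z)) = fun t => D (s - z) * (A t * F (z - t)).
    by apply/funext => t; ring.
  have -> : (fun t => b t * g (z - t) * D (s - z)) = fun t => D (s - z) * (b t * g (z - t)).
    by apply/funext => t; ring.
  rewrite !ointZ; [|by apply: contM => //; exact: cont_refl..].
  rewrite HF// /T /Z.
  have : `|z| <= `|s| + rD; last lra.
  have -> : z = s - (s - z) by ring.
  by apply: (le_trans (ler_normB _ _)); rewrite lerD2l.
rewrite -[RHS]I0 I1.
have cin : continuous (fun t => oint (fun z => b t * g (z - t) * D (s - z)) (- Z) Z).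
  by apply: lip1_continuous; exact: lip2_oint.
rewrite [RHS](@oint_supp _ _ (- eps) eps)//; last 5 first.
- by rewrite /T; lra.
- lra.
- by rewrite /T; lra.
- move=> t te; rewrite (_ : (fun z => _) = fun=> 0) ?oint0//; apply/funext => z.
  by rewrite sb ?mul0r// ltr_normr; apply/orP; right; lra.
- move=> t te; rewrite (_ : (fun z => _) = fun=> 0) ?oint0//; apply/funext => z.
  by rewrite sb ?mul0r// ltr_normr; apply/orP; left.
have inner t : `|t| <= eps -> oint (fun z => b t * g (z - t) * D (s - z)) (- Z) Z
    = b t * oint (fun r => g r * D (s - t - r)) (- rb) rb.
  rewrite ler_norml => /andP[t1 t2].
  rewrite -ointZ; last by apply: contM => //; exact: cont_refl.
  have cc : continuous (fun z => b t * g (z - t) * D (s - z)).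
    by apply: contM; [apply: contM; [exact: cont_cst|exact: cont_shift]|exact: cont_refl].
  rewrite (@oint_supp _ _ (- rb + t) (rb + t))//; rewrite /Z; [|lra|lra|lra| |].
  - rewrite -[LHS](@oint_shift _ (fun z => b t * g (z - t) * D (s - z)) t (- rb) rb cc).
    congr oint; apply/funext => r; rewrite -mulrA; congr (_ * (g _ * D _)); ring.
  - by move=> z zt; rewrite sg ?mulr0 ?mul0r// ltr_normr; apply/orP; right; lra.
  - by move=> z zt; rewrite sg ?mulr0 ?mul0r// ltr_normr; apply/orP; left; lra.
apply/esym; apply: oint_eq => //.
  have e : forall t, `|t| <= eps -> b t * oint (fun r => g r * D (s - t - r)) (- rb) rb =
    oint (fun z => b t * g (z - t) * D (s - z)) (- Z) Z by move=> t /inner.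
  have -> : (fun t => b t * oint (fun r => g r * D (s - t - r)) (- rb) rb) =
      fun t => oint (fun z => b t * g (z - t) * D (s - z)) (- Z) Z.
    apply/funext => t; have [/e//|te] := leP `|t| eps.
    rewrite sb// mul0r (_ : (fun z => _) = fun=> 0) ?oint0//; apply/funext => z.
    by rewrite !mul0r.
  exact: cin.
- lra.
- by move=> t tr; apply: inner; rewrite ler_norml.
Qed.

End LipschitzKernels.

(** * The convolution identity for the response *)

Section Response.
Context {R : realType}.
Implicit Types (p gam b : R -> R) (s t x T r eps : R).

Lemma regular_smooth p gam x : (forall x y, ig x y p) -> bsmooth gam -> 0 <= x <= 1 ->
  smooth (regular p gam x).
Proof.
move=> ip bg x01; apply: (@smooth_class _ [set f | exists2 gam, bsmooth gam & f = regular p gam x]);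
  last by exists gam.
move=> _ [g sg ->]; exists (regular p (g^`())%classic x); last exact: regular_der.
by exists (g^`())%classic => //; exact: bsmooth_derive1.
Qed.

(* The trace at [x = 1] of [w_x + w_t] for the regular solution [w] with [w_x(0, .) = gam]. *)
Definition response p gam t := regular p (gam^`())%classic 1 t + regular_x p gam 1 t.

Let one01 : (0 : R) <= 1 <= (1 : R). Proof. by rewrite ler01 lexx. Qed.

Lemma response_lip1 p gam : (forall x y, ig x y p) -> bsmooth gam -> lip1 (response p gam).
Proof.
move=> ip bg; apply: lip1D; last exact: regular_x_lip1.
by apply: smooth_lip1; apply: regular_smooth => //; exact: bsmooth_derive1.
Qed.

Lemma response_supp p gam r : (forall x y, ig x y p) -> smooth gam -> csupp r gam ->
  csupp (1 + r) (response p gam).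
Proof.
move=> ip sg cg t rt; have bg := csupp_bsmooth sg cg; rewrite /response.
rewrite (regular_supp ip (bsmooth_derive1 bg) (csupp_der cg (smooth_der sg)) one01 rt).
by rewrite (regular_x_supp ip bg cg one01 rt) addr0.
Qed.

(** Green's identity on [[0, 1]] between [v] and the regular solution reflected in time. At [x = 0]
    the latter vanishes and [v = b], which leaves [b * gam]; at [x = 1] the outgoing condition
    trades [v_x] for a time derivative of the other factor. *)
Lemma response_identity (q : R -> R) (u : R -> (R -> R) -> R) (N : R -> R) b gam c eps r s T :
  causal_solution q u -> (forall x y, ig x y (extend0 q)) ->
  (forall x y, x <= y -> itg x y (fun s => 1 + `|extend0 q s|) <= N y - N x) ->
  smooth b -> csupp eps b -> 0 <= eps ->
  bsmooth c -> gam = (c^`())%classic -> csupp r gam -> 0 <= r ->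
  eps + `|s| + (1 + r) <= T ->
  oint (fun t => mollified u b 1 t * response (extend0 q) gam (s - t)) (- T) T
    = oint (fun t => b t * gam (s - t)) (- T) T.
Proof.
move=> hu ip hN sb cb eps0 bc gamE cg r0 epsT; set p := extend0 q in ip *.
have bg : bsmooth gam by rewrite gamE; exact: bsmooth_derive1.
have sg := bsmooth_smooth bg; have tb := csupp_test_fun1 sb cb.
pose gam1 := (gam^`())%classic; have cg1 : csupp r gam1 := csupp_der cg (smooth_der sg).
have bg1 : bsmooth gam1 := bsmooth_derive1 bg.
have s0 := normr_ge0 s; have ss := ler_norm s; have ss' := ler_norm (- s); rewrite normrN in ss'.
pose r' := 1 + r + `|s|; have r'0 : 0 <= r' by rewrite /r'; lra.
pose X := r' + eps + 2; have X1 : 1 <= X by rewrite /X; lra.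
have X0 : 0 < X by lra.
(* A window large enough for [outgoing]; causality of [v] and the supports of [gam] and of the
   response bring it back to [T] at the end. *)
pose T1 := T + (X + r' + eps + 1); have TT1 : T <= T1 by rewrite /T1 /X; lra.
have Hv := wave_solution_sub (lexx 0) X1 (mollified_wave_solution hu ip hN X0 tb).
have Hz := wave_solution_refl s (regular_wave_solution ip hN bc gamE (erefl gam1)).
have T1T1 : - T1 <= T1 by lra.
have far t : 1 + r < `|s - t| -> regular p gam 1 (s - t) = 0 by exact: regular_supp.
have out x t : 0 <= x <= 1 -> (t = T1 \/ t = - T1) ->
    regular p gam x (s - t) = 0 /\ regular p gam1 x (s - t) = 0.
  move=> x01 tT; have /andP[_ x1] := x01.
  suff h : x + r < `|s - t| by split; exact: regular_supp h.
  rewrite ltr_normr; have := TT1; rewrite /T1 /X /r' => TT; apply/orP.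
  by case: tT => ->; rewrite /T1 /X /r'; [right|left]; lra.
have bd x : 0 <= x <= 1 -> mollified u (b^`())%classic x T1 * regular p gam x (s - T1)
    - mollified u b x T1 * - regular p gam1 x (s - T1)
    - (mollified u (b^`())%classic x (- T1) * regular p gam x (s - - T1)
    - mollified u b x (- T1) * - regular p gam1 x (s - - T1)) = 0.
  move=> x01; have [-> ->] := out x T1 x01 (or_introl erefl).
  by have [-> ->] := out x (- T1) x01 (or_intror erefl); rewrite oppr0 !mulr0 !subrr.
have := green_const Hv Hz ler01 T1T1 (N_bounds ip hN (lexx 0)) bd (fun _ _ _ _ _ => erefl).
have -> : (fun t => mollified_x q u X b 0 t * regular p gam 0 (s - t)
     - mollified u b 0 t * regular_x p gam 0 (s - t)) = fun t => - (b t * gam (s - t)).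
  apply/funext => t; rewrite (regular_0 ip _ bg) regular_x_0 (mollified_boundary hu t tb).
  by rewrite mulr0 sub0r.
have cgr : continuous (fun t => gam (s - t)) by apply: cont_refl; exact: smooth_continuous.
have cR : continuous (fun t => response p gam (s - t)).
  by apply: cont_refl; apply: lip1_continuous; exact: response_lip1.
have cA : continuous (mollified u b 1) := der_continuous (ws_t Hv one01).
have cAx : continuous (mollified_x q u X b 1) := ws_cx Hv one01.
have cb0 : continuous b by exact: smooth_continuous.
rewrite ointN; last by exact: contM.
pose eta t := regular p gam 1 (s - t); pose eta1 t := - regular p gam1 1 (s - t).
have seta : smooth eta by apply: smooth_refl; exact: regular_smooth.
have deta : der eta eta1 by apply: der_refl; exact: regular_der.
have ceta : csupp r' eta.
  move=> t rt; apply: far; have := lerB_dist t s; rewrite (distrC t).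
  by move: rt; rewrite /r'; lra.
have XT1 : X + r' + eps + 1 <= T1 by rewrite /T1; lra.
have := outgoing hu ip hN sb cb eps0 r'0 seta ceta (esym (der_derive1 deta)) XT1.
rewrite -/X => out0 W.
have ceta0 : continuous eta by exact: smooth_continuous.
have ceta1 : continuous eta1.
  by rewrite -(der_derive1 deta); apply: smooth_continuous; exact: smooth_derive1.
have crx : continuous (fun t => regular_x p gam 1 (s - t)).
  by apply: cont_refl; apply: lip1_continuous; exact: regular_x_lip1.
have E1 : oint (fun t => mollified u b 1 t * response p gam (s - t)) (- T1) T1
    = oint (fun t => b t * gam (s - t)) (- T1) T1.
  apply: oppr_inj; rewrite -W -[RHS]subr0 -[X in _ - X]out0 -ointB; last 2 first.
  - by apply: contB; exact: contM.
  - by apply: contB; exact: contM.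
  rewrite -ointN; last by exact: contM.
  congr (oint _ _ _); apply/funext => t; rewrite /response /eta1 /eta -/gam1; ring.
have cut (f g : R -> R) : continuous f -> continuous g -> csupp (1 + r) g -> (forall t, t < - eps -> f t = 0) ->
    oint (fun t => f t * g (s - t)) (- T1) T1 = oint (fun t => f t * g (s - t)) (- T) T.
  move=> cf cgg sgg f0; apply: oint_supp; [|lra|lra|lra| |].
  - by apply: contM => //; exact: cont_refl.
  - by move=> t tT; rewrite f0 ?mul0r//; lra.
  - by move=> t tT; rewrite sgg ?mulr0// ltr_normr; apply/orP; right; lra.
have cg' : csupp (1 + r) gam by apply: csuppW cg; lra.
rewrite -!cut//.
- exact: smooth_continuous.
- by move=> t te; apply: cb; rewrite ltr_normr; apply/orP; right; lra.
- by apply: lip1_continuous; exact: response_lip1.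
- exact: response_supp.
- by move=> t te; apply: (mollified_causal hu sb cb ler01 te).
Qed.

End Response.

(** * Equal data give equal responses *)

Section SameData.
Context {R : realType} (q1 q2 : R -> R) (u1 u2 : R -> (R -> R) -> R).
Context (hu1 : causal_solution q1 u1) (hu2 : causal_solution q2 u2).
Context (ip1 : forall x y, ig x y (extend0 q1)) (ip2 : forall x y, ig x y (extend0 q2)).
Context (N : R -> R).
Context (hN1 : forall x y, x <= y -> itg x y (fun s => 1 + `|extend0 q1 s|) <= N y - N x).
Context (hN2 : forall x y, x <= y -> itg x y (fun s => 1 + `|extend0 q2 s|) <= N y - N x).
Context (ha : eq_distr_on `]0, +oo[ (u1 1) (u2 1)).
Implicit Types (b g gam : R -> R) (s t r eps : R).

(** For [t > eps] the function [b (t - s)] of [s] is supported in positive times, where the data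
    agree. For [t <= eps] both sides vanish by finite speed, since [eps <= 1/4] gives
    [t + eps < 1]. *)
Lemma trace_eq b eps t : smooth b -> csupp eps b -> 0 <= eps -> eps <= 4^-1 ->
  mollified u1 b 1 t = mollified u2 b 1 t.
Proof.
move=> sb cb eps0 eps4; have one01 : (0 : R) <= 1 <= (1 : R) by rewrite ler01 lexx.
have e1 : eps <= 1 by apply: (le_trans eps4); lra.
have [te|te] := leP t eps.
  have te1 : t + eps < 1 by lra.
  by rewrite (finite_speed hu1 ip1 hN1 sb cb eps0 e1 one01 te1)
    (finite_speed hu2 ip2 hN2 sb cb eps0 e1 one01 te1).
apply: ha; first exact: csupp_test_fun1 (smooth_refl t sb) (csupp_refl cb).
have cl : closed [set s : R | t - eps <= s] by exact: closed_ge.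
move=> s /(@closure_subset _ _ [set s : R | t - eps <= s]) h.
have : closure [set s : R | t - eps <= s] s.
  apply: h => z /= /eqP bz; rewrite leNgt; apply/negP => zt; apply: bz; apply: cb.
  by rewrite ltr_normr; apply/orP; left; lra.
by rewrite -((closure_id _).1 cl) /= in_itv/= andbT; lra.
Qed.

Lemma mollified_smooth q u b r x : causal_solution q u -> 0 <= x -> smooth b -> csupp r b ->
  smooth (mollified u b x).
Proof.
move=> hu x0 sb cb.
apply: (@smooth_class _ [set f | exists2 b, smooth b /\ csupp r b & f = mollified u b x]);
  last by exists b.
move=> _ [g [sg cg] ->]; exists (mollified u (g^`())%classic x).
  by exists (g^`())%classic => //; split; [exact: smooth_derive1|exact: csupp_der (smooth_der sg)].
exact: mollified_der (sol_distribution hu x0) sg cg.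
Qed.

Lemma response_eq gam r s : smooth gam -> csupp r gam -> 0 <= r ->
  response (extend0 q1) gam s = response (extend0 q2) gam s.
Proof.
move=> sg cg r0; have bg := csupp_bsmooth sg cg.
pose D t := response (extend0 q1) gam t - response (extend0 q2) gam t.
have lD : lip1 D by apply: lip1D; [|apply: lip1N]; exact: response_lip1.
have cD : csupp (1 + r) D.
  by move=> t rt; rewrite /D (response_supp ip1 sg cg rt) (response_supp ip2 sg cg rt) subrr.
suff H rb : 0 < rb -> rb < 1 -> forall s, oint (fun z => bump rb z * D (s - z)) (- rb) rb = 0.
  apply/subr0_eq; apply: (@bump_oint_eq0 _ D s 1); [by []|exact: lip1_continuous|].
  by move=> rb /andP[? ?]; exact: H.
move=> rb0 rb1 {}s; have rb0' := ltW rb0.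
have lb e : lip1 (bump e) := smooth_lip1 (bump_smooth e).
(* The convolution of [bump rb] with [D]. It is shown to vanish by letting [bump eps] concentrate,
   with [eps < 1/4] as [trace_eq] demands; a second localisation then gives [D s = 0]. *)
pose H z := oint (fun y => bump rb y * D (z - y)) (- rb) rb.
have cH : continuous H.
  apply: lip1_continuous; apply: (@lip2_oint _ (fun z y => bump rb y * D (z - y))).
  apply: lip2M; first by apply: lip2_sym; exact: (@lip2_fst _ (bump rb)).
  by apply: lip2_sym; exact: (@lip2_sub _ D).
have q0 : 0 < 4^-1 :> R by rewrite invr_gt0.
apply: (bump_oint_eq0 q0 cH) => eps /andP[eps0 eps4].
have eps0' := ltW eps0; have eps4' := ltW eps4.
have sb := bump_smooth eps; have cb := bump_csupp eps0.
have sgb := bump_smooth rb; have cgb := bump_csupp rb0.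
pose A := mollified u1 (bump eps) 1.
have AE t : A t = mollified u2 (bump eps) 1 t by exact: (trace_eq _ sb cb eps0' eps4').
have lA : lip1 A by apply: smooth_lip1; exact: mollified_smooth hu1 ler01 sb cb.
have cA := lip1_continuous lA.
have bgb := csupp_bsmooth sgb cgb.
apply: (@convolution_cancel _ A (response (extend0 q1) (bump rb)) D (bump eps) (bump rb) eps
  (1 + rb) (1 + r) rb) => //.
- exact: response_lip1.
- by rewrite addr_ge0.
- by rewrite addr_ge0.
- exact: response_supp.
- move=> z T hT; apply: (response_identity hu1 ip1 hN1 sb cb eps0'
    (bsmooth_primitive sgb cgb) _ cgb rb0' hT).
  by rewrite (der_derive1 (oint_der _ (smooth_continuous sgb))).
- move=> z T hT; have E := esym (der_derive1 (oint_der (- r) (smooth_continuous sg))).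
  have h1 : oint (fun t => A t * response (extend0 q1) gam (z - t)) (- T) T = _
    := response_identity hu1 ip1 hN1 sb cb eps0' (bsmooth_primitive sg cg) E cg r0 hT.
  have AE2 : mollified u2 (bump eps) 1 = A by apply/funext => t; rewrite AE.
  have := response_identity hu2 ip2 hN2 sb cb eps0' (bsmooth_primitive sg cg) E cg r0 hT.
  rewrite AE2 => h2.
  have cc (p : R -> R) : (forall x y, ig x y p) ->
      continuous (fun t => A t * response p gam (z - t)).
    move=> ip; apply: contM => //; apply: cont_refl; apply: lip1_continuous.
    exact: response_lip1.
  have -> : (fun t => A t * D (z - t)) = fun t => A t * response (extend0 q1) gam (z - t)
      - A t * response (extend0 q2) gam (z - t) by apply/funext => t; rewrite /D mulrBr.
  by rewrite (ointB (- T) T (cc _ ip1) (cc _ ip2)) [X in X - _]h1 [X in _ - X]h2 subrr.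
Qed.

End SameData.

(** * Products of two regular solutions *)

Section SelfConvolution.
Context {R : realType}.
Implicit Types (c : R -> R) (eps s t x y z h k : R).

Definition selfconv c eps z := oint (fun t => c t * c (z - t)) (- eps) eps.

Lemma selfconv_lip1 c eps : smooth c -> lip1 (selfconv c eps).
Proof.
move=> sc; have lc := smooth_lip1 sc.
apply: (@lip2_oint _ (fun z t => c t * c (z - t))); apply: lip2M.
  by apply: lip2_sym; exact: (@lip2_fst _ c).
by apply: lip2_sym; exact: (@lip2_sub _ c).
Qed.

Lemma selfconv_supp c eps z : 0 <= eps -> smooth c -> csupp eps c -> 2 * eps <= `|z| ->
  selfconv c eps z = 0.
Proof.
move=> e0 sc cc ez; have cc0 := smooth_continuous sc; apply: oint_eq0.
- by apply: contM => //; exact: cont_refl.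
- by lra.
move=> t /andP[t1 t2]; rewrite (cc (z - t)) ?mulr0//.
by move: ez; rewrite ler_normr ltr_normr => /orP[ez|ez]; apply/orP; [left|right]; lra.
Qed.

Lemma selfconv_shift c eps s h k a b : 0 <= eps -> smooth c -> csupp eps c ->
  a + h <= - eps -> eps <= b + h ->
  oint (fun t => c (t + h) * c (s - t + k)) a b = selfconv c eps (s + h + k).
Proof.
move=> e0 sc cc ah bh; have cc0 := smooth_continuous sc.
pose f t := c t * c (s + h + k - t).
have cf : continuous f by apply: contM => //; exact: cont_refl.
have -> : (fun t => c (t + h) * c (s - t + k)) = fun t => f (t + h).
  by apply/funext => t; congr (_ * c _); ring.
rewrite (oint_shift _ _ _ cf) /selfconv -/f; apply: oint_supp => //; first by lra.
  by move=> t te; rewrite /f cc ?mul0r// ltr_normr; apply/orP; right; lra.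
by move=> t te; rewrite /f cc ?mul0r// ltr_normr; apply/orP; left; lra.
Qed.

(** D'Alembert's formula produces [selfconv] at [s + 2 x], twice at [s], and at [s - 2 x]. As
    [s > 2 eps], only the last one can be nonzero. *)
Lemma free_product c gam eps x s a b : 0 <= eps -> smooth c -> csupp eps c -> gam = (c^`())%classic ->
  0 <= x -> a + x <= - eps -> eps <= b - x -> 2 * eps < s ->
  oint (fun t => free_solution gam x t * free_solution gam x (s - t)) a b
    = 4^-1 * selfconv c eps (s - 2 * x).
Proof.
move=> e0 sc cc gE x0 ax bx es; have cc0 := smooth_continuous sc.
have dc : der c gam by rewrite gE; exact: smooth_der.
have c1 h : continuous (fun t => c (t + h)) by exact: cont_shift.
have c2 k : continuous (fun t => c (s - t + k)).
  by apply: (@cont_refl _ (fun t => c (t + k))); exact: cont_shift.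
have cT h k : continuous (fun t => c (t + h) * c (s - t + k)) by exact: contM.
have -> : (fun t => free_solution gam x t * free_solution gam x (s - t)) = fun t =>
    4^-1 * ((c (t + x) * c (s - t + x) - c (t + x) * c (s - t + - x))
      - (c (t + - x) * c (s - t + x) - c (t + - x) * c (s - t + - x))).
  by apply/funext => t; rewrite !(free_solution_primitive _ _ dc); field.
rewrite ointZ; last by apply: contB; exact: contB.
rewrite !ointB//; try by exact: contB.
rewrite !(@selfconv_shift c eps)//; try lra.
have S z : 2 * eps < z -> selfconv c eps z = 0.
  by move=> ez; apply: selfconv_supp => //; apply: (le_trans (ltW ez)); exact: ler_norm.
congr (_ * _); rewrite (S (s + x + x)); last by lra.
rewrite (S (s + x + - x)); last by lra.
rewrite (S (s + - x + x)); last by lra.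
by rewrite !subrr !sub0r opprK; congr selfconv; ring.
Qed.

(** Two translates of [c], each with weight 1/2. An [L^1] bound of 1 lets the product of a free
    solution with a bounded error be estimated by the error alone. *)
Lemma free_solution_mass c gam eps x a b : 0 <= eps -> smooth c -> csupp eps c ->
  gam = (c^`())%classic -> (forall t, 0 <= c t) -> oint c (- eps) eps = 1 ->
  0 <= x -> a + x <= - eps -> eps <= b - x ->
  continuous (free_solution gam x) /\ oint (fun t => `|free_solution gam x t|) a b <= 1.
Proof.
move=> e0 sc cc gE c0 c1 x0 ax bx; have cc0 := smooth_continuous sc.
have dc : der c gam by rewrite gE; exact: smooth_der.
have E : free_solution gam x = fun t => 2^-1 * (c (t + x) - c (t + - x)).
  by apply/funext => t; exact: free_solution_primitive.
have cf : continuous (free_solution gam x).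
  by rewrite E; apply: contM; [exact: cont_cst|apply: contB; exact: cont_shift].
split=> //; have ab : a <= b by lra.
have cp h : continuous (fun t => c (t + h)) by exact: cont_shift.
have mass h : a + h <= - eps -> eps <= b + h -> oint (fun t => c (t + h)) a b = 1.
  move=> ah bh; rewrite oint_shift// -c1; apply: oint_supp => //; first by lra.
    by move=> t te; rewrite cc// ltr_normr; apply/orP; right; lra.
  by move=> t te; rewrite cc// ltr_normr; apply/orP; left; lra.
have m1 : oint (fun t => 2^-1 * (c (t + x) + c (t + - x))) a b = 1.
  rewrite ointZ; last exact: contD.
  by rewrite ointD// (mass x) ?(mass (- x)); [field|lra|lra|lra|lra].
rewrite -[leRHS]m1; apply: oint_le => //.
- exact: cont_abs.
- by apply: contM; [exact: cont_cst|exact: contD].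
move=> t _; rewrite E normrM ger0_norm ?invr_ge0// ler_wpM2l ?invr_ge0//.
by rewrite ler_norml; have := c0 (t + x); have := c0 (t + - x) => *; apply/andP; split; lra.
Qed.

Lemma oint_mul_bound (f g : R -> R) M a b : continuous f -> continuous g -> a <= b ->
  (forall t, `|g t| <= M) -> `|oint (fun t => f t * g t) a b| <= oint (fun t => `|f t|) a b * M.
Proof.
move=> cf cg ab gM; have cfg : continuous (fun t => f t * g t) by exact: contM.
apply: (le_trans (oint_norm cfg ab)); rewrite [leRHS]mulrC -ointZ; last exact: cont_abs.
apply: oint_le => //; [by apply: cont_abs; exact: contM|by apply: contM; [exact: cont_cst|exact: cont_abs]|].
by move=> t _; rewrite normrM [leLHS]mulrC ler_wpM2r.
Qed.

End SelfConvolution.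

(** The right-hand side of [regular_free_diff] when [c] has mass one. *)
Definition free_error (R : realType) (p : R -> R) : R := 2 * expR (growth p) * growth p.

(** Two mixed terms, and the product of the two errors over a time window of length at most 10. *)
Definition cross_const (R : realType) (p1 p2 : R -> R) : R :=
  free_error p1 + free_error p2 + free_error p1 * free_error p2 * 10.

(** * The orthogonality relation for two potentials *)

Section EqualResponses.
Context {R : realType} (p1 p2 : R -> R).
Context (ip1 : forall x y, ig x y p1) (ip2 : forall x y, ig x y p2).
Context (N : R -> R) (hN1 : forall x y, x <= y -> itg x y (fun s => 1 + `|p1 s|) <= N y - N x).
Context (hN2 : forall x y, x <= y -> itg x y (fun s => 1 + `|p2 s|) <= N y - N x).
Context (hN12 : forall x y, x <= y -> itg x y (fun s => `|p1 s - p2 s|) <= N y - N x).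
Context (same : forall gam r s, smooth gam -> csupp r gam -> 0 <= r ->
  response p1 gam s = response p2 gam s).
Context (c : R -> R) (eps : R) (hc : mollifier eps c) (eps0 : 0 < eps) (eps1 : eps <= 1).
Implicit Types (s t x y : R).

Let gam := (c^`())%classic.
Let gam1 := (gam^`())%classic.
Let sc : smooth c. Proof. by have [] := hc. Qed.
Let cc : csupp eps c. Proof. by have [] := hc. Qed.
Let c0 t : 0 <= c t. Proof. by have [] := hc. Qed.
Let mc : oint c (- eps) eps = 1. Proof. by have [] := hc. Qed.
Let bc : bsmooth c. Proof. exact: csupp_bsmooth sc cc. Qed.
Let bg : bsmooth gam. Proof. exact: bsmooth_derive1. Qed.
Let sg : smooth gam. Proof. exact: bsmooth_smooth. Qed.
Let cg : csupp eps gam. Proof. exact: csupp_der cc (smooth_der sc). Qed.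
Let bg1 : bsmooth gam1. Proof. exact: bsmooth_derive1. Qed.
Let cg1 : csupp eps gam1. Proof. exact: csupp_der cg (smooth_der sg). Qed.
Let one01 : (0 : R) <= 1 <= (1 : R). Proof. by rewrite ler01 lexx. Qed.
Let der_even (f g : R -> R) t : (forall t, f (- t) = - f t) -> der f g -> g (- t) = g t.
Proof.
move=> fo fg; have h : der (fun t => - f t) (fun t => - g (0 - t)).
  have -> : (fun t => - f t) = fun t => f (0 - t) by apply/funext => z; rewrite sub0r fo.
  exact: der_refl.
by have := der_unique h (derN fg) t; rewrite sub0r => /oppr_inj.
Qed.

Let gam_odd t : gam (- t) = - gam t.
Proof.
have ev z : c (0 - z) = c z by rewrite sub0r; have [] := hc.
have h : der c (fun t => - gam (0 - t)).
  by have := der_refl 0 (smooth_der sc); rewrite (_ : (fun t => c (0 - t)) = c)//; exact/funext.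
by have := der_unique h (smooth_der sc) t; rewrite -/gam sub0r => <-; rewrite opprK.
Qed.

(* By parity, the two terms of the response separate. *)
Let same_cauchy t : regular p1 gam 1 t = regular p2 gam 1 t /\ regular_x p1 gam 1 t = regular_x p2 gam 1 t.
Proof.
have ev p z : (forall x y, ig x y p) -> regular p gam1 1 (- z) = regular p gam1 1 z.
  move=> ip; apply: (@der_even (regular p gam 1)); last exact: regular_der.
  by move=> ?; apply: regular_odd => //; exact: gam_odd.
have od p z : (forall x y, ig x y p) -> regular_x p gam 1 (- z) = - regular_x p gam 1 z.
  by move=> ip; apply: regular_x_odd => //; exact: gam_odd.
have e z := same z sg cg (ltW eps0); rewrite /response -/gam1 in e.
have x_eq z : regular_x p1 gam 1 z = regular_x p2 gam 1 z.
  have half (a b a' b' : R) : a + b = a' + b' -> a - b = a' - b' -> b = b' by lra.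
  by apply: half (e z) _; have := e (- z); rewrite (ev _ z ip1) (ev _ z ip2) (od _ z ip1) (od _ z ip2).
have d_eq z : regular p1 gam1 1 z = regular p2 gam1 1 z by have := e z; rewrite x_eq => /addIr.
split=> //; apply/subr0_eq.
have d0 : der (fun t => regular p1 gam 1 t - regular p2 gam 1 t) (fun=> 0).
  apply: der_ext (derB (regular_der ip1 bg one01) (regular_der ip2 bg one01)) _ => z.
  by rewrite -/gam1 d_eq subrr.
(* The time derivatives agree, so the difference is constant in [t]; [2 + eps] is a time outside
   both supports. *)
rewrite (der0_cst d0 t (2 + eps)).
have far : 1 + eps < `|2 + eps| by apply: lt_le_trans (ler_norm _); lra.
by rewrite (regular_supp ip1 bg cg one01 far) (regular_supp ip2 bg cg one01 far) subrr.
Qed.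

(** The window [[s - 5, 5]] is invariant under [t -> s - t]. For [s <= 2] its ends lie outside the
    supports of the solutions, which are contained in [|t| <= 2]. *)
Let om s x := oint (fun t => regular p1 gam x t * regular p2 gam x (s - t)) (s - 5) 5.

Lemma cross_identity s : s <= 2 ->
  (forall x y, 0 <= x -> y <= 1 -> ig x y (fun x => (p1 x - p2 x) * om s x)) /\
  itg 0 1 (fun x => (p1 x - p2 x) * om s x) = 0.
Proof.
move=> s2; have ac : s - 5 <= 5 by lra.
have H1 := regular_wave_solution ip1 hN1 bc (erefl gam) (erefl gam1).
have H2 := wave_solution_refl s (regular_wave_solution ip2 hN2 bc (erefl gam) (erefl gam1)).
have hN x y : 0 <= x -> x <= y -> y <= 1 ->
    [/\ y - x <= N y - N x, `|itg 0 y p1 - itg 0 x p1| <= N y - N x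
      & `|itg 0 y p2 - itg 0 x p2| <= N y - N x].
  move=> x0 xy _; have [h _] := N_incr ip1 hN1 xy.
  by split; [exact: h|exact: N_primitive|exact: N_primitive].
have far p x : (forall x y, ig x y p) -> 0 <= x <= 1 -> regular p gam x 5 = 0 /\ regular p gam1 x 5 = 0.
  move=> ip x01; have /andP[_ x1] := x01.
  have h : x + eps < `|5 : R| by rewrite ger0_norm//; have := eps1; lra.
  by split; [exact: regular_supp h|exact: regular_supp h].
have bd x : 0 <= x <= 1 -> regular p1 gam1 x 5 * regular p2 gam x (s - 5)
    - regular p1 gam x 5 * - regular p2 gam1 x (s - 5)
    - (regular p1 gam1 x (s - 5) * regular p2 gam x (s - (s - 5))
    - regular p1 gam x (s - 5) * - regular p2 gam1 x (s - (s - 5))) = 0.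
  move=> x01; have [-> ->] := far p1 x ip1 x01.
  by rewrite subKr; have [-> ->] := far p2 x ip2 x01; rewrite oppr0 !(mul0r, mulr0) !subrr.
have ir x y : ig x y (fun s => p1 s - p2 s) by exact: igB.
split; first exact: (green_integrable H1 H2 ler01 ac hN ir).
apply: (etrans (esym (green_source H1 H2 ler01 ac hN bd ir _ _))).
- move=> x y x0 xy _; rewrite (@itg_split _ 0 y x p1)// (@itg_split _ 0 y x p2)// itgB//; ring.
- by move=> x y _ xy _; exact: hN12.
- apply/eqP; rewrite subr_eq0; apply/eqP.
  have -> : (fun t => regular_x p1 gam 0 t * regular p2 gam 0 (s - t)
      - regular p1 gam 0 t * regular_x p2 gam 0 (s - t)) = fun=> 0.
    by apply/funext => t; rewrite (regular_0 ip1 _ bg) (regular_0 ip2 _ bg) mulr0 mul0r subrr.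
  rewrite oint0.
  have cf : continuous (regular p1 gam 1) by exact: smooth_continuous (regular_smooth ip1 bg one01).
  have cx : continuous (regular_x p1 gam 1) by apply: lip1_continuous; exact: regular_x_lip1.
  (* Equal Cauchy data at [x = 1] turn the Wronskian into [h t - h (s - t)], whose integral over the
     invariant window is zero. At [x = 0] it vanishes because both solutions do. *)
  pose h t := regular_x p1 gam 1 t * regular p1 gam 1 (s - t).
  have ch : continuous h by apply: contM => //; exact: cont_refl.
  have -> : (fun t => regular_x p1 gam 1 t * regular p2 gam 1 (s - t)
      - regular p1 gam 1 t * regular_x p2 gam 1 (s - t)) = fun t => h t - h (s - t).
    apply/funext => t; rewrite /h subKr; have [<- _] := same_cauchy (s - t).
    by have [_ <-] := same_cauchy (s - t); congr (_ - _); exact: mulrC.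
  rewrite ointB//; last exact: cont_refl.
  by rewrite (oint_refl _ _ _ ch) subKr subrr.
Qed.


Let reg_diff p x t : (forall x y, ig x y p) -> 0 <= x <= 1 ->
  `|regular p gam x t - free_solution gam x t| <= free_error p.
Proof.
move=> ip x01; have := regular_free_diff ip t sc cc (ltW eps0) c0 x01.
by rewrite mc mul1r.
Qed.

(** Each solution is its free part plus a bounded error. Mixed terms cost the error times the unit
    mass of the free part; the product of the errors is multiplied by the length of the window. *)
Lemma cross_product_diff s x : 2 * eps < s -> s <= 2 -> 0 <= x <= 1 ->
  `|4^-1 * selfconv c eps (s - 2 * x) - om s x| <= cross_const p1 p2.
Proof.
move=> es s2 x01; have /andP[x0 x1] := x01; have e1 := eps1; have e0 := eps0.
have l1 : s - 5 + x <= - eps by lra.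
have l2 : eps <= 5 - x by lra.
rewrite -(free_product (ltW eps0) sc cc (erefl gam) x0 l1 l2 es).
have [cf m1] := free_solution_mass (ltW eps0) sc cc (erefl gam) c0 mc x0 l1 l2.
set f := free_solution gam x in cf m1 *; rewrite /om.
set w1 := regular p1 gam x; set w2 := regular p2 gam x.
have cw1 : continuous w1 by exact: smooth_continuous (regular_smooth ip1 bg x01).
have cw2 : continuous w2 by exact: smooth_continuous (regular_smooth ip2 bg x01).
have cfs : continuous (fun t => f (s - t)) by exact: cont_refl.
have cws : continuous (fun t => w2 (s - t)) by exact: cont_refl.
have c1 : continuous (fun t => w1 t - f t) by exact: contB.
have c2 : continuous (fun t => w2 (s - t) - f (s - t)) by exact: contB.
have b1 t : `|w1 t - f t| <= free_error p1 by exact: reg_diff.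
have b2 t : `|w2 (s - t) - f (s - t)| <= free_error p2 by exact: reg_diff.
have k1 : 0 <= free_error p1 := le_trans (normr_ge0 _) (b1 0).
have k2 : 0 <= free_error p2 := le_trans (normr_ge0 _) (b2 0).
have ac : s - 5 <= 5 by lra.
have mf : oint (fun t => `|f (s - t)|) (s - 5) 5 <= 1.
  by rewrite (@oint_refl _ (fun t => `|f t|)) ?subKr//; exact: cont_abs.
have -> : oint (fun t => f t * f (s - t)) (s - 5) 5 - oint (fun t => w1 t * w2 (s - t)) (s - 5) 5
  = - (oint (fun t => f t * (w2 (s - t) - f (s - t))) (s - 5) 5
    + oint (fun t => f (s - t) * (w1 t - f t)) (s - 5) 5
    + oint (fun t => (w1 t - f t) * (w2 (s - t) - f (s - t))) (s - 5) 5).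
  have h1 : continuous (fun t => f t * (w2 (s - t) - f (s - t))) by exact: contM.
  have h2 : continuous (fun t => f (s - t) * (w1 t - f t)) by exact: contM.
  have h3 : continuous (fun t => (w1 t - f t) * (w2 (s - t) - f (s - t))) by exact: contM.
  have h4 : continuous (fun t => f t * f (s - t)) by exact: contM.
  have h5 : continuous (fun t => w1 t * w2 (s - t)) by exact: contM.
  rewrite -(ointD _ _ h1 h2) -(ointD _ _ (contD h1 h2) h3) -(ointN _ _ (contD (contD h1 h2) h3)).
  rewrite -(ointB _ _ h4 h5).
  by congr (oint _ _ _); apply/funext => t; ring.
rewrite normrN; apply: (le_trans (ler_normD _ _)); apply: lerD; last first.
  apply: (le_trans (@oint_abs_le _ _ (free_error p1 * free_error p2) _ _ _ ac _)); first exact: contM.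
    by move=> t _; exact: ler_norm_mul.
  have len : 5 - (s - 5) <= 10 by lra.
  exact: ler_wpM2l (mulr_ge0 k1 k2) _ _ len.
apply: (le_trans (ler_normD _ _)); rewrite addrC; apply: lerD.
  by apply: (le_trans (oint_mul_bound cfs c1 ac b1)); rewrite -[leRHS]mul1r ler_wpM2r.
by apply: (le_trans (oint_mul_bound cf c2 ac b2)); rewrite -[leRHS]mul1r ler_wpM2r.
Qed.

(** The two factors live in [|t| <= x + eps] and [|s - t| <= x + eps], which are then disjoint. *)
Lemma cross_product_early s x : 0 <= x <= 1 -> 2 * (x + eps) < s -> om s x = 0.
Proof.
move=> x01 xs; have /andP[x0 x1] := x01.
rewrite /om (_ : (fun t => _) = fun=> 0) ?oint0//; apply/funext => t.
have [te|te] := ltP (x + eps) t.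
  by rewrite (regular_supp ip1 bg cg x01) ?mul0r//; apply: lt_le_trans (ler_norm _).
by rewrite (regular_supp ip2 bg cg x01) ?mulr0//; apply: lt_le_trans (ler_norm _); lra.
Qed.

Lemma cross_estimate y : 2 * eps < y -> y <= 1 ->
  `|itg 0 1 (fun x => (p1 x - p2 x) * (4^-1 * selfconv c eps (2 * y - 2 * x)))|
    <= cross_const p1 p2 * itg (y - 2 * eps) 1 (fun x => `|p1 x - p2 x|).
Proof.
move=> ey y1; have e0 := eps0; have s2 : 2 * y <= 2 by lra.
have [io I0] := cross_identity s2.
have ir a b : ig a b (fun s => p1 s - p2 s) by exact: igB.
have lG := lip1_continuous (selfconv_lip1 eps sc).
have cG : continuous (fun x => 4^-1 * selfconv c eps (2 * y - 2 * x)).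
  apply: contM; first exact: cont_cst.
  apply: (@cont_comp _ (selfconv c eps)) => //.
  by apply: contB; [exact: cont_cst|apply: contM; [exact: cont_cst|move=> t; exact: cvg_id]].
have iG a b := ig_mul (ir a b) cG.
rewrite -[X in `|X|]subr0 -[X in _ - X]I0 -itgB//; last exact: io.
(* To the left of [y - 2 eps] both products vanish. This is what makes the inequality of Volterra
   type, with an integral over [[y, 1]] only, up to [2 eps]. *)
rewrite (@itg_split _ 0 1 (y - 2 * eps)); [|lra|lra|by apply: igB => //; exact: io].
rewrite (@itg_eq _ 0 (y - 2 * eps) _ (fun=> 0)); last first.
  move=> x /andP[x0 x1]; have x01 : 0 <= x <= 1 by apply/andP; split; lra.
  rewrite (@cross_product_early _ x)//; last by lra.
  rewrite (selfconv_supp (ltW e0) sc cc) ?mulr0 ?subr0//.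
  by apply: le_trans (ler_norm _); lra.
rewrite itg0 add0r -itgZ; last exact: ig_abs.
apply: itg_bound; [by apply: igZ; exact: ig_abs|by apply: igB => //; apply: io; lra|].
move=> x /andP[x0 x1]; rewrite -mulrBr mulrC; apply: ler_norm_mul => //.
by apply: cross_product_diff => //; [lra|apply/andP; split; lra].
Qed.

End EqualResponses.

(** * Lebesgue points *)

Section Localization.
Context {R : realType}.
Local Notation mu := (@lebesgue_measure R).
Implicit Types (p c : R -> R) (x y r e eps t B C : R).

Let ig_cst (a b k : R) : ig a b (fun _ => k).
Proof. by apply: ig_cont; exact: cont_cst. Qed.

Lemma lebesgue_pt_itg p y e : mu.-integrable setT (EFin \o p) -> lebesgue_pt p y -> 0 < e ->
  exists2 d, 0 < d & forall r, 0 < r -> r < d -> itg (y - r) (y + r) (fun x => `|p x - p y|) <= e * r.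
Proof.
(* The interval has length [2 r], so an average below [e / 2] is an integral below [e r]. *)
move=> ip Hy e0; have e20 : (0 < (e / 2)%:E)%E by rewrite lte_fin divr_gt0.
have := Hy _ (open_ereal_lt' e20).
case=> d /= d0 Hd; exists d => // r r0 rd.
have : (davg p y r < (e / 2)%:E)%E.
  by apply: Hd => //=; rewrite sub0r normrN gtr0_norm.
pose f x := `|p x - p y|.
have If : ig (y - r) (y + r) f.
  apply: ig_abs; apply: igB; last exact: ig_cst.
  exact: integrableS ip.
rewrite /davg /iavg lebesgue_measure_ball ?(ltW r0)// ball_itv.
rewrite -(@integral_itv_bndoo _ (y - r) (y + r) _ false false); last first.
  apply: measurable_funS (_ : measurable_fun `]y - r, y + r] _) => //.
    by apply: subset_itvl; rewrite bnd_simp.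
  by have /measurable_int := If.
rewrite (_ : integral _ _ _ = (itg (y - r) (y + r) f)%:E); last first.
  rewrite /itg /Rintegral fineK//.
  exact: (integrable_fin_num _ If).
rewrite inver mulrn_eq0 /= gt_eqF// -EFinM lte_fin => h.
have r2 : 0 < r *+ 2 by rewrite mulrn_wgt0.
move: h; rewrite ltr_pdivrMl// => /ltW h; apply: (le_trans h).
by rewrite (_ : r *+ 2 * (e / 2) = e * r)//; rewrite mulr2n; field.
Qed.

(** Dilates of one mollifier. The supremum [B / eps] is compensated at a Lebesgue point by the
    integral of the oscillation over a width of order [eps], which is small compared with [eps]. *)
Lemma mollifier_family : exists2 B, 0 <= B &
  forall eps, 0 < eps -> exists2 c, mollifier eps c & forall t, c t <= B / eps.
Proof.
have [rho [s1 s2 s3 s4 s5]] := @exists_mollifier R 1 ltr01.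
have cr := smooth_continuous s1; have [M HM] := csupp_bounded cr s2.
exists M; first exact: le_trans (normr_ge0 _) (HM 0).
move=> eps e0; have en : eps != 0 by rewrite gt_eqF.
exists (fun t => eps^-1 * rho (eps^-1 * t + 0)); last first.
  move=> t; rewrite mulrC ler_pM2r ?invr_gt0//; exact: le_trans (ler_norm _) (HM _).
split.
- exact: smooth_affine.
- move=> t et; rewrite s2 ?mulr0// addr0 normrM (@gtr0_norm _ eps^-1) ?invr_gt0//.
  by rewrite mulrC ltr_pdivlMr// mul1r.
- by move=> t; rewrite mulr_ge0// invr_ge0 ltW.
- by move=> t; rewrite !addr0 mulrN s4.
have D : der (oint rho 0) rho by exact: oint_der.
have D' := der_comp D (der_affine eps^-1 0).
rewrite (oint_FTC _ _ (der_ext D' _)); last by move=> t; rewrite mulrC.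
by rewrite !addr0 mulrN mulVf// -[RHS]s5 -(oint_chasles rho 0 (-1) 1) (oint_sym rho 0 (-1)); ring.
Qed.

Lemma selfconv_bound c eps B z : 0 < eps -> mollifier eps c -> (forall t, c t <= B) ->
  `|selfconv c eps z| <= B.
Proof.
move=> e0 [s1 s2 s3 s4 s5] cB; have cc := smooth_continuous s1; have e1 := ltW e0.
have ee : - eps <= eps by lra.
have cz : continuous (fun t => c (z - t)) by exact: cont_refl.
have b t : `|c (z - t)| <= B by rewrite ger0_norm.
apply: (le_trans (oint_mul_bound cc cz ee b)).
rewrite (_ : (fun t => `|c t|) = c) ?s5 ?mul1r//.
by apply/funext => t; rewrite ger0_norm.
Qed.

(** The convolution of [c] with itself has mass one, and the change of variable [z = 2 y - 2 x]
    halves it. *)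
Lemma selfconv_mass c eps y : 0 < eps -> mollifier eps c ->
  oint (fun x => selfconv c eps (2 * y - 2 * x)) (y - 2 * eps) (y + 2 * eps) = 2^-1.
Proof.
move=> e0 [s1 s2 s3 s4 s5]; have cc := smooth_continuous s1; have lc := smooth_lip1 s1.
have lG := @selfconv_lip1 _ c eps s1; have cG := lip1_continuous lG.
have cl t a b : a <= - eps + t -> eps + t <= b -> oint (fun z => c (z - t)) a b = 1.
  move=> h1 h2; rewrite (oint_shift _ _ _ cc) -s5; apply: oint_supp => //; try lra.
    by move=> z ze; rewrite s2// ltr_normr; apply/orP; right; lra.
  by move=> z ze; rewrite s2// ltr_normr; apply/orP; left; lra.
have mass : oint (selfconv c eps) (- (4 * eps)) (4 * eps) = 1.
  rewrite /selfconv (@oint_swap _ (fun z t => c t * c (z - t))); last first.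
    apply: lip2M; first by apply: lip2_sym; exact: (@lip2_fst _ c).
    by apply: lip2_sym; exact: (@lip2_sub _ c).
  rewrite -[RHS]s5; apply: oint_eq => //; last 2 first.
  - by lra.
  - move=> t /andP[t1 t2]; rewrite ointZ; last exact: cont_shift.
    by rewrite cl ?mulr1//; lra.
  apply: lip1_continuous; apply: (@lip2_oint _ (fun t z => c t * c (z - t))).
  by apply: lip2M; [exact: (@lip2_fst _ c)|exact: (@lip2_sub _ c)].
have D := der_comp (oint_der (- (4 * eps)) cG) (der_affine (-2) (2 * y)).
have D2 := derZ (- 2^-1) D.
have -> : (fun x => selfconv c eps (2 * y - 2 * x)) = fun x => selfconv c eps (-2 * x + 2 * y).
  by apply/funext => x; congr selfconv; ring.
rewrite (oint_FTC _ _ (der_ext D2 _)) /=; last by move=> t; field.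
have -> : -2 * (y + 2 * eps) + 2 * y = - (4 * eps) by ring.
have -> : -2 * (y - 2 * eps) + 2 * y = 4 * eps by ring.
by rewrite mass ointxx; field.
Qed.

(** The kernel concentrates at [y] and has mass [1/8]: the factor [4^-1] times the one half of
    [selfconv_mass]. Hence the factor 8. *)
Lemma lebesgue_pt_estimate p C y : mu.-integrable setT (EFin \o p) -> 0 <= C -> 0 < y < 1 ->
  lebesgue_pt p y ->
  (forall c eps, mollifier eps c -> 0 < eps -> eps <= 1 -> 2 * eps < y ->
    `|itg 0 1 (fun x => p x * (4^-1 * selfconv c eps (2 * y - 2 * x)))|
      <= C * itg (y - 2 * eps) 1 (fun x => `|p x|)) ->
  `|p y| <= 8 * C * itg y 1 (fun x => `|p x|).
Proof.
move=> ip C0 /andP[y0 y1] Ly H.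
have I a b : ig a b p by exact: integrableS ip.
have Ia a b : ig a b (fun x => `|p x|) by exact: ig_abs.
have Id a b : ig a b (fun x => p x - p y) by apply: igB => //; exact: ig_cst.
have Ida a b : ig a b (fun x => `|p x - p y|) by exact: ig_abs.
set Mv := itg y 1 _; have [B B0 HB] := mollifier_family.
(* The errors per unit of [e]: [8 C (1 + 2 |p y|)] for enlarging [[y, 1]] to [[y - 2 eps, 1]], and
   [4 B] for the oscillation of [p] around [y]. *)
pose K := 8 * C * (1 + 2 * `|p y|) + 4 * B.
have K0 : 0 <= K by rewrite addr_ge0 ?mulr_ge0// addr_ge0// mulr_ge0.
apply/ler_addgt0Pr => e' e'0; pose e := e' / (K + 1).
have K1 : 0 < K + 1 by rewrite ltr_wpDl.
have e0 : 0 < e by rewrite divr_gt0.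
suff main : `|p y| <= 8 * C * Mv + K * e.
  apply: (le_trans main); rewrite lerD2l /e mulrA ler_pdivrMr// mulrDr mulr1 mulrC lerDl.
  exact: ltW.
have [d d0 Hd] := lebesgue_pt_itg ip Ly e0.
(* With [eps = m / 4] the interval of radius [2 eps] around [y] lies inside []0, 1[], and both
   [2 eps <= e] and [2 eps < d] hold. *)
pose m := Num.min (Num.min (Num.min d e) (Num.min y (1 - y))) 1.
have m0 : 0 < m by rewrite /m !lt_min d0 e0 y0 subr_gt0 y1 ltr01.
have [md me my m1 mm] : [/\ m <= d, m <= e, m <= y, m <= 1 - y & m <= 1].
  by split; rewrite /m !ge_min ?lexx ?orbT.
pose eps := m / 4; have eps0 : 0 < eps by rewrite divr_gt0.
have em : 2 * eps = m / 2 by rewrite /eps; field.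
have [c hc cB] := HB eps eps0.
have ey : 2 * eps < y by rewrite em; lra.
have e1 : eps <= 1 by rewrite /eps; lra.
have := H c eps hc eps0 e1 ey; have := Hd (2 * eps).
have eyr : y + 2 * eps <= 1 by rewrite em; lra.
have rd : 2 * eps < d by rewrite em; lra.
have re : 2 * eps <= e by rewrite em; lra.
have r1 : 2 * eps <= 1 by rewrite em; lra.
have r0 : 0 < 2 * eps by rewrite mulr_gt0.
have l0 : 0 <= y - 2 * eps by rewrite subr_ge0 ltW.
have l1 : y - 2 * eps <= y by rewrite gerBl ltW.
have l2 : y <= y + 2 * eps by rewrite lerDl ltW.
have ab := le_trans l1 l2.
have [yw y1'] := (le_trans l1 (ltW y1), ltW y1).
move=> /(_ r0 rd) Hint Hest.
have [s1 s2 s3 s4 s5] := hc.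
have cG := lip1_continuous (@selfconv_lip1 _ c eps s1).
pose G x := 4^-1 * selfconv c eps (2 * y - 2 * x).
have cs : continuous (fun x => selfconv c eps (2 * y - 2 * x)).
  apply: (@cont_comp _ (selfconv c eps)) => //.
  by apply: contB; [exact: cont_cst|apply: contM; [exact: cont_cst|move=> t; exact: cvg_id]].
have cGy : continuous G by apply: contM => //; exact: cont_cst.
have IG a b : ig a b (fun x => p x * G x) by exact: ig_mul.
have far x : 2 * eps <= `|y - x| -> G x = 0.
  move=> h; rewrite /G (selfconv_supp (ltW eps0) s1 s2) ?mulr0// -mulrBr normrM ger0_norm//.
  by apply: (le_trans h); rewrite ler_peMl// ler1n.
have E1 : itg 0 1 (fun x => p x * G x) = itg (y - 2 * eps) (y + 2 * eps) (fun x => p x * G x).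
  rewrite (@itg_split _ 0 1 (y - 2 * eps) _ l0 yw (IG _ _)).
  rewrite (@itg_split _ (y - 2 * eps) 1 (y + 2 * eps) _ ab eyr (IG _ _)).
  rewrite (@itg_eq _ 0 (y - 2 * eps) _ (fun=> 0)); last first.
    by move=> x /andP[_ xy]; rewrite far ?mulr0// ler_normr lerBrDl -lerBrDr xy.
  rewrite (@itg_eq _ (y + 2 * eps) 1 _ (fun=> 0)) ?itg0 ?add0r ?addr0// => x /andP[xy _].
  by rewrite far ?mulr0// ler_normr; apply/orP; right; rewrite opprB lerBrDl ltW.
have cb0 (t : R) : c t <= B / eps by exact: cB.
have bG x : `|G x| <= B / (4 * eps).
  rewrite /G normrM ger0_norm ?invr_ge0// invfM mulrCA ler_wpM2l ?invr_ge0//.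
  exact: (selfconv_bound _ eps0 hc cB).
have E2 : itg (y - 2 * eps) (y + 2 * eps) (fun x => p x * G x) = p y / 8
    + itg (y - 2 * eps) (y + 2 * eps) (fun x => (p x - p y) * G x).
  have -> : p y / 8 = itg (y - 2 * eps) (y + 2 * eps) (fun x => p y * G x).
    rewrite itgZ; last exact: ig_cont.
    by rewrite itg_cont// /G ointZ// (selfconv_mass y eps0 hc); field.
  rewrite -itgD; [|by apply: igZ; exact: ig_cont|exact: ig_mul].
  by apply: itg_eq => x _; ring.
have E3 : `|itg (y - 2 * eps) (y + 2 * eps) (fun x => (p x - p y) * G x)| <= B / (4 * eps) * (e * (2 * eps)).
  apply: (@le_trans _ _ (itg (y - 2 * eps) (y + 2 * eps) (fun x => B / (4 * eps) * `|p x - p y|))).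
    apply: itg_bound; [exact: igZ|exact: ig_mul|move=> x _].
    by rewrite mulrC; apply: ler_norm_mul.
  rewrite itgZ// ler_wpM2l// divr_ge0// mulr_ge0//; exact: ltW.
have E4 : itg (y - 2 * eps) 1 (fun x => `|p x|) <= Mv + (e + 2 * e * `|p y|).
  rewrite (@itg_split _ (y - 2 * eps) 1 y _ l1 y1' (Ia _ _)) addrC lerD2l.
  apply: (@le_trans _ _ (itg (y - 2 * eps) (y + 2 * eps) (fun x => `|p x|))).
    rewrite [leRHS](@itg_split _ _ _ y _ l1 l2 (Ia _ _)).
    by rewrite lerDl; apply: itg_ge0.
  apply: (@le_trans _ _ (itg (y - 2 * eps) (y + 2 * eps) (fun x => `|p x - p y| + `|p y|))).
    apply: itg_le => //; first by apply: igD => //; exact: ig_cst.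
    by move=> x _; have := ler_normD (p x - p y) (p y); rewrite subrK.
  rewrite itgD//.
  apply: lerD; first by apply: (le_trans Hint); rewrite ler_piMr// ltW.
  rewrite itg_cont//; last exact: cont_cst.
  rewrite (oint_FTC _ _ (der_affine `|p y| 0)) !addr0 -mulrBr mulrC ler_wpM2r//.
  have -> : y + 2 * eps - (y - 2 * eps) = 2 * (2 * eps) by ring.
  by rewrite ler_wpM2l.
have E5 : `|p y| / 8 <= C * (Mv + (e + 2 * e * `|p y|)) + B * e / 2.
  have -> : `|p y| / 8 = `|p y / 8| by rewrite normrM (@ger0_norm _ 8^-1) ?invr_ge0.
  have -> : p y / 8 = itg 0 1 (fun x => p x * G x)
      - itg (y - 2 * eps) (y + 2 * eps) (fun x => (p x - p y) * G x) by rewrite E1 E2; ring.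
  apply: (le_trans (ler_normB _ _)); apply: lerD.
    by apply: (le_trans Hest); rewrite ler_wpM2l.
  have en : eps != 0 by rewrite gt_eqF.
  by rewrite (_ : B * e / 2 = B / (4 * eps) * (e * (2 * eps)))//; field.
have -> : 8 * C * Mv + K * e = 8 * (C * (Mv + (e + 2 * e * `|p y|)) + B * e / 2).
  by rewrite /K; field.
by rewrite mulrC -ler_pdivrMr.
Qed.

End Localization.

(** * Gronwall's argument almost everywhere *)

Section Uniqueness.
Context {R : realType}.
Local Notation mu := (@lebesgue_measure R).
Implicit Types (p q f g : R -> R) (a b x y K : R).

Let aeF := ae_filter_ringOfSetsType mu.

Lemma itg_ae_le a b f g : ig a b f -> ig a b g -> (forall x, 0 <= f x) -> (forall x, 0 <= g x) ->
  {ae mu, forall x, a < x <= b -> f x <= g x} -> itg a b f <= itg a b g.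
Proof.
move=> If Ig f0 g0 H; rewrite /itg /Rintegral; apply: fine_le.
- exact: (integrable_fin_num _ If).
- exact: (integrable_fin_num _ Ig).
apply: ae_ge0_le_integral => //.
- by move=> x _; rewrite lee_fin.
- exact: measurable_int If.
- by move=> x _; rewrite lee_fin.
- exact: measurable_int Ig.
Qed.

Lemma ae_neq a : {ae mu, forall z, z != a}.
Proof.
exists [set a]; split => //; first exact: lebesgue_measure_set1.
by move=> z /= /negP; rewrite negbK => /eqP.
Qed.

(** Steps backwards from [1]: if the tail integral [M] vanishes at [y] and [K (y - x) <= 1/2],
    integrating the inequality over [[x, y]] gives [M x <= M x / 2]. Finitely many steps reach
    [0]. *)
Lemma ae_volterra_eq0 p K : mu.-integrable setT (EFin \o p) -> 0 <= K ->
  {ae mu, forall y, 0 < y < 1 -> `|p y| <= K * itg y 1 (fun x => `|p x|)} ->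
  {ae mu, forall y, 0 <= y <= 1 -> p y = 0}.
Proof.
move=> ip K0 H; have Ia a b : ig a b (fun x => `|p x|).
  by apply: ig_abs; exact: integrableS ip.
pose M x := itg x 1 (fun x => `|p x|).
have M0 x : 0 <= M x by exact: itg_ge0.
have split x y : x <= y -> y <= 1 -> M x = itg x y (fun x => `|p x|) + M y.
  by move=> xy y1; exact: itg_split.
have step x y : 0 <= x -> x <= y -> y <= 1 -> K * (y - x) <= 2^-1 -> M y = 0 -> M x = 0.
  move=> x0 xy y1 Kxy My0; apply/eqP; rewrite eq_le M0 andbT.
  suff : M x <= 2^-1 * M x by have := M0 x => *; lra.
  rewrite {1}(split x y)// My0 addr0.
  apply: (@le_trans _ _ (itg x y (fun=> K * M x))).
    apply: itg_ae_le => //; [by apply: ig_cont; exact: cont_cst|by move=> _; rewrite mulr_ge0|].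
    move: H (ae_neq 1); apply: (@filterS2 _ _ aeF) => z Hz z1 /andP[xz zy].
    have z01 : 0 < z < 1 by rewrite (le_lt_trans x0 xz) lt_neqAle z1 (le_trans zy).
    apply: (le_trans (Hz z01)); rewrite ler_wpM2l// -/(M z) (split x z) ?(ltW xz)//.
      by rewrite lerDr; exact: itg_ge0.
    exact: le_trans y1.
  rewrite itg_cont//; last exact: cont_cst.
  rewrite (oint_FTC _ _ (der_affine (K * M x) 0)) !addr0 -mulrBr mulrAC.
  by rewrite ler_wpM2r.
(* A step length with [K d <= 1/2]; it makes sense also for [K = 0]. *)
have d0 : 0 < (2 * K + 1)^-1 by rewrite invr_gt0 ltr_wpDl// mulr_ge0.
have Kd : K * (2 * K + 1)^-1 <= 2^-1.
  rewrite ler_pdivrMr; last by rewrite ltr_wpDl// mulr_ge0.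
  by lra.
set d := (2 * K + 1)^-1 in d0 Kd.
have all n x : 0 <= x -> x <= 1 -> 1 - x <= n%:R * d -> M x = 0.
  elim: n x => [|n IH] x x0 x1; first by rewrite mul0r => ?; apply: itg_empty; lra.
  rewrite -natr1 mulrDl mul1r => xn; have [xd|xd] := leP (x + d) 1.
    apply: (step x (x + d)) => //; first by lra.
      by rewrite addrAC subrr add0r.
    by apply: IH; lra.
  apply: (step x 1) => //; last exact: itg_empty.
  by apply: le_trans Kd; rewrite ler_wpM2l//; lra.
have M00 : M 0 = 0.
  have [n Hn] : exists n : nat, d^-1 <= n%:R.
    by exists (Num.bound d^-1); apply: ltW; apply: archi_boundP; rewrite invr_ge0 ltW.
  by apply: (all n) => //; rewrite subr0 -ler_pdivrMr// mul1r.
have I1 : ig 0 1 p by exact: integrableS ip.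
(* [M 0 = 0] says that [|p|] has integral zero over []0, 1]]; the end point [0] is a null set. *)
have : ae_eq mu [set` `]0, 1]] (EFin \o p) (cst 0%E).
  apply/ae_eq_integral_abs => //; first exact: measurable_int I1.
  have <- : (M 0)%:E = 0%E by rewrite M00.
  rewrite /M /itg /Rintegral fineK//; exact: (integrable_fin_num _ (Ia 0 1)).
move=> E; move: E (ae_neq 0); apply: (@filterS2 _ _ aeF) => y Hy y0 /andP[h0 h1].
have : (EFin \o p) y = 0%E by apply: Hy; rewrite /= in_itv/= h1 lt_neqAle eq_sym y0 h0.
by case.
Qed.

Lemma extend0_integrable q : mu.-integrable `[0, 1] (EFin \o q) ->
  mu.-integrable setT (EFin \o extend0 q).
Proof.
rewrite integrable_mkcond//; congr integrable; apply/funext => x; rewrite patchE /= /extend0.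
case: ifPn => [|/negP h]; first by rewrite inE/= in_itv/= => ->.
by case: ifPn => // x01; case: h; rewrite inE/= in_itv.
Qed.

End Uniqueness.

(** * A common dominating primitive, and uniqueness of the potential *)

Section CommonPrimitive.
Context {R : realType}.
Local Notation mu := (@lebesgue_measure R).
Implicit Types (p f : R -> R) (x y : R).

Lemma itg_primitive f x y : mu.-integrable setT (EFin \o f) -> x <= y ->
  itg x y f = \int[mu]_(t in `]-oo, y]) f t - \int[mu]_(t in `]-oo, x]) f t.
Proof.
move=> If xy; rewrite /itg -(@Rintegral_itvB _ f -oo%O (BRight y) x)//.
exact: integrableS If.
Qed.

Lemma cross_const_ge0 (p1 p2 : R -> R) : 0 <= cross_const p1 p2.
Proof.
have g (p : R -> R) : 0 <= free_error p.
  have h : 0 <= growth p by rewrite addr_ge0// mulr_ge0// itg_ge0.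
  by rewrite !mulr_ge0 ?expR_ge0.
exact: addr_ge0 (addr_ge0 (g p1) (g p2)) (mulr_ge0 (mulr_ge0 (g p1) (g p2)) (ler0n R 10)).
Qed.

End CommonPrimitive.

Theorem theorem4p2 (R : realType) (q1 q2 : R -> R)
    (u1 u2 : R -> (R -> R) -> R)
    (hq1 : (@lebesgue_measure R).-integrable `[0, 1] (EFin \o q1))
    (hq2 : (@lebesgue_measure R).-integrable `[0, 1] (EFin \o q2))
    (hu1 : causal_solution q1 u1)
    (hu2 : causal_solution q2 u2)
    (ha : eq_distr_on `]0, +oo[ (u1 1) (u2 1)) :
  {ae @lebesgue_measure R, forall x : R, 0 <= x <= 1 -> q1 x = q2 x}.
Proof.
have If1 := extend0_integrable hq1; have If2 := extend0_integrable hq2.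
set p1 := extend0 q1 in If1; set p2 := extend0 q2 in If2.
have I1 x y : ig x y p1 by exact: integrableS If1.
have I2 x y : ig x y p2 by exact: integrableS If2.
have Ia1 x y : ig x y (fun s => `|p1 s|) by exact: ig_abs.
have Ia2 x y : ig x y (fun s => `|p2 s|) by exact: ig_abs.
pose a x := `|p1 x| + `|p2 x|.
have Ia : lebesgue_measure.-integrable setT (EFin \o a).
  have h1 := integrable_abse If1; have h2 := integrable_abse If2.
  exact: (integrableD measurableT h1 h2).
(* One [N] for both potentials: Green's identity between solutions of the two equations measures
   their remainders by the same function. *)
pose N x := x + (\int[lebesgue_measure]_(t in `]-oo, x]) a t)%R.
have NE x y : x <= y -> N y - N x = (y - x) + (itg x y (fun s => `|p1 s|) + itg x y (fun s => `|p2 s|)).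
  by move=> xy; rewrite -itgD// (itg_primitive Ia xy) /N; ring.
have hN1 x y : x <= y -> itg x y (fun s => 1 + `|extend0 q1 s|) <= N y - N x.
  by move=> xy; rewrite (itg_1_abs I1 xy) NE// lerD2l lerDl; exact: itg_ge0.
have hN2 x y : x <= y -> itg x y (fun s => 1 + `|extend0 q2 s|) <= N y - N x.
  by move=> xy; rewrite (itg_1_abs I2 xy) NE// lerD2l lerDr; exact: itg_ge0.
have hN12 x y : x <= y -> itg x y (fun s => `|p1 s - p2 s|) <= N y - N x.
  move=> xy; rewrite NE//.
  apply: (@le_trans _ _ (itg x y (fun s => `|p1 s| + `|p2 s|))).
    apply: itg_le; [by apply: ig_abs; exact: igB|exact: igD|].
    by move=> s _; exact: ler_normB.
  by rewrite itgD// lerDr subr_ge0.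
have same gam r s : smooth gam -> csupp r gam -> 0 <= r -> response p1 gam s = response p2 gam s.
  exact: (response_eq hu1 hu2 I1 I2 hN1 hN2 ha).
pose p x := p1 x - p2 x.
have Ip : lebesgue_measure.-integrable setT (EFin \o p).
  exact: (integrableB measurableT If1 If2).
have C0 := cross_const_ge0 p1 p2; set C := cross_const p1 p2 in C0.
have aeF := ae_filter_ringOfSetsType (@lebesgue_measure R).
(* Almost every [y] is a Lebesgue point of [p], so the pointwise estimate holds almost everywhere,
   which is the form that [ae_volterra_eq0] accepts. *)
have leb := lebesgue_differentiation (open_integrable_locally openT Ip).
have : {ae @lebesgue_measure R, forall y, 0 <= y <= 1 -> p y = 0}.
  have C80 : 0 <= 8 * C by rewrite mulr_ge0.
  apply: (ae_volterra_eq0 Ip C80).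
  apply: (@filterS _ _ aeF) leb => y Ly y01; have /andP[_ y1] := y01.
  apply: (lebesgue_pt_estimate Ip C0 y01 Ly) => c eps hc eps0 eps1 ey.
  exact: (cross_estimate I1 I2 hN1 hN2 hN12 same hc eps0 eps1 ey (ltW y1)).
apply: (@filterS _ _ aeF) => x Hx x01; apply/subr0_eq.
by have := Hx x01; rewrite /p /p1 /p2 /extend0 x01.
Qed.
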